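(* Let $\Omega\subset\mathbb{R}^n$ be open and bounded with Lipschitz boundary, let $1\le q<\infty$, $0<\gamma\le\Gamma<\infty$, $u_0\in W^{1,q}(\Omega;\mathbb{R}^N)$, and let $F\in C(\mathbb{R}^{N\times n})$ be convex with $\gamma|z|\le F(z)\le\Gamma(1+|z|^q)$ for all $z\in\mathbb{R}^{N\times n}$. Then $$\mathscr{F}[u;\Omega]=\overline{\mathscr{F}}^*_{u_0}[u;\Omega]\qquad\text{for all } u\in u_0+W^{1,q}_0(\Omega;\mathbb{R}^N),$$ and $$\inf_{u_0+W^{1,q}_0(\Omega;\mathbb{R}^N)}\mathscr{F}[\cdot;\Omega]=\min_{BV(\Omega;\mathbb{R}^N)}\overline{\mathscr{F}}^*_{u_0}[\cdot;\Omega]\in(-\infty,\infty).$$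
   Context: Weak*-convergence: $u_j\overset{*}{\rightharpoonup}u$ in $BV(\Omega;\mathbb{R}^N)$ means $u_j\to u$ strongly in $L^1(\Omega;\mathbb{R}^N)$ and $Du_j\overset{*}{\rightharpoonup}Du$ weakly* as finite $\mathbb{R}^{N\times n}$-valued Radon measures on $\Omega$. For $v\in W^{1,q}(\Omega;\mathbb{R}^N)$ put $\mathscr{F}[v;\Omega]:=\int_\Omega F(\nabla v)\,dx$. For $u\in BV(\Omega;\mathbb{R}^N)$ put $$\overline{\mathscr{F}}^*_{u_0}[u;\Omega]:=\inf\Big\{\liminf_{j\to\infty}\int_\Omega F(\nabla u_j)\,dx:\ (u_j)\subset u_0+W^{1,q}_0(\Omega;\mathbb{R}^N),\ u_j\overset{*}{\rightharpoonup}u\text{ in }BV(\Omega;\mathbb{R}^N)\Big\}.$$ *)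

(* Defs.v *)
From HB Require Import structures.
From mathcomp Require Import all_boot all_order all_algebra.
From mathcomp Require Import all_classical all_reals all_analysis.

Set Implicit Arguments.
Unset Strict Implicit.
Unset Printing Implicit Defensive.

Import Order.TTheory GRing.Theory Num.Theory.
Import numFieldNormedType.Exports.

Local Open Scope classical_set_scope.
Local Open Scope ring_scope.

Definition measure_matrix_display : measure_display -> measure_display.
Proof. exact. Qed.

(* Product sigma-algebra of the entries; on 'M[R]_(m, n) with R : realType this *)
(* is the Borel sigma-algebra. *)
Section measurable_matrix.
Context {d} {T : measurableType d}.
Variables m n : nat.

Definition matrix_cylinders : set (set 'M[T]_(m, n)) :=
  [set X | exists i j, exists2 B : set T, measurable B &
     X = [set A : 'M[T]_(m, n) | B (A i j)]].

Let mx_set0 : <<s matrix_cylinders >> set0.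
Proof. exact: sigma_algebra0. Qed.

Let mx_setC A : <<s matrix_cylinders >> A -> <<s matrix_cylinders >> (~` A).
Proof. exact: sigma_algebraC. Qed.

Let mx_bigcup (F : (set 'M[T]_(m, n))^nat) :
  (forall i, <<s matrix_cylinders >> (F i)) ->
  <<s matrix_cylinders >> (\bigcup_i (F i)).
Proof. exact: sigma_algebra_bigcup. Qed.

HB.instance Definition _ := @isMeasurable.Build (measure_matrix_display d)
  'M[T]_(m, n) <<s matrix_cylinders >> mx_set0 mx_setC mx_bigcup.

End measurable_matrix.

Lemma measurable_fun_matrix d1 d2 (T1 : measurableType d1)
    (T2 : measurableType d2) m n (f : T1 -> 'M[T2]_(m, n)) :
  (forall i j, measurable_fun [set: T1] (fun x => f x i j)) ->
  measurable_fun [set: T1] f.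
Proof.
move=> mf; apply: (@measurability _ _ _ _ setT f (@matrix_cylinders _ T2 m n)).
  by [].
by move=> _ [_ [i [j [B mB ->]]] <-]; exact: mf.
Qed.

Lemma measurable_entry d (T : measurableType d) m n i j :
  measurable_fun [set: 'M[T]_(m, n)] (fun A : 'M[T]_(m, n) => A i j).
Proof.
by move=> _ B mB; rewrite setTI; apply: sub_sigma_algebra; exists i, j, B.
Qed.

Section lebesgue_measure_rV.
Context {R : realType}.

Definition consrV n (p : measurableTypeR R * 'rV[R]_n) : 'rV[R]_(1 + n) :=
  row_mx (const_mx p.1) p.2.

Lemma measurable_consrV n : measurable_fun setT (@consrV n).
Proof.
apply: measurable_fun_matrix => i j; rewrite /consrV.
case: (split_ordP j) => k ->.
  under eq_fun do rewrite row_mxEl mxE.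
  exact: (@measurable_fst _ _ (measurableTypeR R)).
under eq_fun do rewrite row_mxEr.
apply: (@measurableT_comp _ _ _ _ _ _ (fun A : 'rV[R]_n => A i k)) => //.
exact: measurable_entry.
Qed.

Fixpoint lebesgue_rV n : set 'rV[R]_n -> \bar R :=
  if n is n'.+1 then
    pushforward (lebesgue_measure \x @lebesgue_rV n')%E (@consrV n')
  else dirac (0 : 'rV[R]_0).

Let is_sigma_finite_measure n (mu : set 'rV[R]_n -> \bar R) :=
  [/\ mu set0 = 0%E, forall A, (0 <= mu A)%E, semi_sigma_additive mu
    & sigma_finite setT mu].

Let consrV_measure n (mu : {sigma_finite_measure set 'rV[R]_n -> \bar R}) :
  is_sigma_finite_measure (pushforward (lebesgue_measure \x mu)%E (@consrV n)).
Proof.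
split.
- by rewrite /pushforward preimage_set0 measure0.
- by move=> A; rewrite /pushforward; exact: measure_ge0.
- move=> F mF tF mUF; rewrite /pushforward preimage_bigcup.
  have mc A : measurable A -> measurable (@consrV n @^-1` A).
    by move=> mA; rewrite -[X in measurable X]setTI; exact: measurable_consrV.
  apply: measure_semi_sigma_additive.
  + by move=> k; exact: mc.
  + apply/trivIsetP => /= i j _ _ ij; rewrite -preimage_setI.
    by move/trivIsetP : tF => /(_ _ _ _ _ ij) ->//; rewrite preimage_set0.
  + by rewrite -preimage_bigcup; exact: mc.
have /sigma_finiteP[F [TF ndF Foo]] := sigma_finiteT (@lebesgue_measure R).
have /sigma_finiteP[G [TG ndG Goo]] := sigma_finiteT mu.
pose g (A : 'rV[R]_(1 + n)) : measurableTypeR R * 'rV[R]_n :=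
  (lsubmx A 0 0, rsubmx A).
have mg : measurable_fun setT g.
  apply/measurable_fun_pairP; split => /=.
    rewrite [X in measurable_fun _ X](_ : _ = fun A : 'rV[R]_(1 + n) =>
        A 0 (lshift n 0)); last by apply/funext => A /=; rewrite mxE.
    exact: (@measurable_entry _ R).
  apply: measurable_fun_matrix => i j.
  rewrite [X in measurable_fun _ X](_ : _ = fun A : 'rV[R]_(1 + n) =>
      A i (rshift 1 j)); last by apply/funext => A /=; rewrite mxE.
  exact: (@measurable_entry _ R).
have cg : cancel (@consrV n) g.
  move=> [x v]; rewrite /g /consrV row_mxKl row_mxKr mxE//.
exists (fun k => g @^-1` (F k `*` G k)).
  rewrite -preimage_bigcup (_ : \bigcup_k _ = setT) ?preimage_setT//.
  apply/seteqP; split => // -[x v] _.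
  have [k _ Fkx] : (\bigcup_k F k) x by rewrite -TF.
  have [l _ Glv] : (\bigcup_k G k) v by rewrite -TG.
  exists (maxn k l) => //; split => /=.
    by move: x Fkx; exact/subsetPset/ndF/leq_maxl.
  by move: v Glv; exact/subsetPset/ndG/leq_maxr.
move=> k; have [mFk Fk] := Foo k; have [mGk Gk] := Goo k.
have mFG : measurable (F k `*` G k) by exact: measurableX.
split; first by rewrite -[X in measurable X]setTI; exact: mg.
rewrite /pushforward (_ : _ @^-1` _ = F k `*` G k); last first.
  have cgE p : (F k `*` G k) (g (consrV p)) = (F k `*` G k) p by rewrite cg.
  by apply/seteqP; split => p; [rewrite -cgE|rewrite -[X in X -> _]cgE].
by rewrite product_measure1E// lte_mul_pinfty// ge0_fin_numE.
Qed.

Lemma lebesgue_rVP n : is_sigma_finite_measure (@lebesgue_rV n).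
Proof.
elim: n => [|n [m0 mge0 msa msf]].
  split; [exact: measure0|exact: measure_ge0|exact: measure_semi_sigma_additive|].
  exact: sigma_finiteT.
pose mu := @lebesgue_rV n.
pose M := isMeasure.Build _ _ _ mu m0 mge0 msa.
pose mu' : {measure set 'rV[R]_n -> \bar R} := HB.pack mu M.
pose S := Measure_isSigmaFinite.Build _ _ _ mu' msf.
pose mu'' : {sigma_finite_measure set 'rV[R]_n -> \bar R} := HB.pack mu M S.
exact: (consrV_measure mu'').
Qed.

Let lebesgue_rV0 n : @lebesgue_rV n set0 = 0%E.
Proof. by have [] := lebesgue_rVP n. Qed.

Let lebesgue_rV_ge0 n A : (0 <= @lebesgue_rV n A)%E.
Proof. by have [_ + _ _] := lebesgue_rVP n; exact. Qed.

Let lebesgue_rV_sigma_additive n : semi_sigma_additive (@lebesgue_rV n).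
Proof. by have [] := lebesgue_rVP n. Qed.

Let lebesgue_rV_sigma_finite n : sigma_finite setT (@lebesgue_rV n).
Proof. by have [] := lebesgue_rVP n. Qed.

HB.instance Definition _ n := isMeasure.Build _ _ _ (@lebesgue_rV n)
  (@lebesgue_rV0 n) (@lebesgue_rV_ge0 n) (@lebesgue_rV_sigma_additive n).

HB.instance Definition _ n := Measure_isSigmaFinite.Build _ _ _
  (@lebesgue_rV n) (@lebesgue_rV_sigma_finite n).

End lebesgue_measure_rV.
Arguments lebesgue_rV {R n}.

Section charge_integral.
Context d (T : measurableType d) (R : realType).

(* Independent of the Hahn decomposition chosen. *)
Definition charge_integral (nu : {charge set T -> \bar R}) (D : set T)
    (f : T -> R) : R :=
  let P := cid (Hahn_decomposition nu) in
  let N := cid (projT2 P) in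
  Rintegral (jordan_pos (projT2 N)) D f - Rintegral (jordan_neg (projT2 N)) D f.

End charge_integral.

Section function_spaces.
Context {R : realType} {n : nat}.
Implicit Types (Omega : set 'rV[R]_n) (q : R).

(* The library norm on matrices is the sup norm. *)
Definition enorm k l (A : 'M[R]_(k, l)) : R :=
  Num.sqrt (\sum_i \sum_j A i j ^+ 2).

Definition dotv (x y : 'rV[R]_n) : R := \sum_i x 0 i * y 0 i.

(* Near each boundary point Omega is the strict epigraph, in the direction of *)
(* a unit vector nu, of a Lipschitz function of the component orthogonal to nu. *)
Definition lipschitz_boundary Omega : Prop :=
  forall x0, (closure Omega `\` Omega°) x0 ->
  exists (nu : 'rV[R]_n) (g : 'rV[R]_n -> R),
    [/\ enorm nu = 1, lipschitz g &
      \forall x \near x0,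
        Omega x <-> g (x - dotv x nu *: nu) < dotv x nu].

Definition pderive (j : 'I_n) (f : 'rV[R]_n -> R) : 'rV[R]_n -> R :=
  fun x => 'D_(delta_mx 0 j) f x.

Definition smooth (f : 'rV[R]_n -> R) : Prop :=
  forall s : seq 'I_n, continuous (foldr pderive f s) /\
    forall j x, derivable (foldr pderive f s) x (delta_mx 0 j).

Definition Cc_smooth Omega : set ('rV[R]_n -> R) :=
  [set f | [/\ smooth f, compact (closure [set x | f x != 0]) &
               closure [set x | f x != 0] `<=` Omega]].

Definition C0 Omega : set ('rV[R]_n -> R) :=
  [set f | {within Omega, continuous f} /\
    forall e, 0 < e -> compact (Omega `&` [set x | e <= `|f x|])].

Definition Lpnorm k l Omega q (f : 'rV[R]_n -> 'M[R]_(k, l)) : \bar R :=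
  'N[lebesgue_rV]_(q%:E)[(fun x => (enorm (f x))%:E) \_ Omega].

Definition Lp k l Omega q : set ('rV[R]_n -> 'M[R]_(k, l)) :=
  [set f | measurable_fun Omega f /\ (Lpnorm Omega q f < +oo)%E].

Definition L1loc k l Omega : set ('rV[R]_n -> 'M[R]_(k, l)) :=
  [set f | measurable_fun Omega f /\
    forall K, compact K -> K `<=` Omega -> (Lpnorm K 1 f < +oo)%E].

Variable N : nat.
Implicit Types u v : 'rV[R]_n -> 'rV[R]_N.

Definition is_weak_gradient Omega u (G : 'rV[R]_n -> 'M[R]_(N, n)) : Prop :=
  [/\ L1loc Omega u, L1loc Omega G & forall phi, Cc_smooth Omega phi ->
    forall i j, \int[lebesgue_rV]_(x in Omega) (u x 0 i * pderive j phi x) =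
              - \int[lebesgue_rV]_(x in Omega) (G x i j * phi x)].

(* Weak gradients are unique almost everywhere on Omega, so integrals over Omega *)
(* do not depend on the representative chosen. *)
Definition weak_gradient Omega u : 'rV[R]_n -> 'M[R]_(N, n) :=
  xget (fun=> 0) [set G | is_weak_gradient Omega u G].

Definition W1q Omega q : set ('rV[R]_n -> 'rV[R]_N) :=
  [set u | Lp Omega q u /\ exists2 G, is_weak_gradient Omega u G & Lp Omega q G].

Definition W1q_norm Omega q u : \bar R :=
  (Lpnorm Omega q u + Lpnorm Omega q (weak_gradient Omega u))%E.

Definition W1q0 Omega q : set ('rV[R]_n -> 'rV[R]_N) :=
  [set u | W1q Omega q u /\ forall e : R, 0 < e ->
    exists2 phi : 'rV[R]_n -> 'rV[R]_N,
      (forall i, Cc_smooth Omega (fun x => phi x 0 i)) &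
      (W1q_norm Omega q (u \- phi)%R < e%:E)%E].

Definition dirichlet_class Omega q u0 : set ('rV[R]_n -> 'rV[R]_N) :=
  [set v | W1q0 Omega q (v \- u0)].

(* Finite signed Borel measures on Omega are represented by charges on R^n, of *)
(* which only the restriction to Omega is ever used. *)
Definition is_derivative_measure Omega u
    (Du : 'I_N -> 'I_n -> {charge set 'rV[R]_n -> \bar R}) : Prop :=
  forall phi, Cc_smooth Omega phi ->
    forall i j, \int[lebesgue_rV]_(x in Omega) (u x 0 i * pderive j phi x) =
              - charge_integral (Du i j) Omega phi.

Definition BV Omega : set ('rV[R]_n -> 'rV[R]_N) :=
  [set u | Lp Omega 1 u /\ exists Du, is_derivative_measure Omega u Du].

(* The derivative measures are unique on Omega, hence quantifying over them *)
(* existentially or universally is the same. *)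
Definition BV_weak_star_cvg Omega (u_ : nat -> 'rV[R]_n -> 'rV[R]_N) u : Prop :=
  [/\ forall k, BV Omega (u_ k), BV Omega u,
    (fun k => Lpnorm Omega 1 (u_ k \- u)) @ \oo --> 0%E &
    exists Du_ Du, [/\ forall k, is_derivative_measure Omega (u_ k) (Du_ k),
      is_derivative_measure Omega u Du &
      forall i j phi, C0 Omega phi ->
        (fun k => charge_integral (Du_ k i j) Omega phi) @ \oo -->
        charge_integral (Du i j) Omega phi]].

Definition energy (F : 'M[R]_(N, n) -> R) Omega u : \bar R :=
  \int[lebesgue_rV]_(x in Omega) (F (weak_gradient Omega u x))%:E.

Definition relaxed_energy (F : 'M[R]_(N, n) -> R) Omega q u0 u : \bar R :=
  ereal_inf [set l | exists u_ : nat -> 'rV[R]_n -> 'rV[R]_N,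
    [/\ forall k, dirichlet_class Omega q u0 (u_ k),
        BV_weak_star_cvg Omega u_ u &
        l = limn_einf (fun k => energy F Omega (u_ k))]].

End function_spaces.

Definition is_minimum (R : realType) (T : Type) (A : set T) (f : T -> \bar R)
    (m : \bar R) : Prop :=
  (exists2 u, A u & f u = m) /\ (forall v, A v -> (m <= f v)%E).

(* Main.v *)
Require Import Defs.
From HB Require Import structures.
From mathcomp Require Import all_boot all_order all_algebra.
From mathcomp Require Import all_classical all_reals all_analysis.
From mathcomp Require Import measurable_realfun.
From mathcomp Require Import ring lra zify.
Set Implicit Arguments.
Unset Strict Implicit.
Unset Printing Implicit Defensive.
Import Order.TTheory GRing.Theory Num.Theory.
Import numFieldNormedType.Exports.
Local Open Scope classical_set_scope.
Local Open Scope ring_scope.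

(** Let m be the infimum of the energy over the Dirichlet class.

    The relaxed energy agrees with the energy on the class. A constant sequence is
    admissible for the relaxation because a function with an integrable weak gradient
    has a derivative measure, the one with the gradient as density
    ([weak_gradient_measure]). The other inequality is lower semicontinuity of the
    energy for convergence in L^1 ([convex_lsc]). A convex continuous F is the supremum
    of countably many affine functions ([convex_sup_affine]). A maximum of finitely many
    of them along a given gradient is approximated, in L^1, by minorants
    a(x) + <b(x), z> <= F(z) whose coefficients are test functions
    ([max_affine_approx]). Integrals of such minorants along weak gradients can be
    integrated by parts and are thus continuous for L^1 convergence.

    The number m is finite by the growth condition, and it is a lower bound of the
    relaxed energy, since every liminf in the definition of the latter is at least m. So
    it suffices to find u in BV with relaxed energy at most m, and this is the limit of
    a minimizing sequence u_k. The bound gamma |z| <= F(z) bounds the gradients of u_k in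
    L^1, and u_k - u0 is approximated by test functions phi_k with the same property.
    Compactness ([BV_compactness]) has two parts.

    Functions: on a dyadic cell of side d, the L^1 norm of a test function is at most the
    absolute value of its integral plus d times the mass of its gradient
    ([cell_poincare]). If the integrals of phi_k over each cell converge, as they do
    along a diagonal subsequence, then phi_k is therefore a Cauchy sequence in L^1
    ([rellich_cauchy]).

    Gradients: the positive and negative parts of the gradients of u_k are nonnegative
    densities whose masses on each dyadic cell may also be assumed to converge. The
    limits L(w) of these masses form a finitely additive function on a binary tree of
    cells. Arranging the cells of each depth as consecutive intervals of length L(w) and
    sending a number t to the point to which the cells around t shrink ([quantile]), the
    image of Lebesgue measure is a measure which is the limit of the densities in
    duality with uniformly continuous functions ([vague_limit]). Functions vanishing at
    the boundary of Omega extend by zero to such functions. Passing to the limit in the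
    integration by parts identifies the difference of the two measures as the
    derivative of u. *)

(** * Smooth functions and compactly supported bumps *)

Section smooth_calculus.
Context {R : realType} {n : nat}.
Implicit Types f g : 'rV[R]_n -> R.

Lemma continuous_add f g : continuous f -> continuous g -> continuous (f \+ g).
Proof. by move=> cf cg x; apply: continuousD; [exact: cf|exact: cg]. Qed.

Lemma continuous_mul f g : continuous f -> continuous g -> continuous (f \* g).
Proof. by move=> cf cg x; apply: continuousM; [exact: cf|exact: cg]. Qed.

(** The class C^m, defined by recursion on m. Closure under products is proved here
    by induction on m, where the list of derivations in [smooth] would require the
    full Leibniz formula. *)
Fixpoint classC (m : nat) f : Prop :=
  continuous f /\
  if m is m'.+1 then
    forall j, (forall x, derivable f x (delta_mx 0 j)) /\ classC m' (pderive j f)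
  else True.

Lemma classC_cont m f : classC m f -> continuous f.
Proof. by case: m => [|m] []. Qed.

Lemma classCW m f : classC m.+1 f -> classC m f.
Proof.
elim: m f => [f [cf _]//|m IH f [cf df]]; split => // j.
have [dfj Cfj] := df j; split => //; exact: IH.
Qed.

Lemma smooth_pderive j f : smooth f -> smooth (pderive j f).
Proof. by move=> sf s; have := sf (rcons s j); rewrite foldr_rcons. Qed.

Lemma smoothP f : smooth f <-> forall m, classC m f.
Proof.
split=> [sf m|Cf s].
  elim: m f sf => [|m IH] f sf; first by split=> //; have [] := sf [::].
  split; first by have [] := sf [::].
  move=> j; split; first by move=> x; have [_ ] := sf [::]; exact.
  exact/IH/smooth_pderive.
elim/last_ind: s f Cf => [|s j IH] f Cf /=.
  split; first exact: (classC_cont (Cf 0%N)).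
  by move=> j x; have [_ /(_ j)[+ _]] := Cf 1%N; exact.
by rewrite foldr_rcons; apply: IH => m; have [_ /(_ j)[_ ]] := Cf m.+1.
Qed.

Lemma classCD m f g : classC m f -> classC m g -> classC m (f \+ g).
Proof.
elim: m f g => [|m IH] f g [cf df] [cg dg].
  by split=> //; exact: continuous_add.
split; first exact: continuous_add.
move=> j; have [dfj Cfj] := df j; have [dgj Cgj] := dg j.
split; first by move=> x; exact: derivableD.
rewrite (_ : pderive j _ = pderive j f \+ pderive j g); first exact: IH.
by apply/funext => x; rewrite /pderive deriveD.
Qed.

Lemma classC_cst m (c : R) : classC m (cst c).
Proof.
elim: m c => [|m IH] c; split => //; try exact: cst_continuous.
move=> j; split; first by move=> x; exact: derivable_cst.
rewrite (_ : pderive j _ = cst 0); first exact: IH.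
by apply/funext => x; rewrite /pderive derive_cst.
Qed.

Lemma classCM m f g : classC m f -> classC m g -> classC m (f \* g).
Proof.
elim: m f g => [|m IH] f g Cf Cg.
  by split=> //; apply: continuous_mul; [exact: classC_cont Cf|exact: classC_cont Cg].
have [cf df] := Cf; have [cg dg] := Cg.
split; first exact: continuous_mul.
move=> j; have [dfj Cfj] := df j; have [dgj Cgj] := dg j.
split; first by move=> x; exact: derivableM.
rewrite (_ : pderive j _ = (f \* pderive j g) \+ (g \* pderive j f)); last first.
  by apply/funext => x; rewrite /pderive deriveM.
by apply: classCD; apply: IH => //; exact: classCW.
Qed.

Lemma smoothD f g : smooth f -> smooth g -> smooth (f \+ g).
Proof. by move=> /smoothP Cf /smoothP Cg; apply/smoothP => m; exact: classCD. Qed.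

Lemma smoothM f g : smooth f -> smooth g -> smooth (f \* g).
Proof. by move=> /smoothP Cf /smoothP Cg; apply/smoothP => m; exact: classCM. Qed.

Lemma smooth_cst (c : R) : smooth (cst c : 'rV[R]_n -> R).
Proof. by apply/smoothP => m; exact: classC_cst. Qed.

Lemma smoothZ (c : R) f : smooth f -> smooth (fun x => c * f x).
Proof. by move=> sf; apply: (smoothM (smooth_cst c) sf). Qed.

Lemma smoothB f g : smooth f -> smooth g -> smooth (f \- g).
Proof.
move=> sf sg; rewrite (_ : f \- g = f \+ (fun x => -1 * g x)).
  exact: (smoothD sf (smoothZ (-1) sg)).
by apply/funext => x /=; rewrite mulN1r.
Qed.

Lemma smooth_exp f k : smooth f -> smooth (fun x => f x ^+ k).
Proof.
move=> sf; elim: k => [|k IH]; first exact: smooth_cst.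
rewrite (_ : (fun x => _) = f \* (fun x => f x ^+ k)); first exact: (smoothM sf IH).
by apply/funext => x; rewrite exprS.
Qed.

Lemma smooth_prod (I : Type) (s : seq I) (F : I -> 'rV[R]_n -> R) :
  (forall i, smooth (F i)) -> smooth (fun x => \prod_(i <- s) F i x).
Proof.
move=> sF; elim: s => [|i s IH].
  rewrite (_ : (fun x => _) = cst 1); first exact: smooth_cst.
  by apply/funext => x; rewrite big_nil.
rewrite (_ : (fun x => _) = F i \* (fun x => \prod_(i <- s) F i x)).
  exact: smoothM.
by apply/funext => x; rewrite big_cons.
Qed.

Lemma smooth_cont f : smooth f -> continuous f.
Proof. by move=> /(_ [::])[]. Qed.

Lemma smooth_derivable f j x : smooth f -> derivable f x (delta_mx 0 j).
Proof. by move=> /(_ [::])[_]; exact. Qed.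

End smooth_calculus.

Section flat.
Context {R : realType}.

(** The functions x^-k exp(-1/x), extended by 0 to x <= 0. The derivative of one of
    them is a combination of two others, so the family is closed under
    differentiation and each of its members is C^oo. *)
Definition flat (k : nat) (x : R) : R :=
  if 0 < x then x ^- k * expR (- x^-1) else 0.

Lemma flat_ge0 k x : 0 <= flat k x.
Proof.
rewrite /flat; case: ifPn => // x0.
by rewrite mulr_ge0 ?expR_ge0// invr_ge0 exprn_ge0// ltW.
Qed.

Lemma flat_le0 k x : x <= 0 -> flat k x = 0.
Proof. by move=> x0; rewrite /flat ltNge x0. Qed.

Lemma flat_gt0 x : (0 < flat 0 x) = (0 < x).
Proof.
rewrite /flat; case: ifPn => x0; last by rewrite ltxx.
by rewrite expr0 invr1 mul1r expR_gt0.
Qed.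

Lemma flat_le1 x : flat 0 x <= 1.
Proof.
rewrite /flat; case: ifPn => x0 //.
by rewrite expr0 invr1 mul1r -expR0 ler_expR oppr_le0 invr_ge0 ltW.
Qed.

Lemma invX_is_derive k (x : R) : x != 0 ->
  is_derive x 1 (fun y => y^-1 ^+ k) (- k%:R * x^-1 ^+ k.+1).
Proof.
move=> x0; elim: k => [|k IH].
  by rewrite mulNr mul0r oppr0; exact: is_derive_cst.
rewrite (_ : (fun y => _) = (fun y : R => y^-1) * (fun y => y^-1 ^+ k)); last first.
  by apply/funext => y; rewrite exprS.
have IV := is_deriveV x0 (is_derive_id x 1).
apply: is_derive_eq.
rewrite /GRing.scale /= -exprVn !exprS expr0 -!natr1; ring.
Qed.

(** This gives the derivative at 0, since exp(1/x) >= x^-(k+2) / (k+2)! bounds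
    x^-k exp(-1/x) by a multiple of x^2. *)
Lemma flat_small k x : flat k x <= (k.+2)`!%:R * x ^+ 2.
Proof.
rewrite /flat; case: ifPn => [x0|_]; last by rewrite mulr_ge0// sqr_ge0.
have t0 : 0 < x^-1 by rewrite invr_gt0.
have f0 : 0 < (k.+2)`!%:R :> R by rewrite ltr0n fact_gt0.
have := expR_ge1Dxn k.+1 (ltW t0) => h.
rewrite expRN ler_pdivrMr ?expR_gt0// -exprVn.
have {}h : (x^-1) ^+ k.+2 / (k.+2)`!%:R <= expR x^-1 by lra.
apply: le_trans (ler_wpM2l _ h); last by rewrite mulr_ge0 ?sqr_ge0// ltW.
rewrite mulrCA [_ * (_ / _)]mulrC -mulrA; set c := (k.+2)`!%:R in f0 *.
rewrite le_eqVlt; apply/orP; left; apply/eqP; rewrite !exprS expr0; field.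
by rewrite !gt_eqF.
Qed.

Lemma flat_is_derive (k : nat) (x : R) :
  is_derive x 1 (flat k) (flat k.+2 x - k%:R * flat k.+1 x).
Proof.
have [x0|x0|->] := ltgtP x 0.
- rewrite !flat_le0 ?ltW// mulr0 subr0.
  apply: (near_eq_is_derive _ _ (f := cst 0)).
  + by near=> y; rewrite flat_le0 // ltW//; near: y; exact: lt_nbhsl.
- have xn0 : x != 0 by rewrite gt_eqF.
  apply: (near_eq_is_derive _ _ (f := (fun y => y^-1 ^+ k) * (fun y => expR (- y^-1)))).
    near=> y; rewrite /flat ifT -?exprVn//; near: y; exact: lt_nbhsr.
  have IX := invX_is_derive k xn0.
  have IV := is_deriveV xn0 (is_derive_id x 1).
  have IE : is_derive x 1 (fun y => expR (- y^-1)) (expR (- x^-1) * x^-1 ^+ 2).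
    rewrite (_ : (fun y => _) = expR \o (fun y : R => - y^-1)); last by [].
    apply: is_derive1_comp; apply: is_derive_eq.
    by rewrite /GRing.scale /= mulr1 opprK exprVn.
  apply: is_derive_eq; rewrite /flat x0 /GRing.scale /= -!exprVn !exprS; ring.
- rewrite !flat_le0 // mulr0 subr0.
  have cv : (fun h : R => h^-1 *: (flat k (h *: 1 + 0) - flat k 0)) @ 0^' --> (0 : R).
    apply: (@cvg_to_0_linear _ _ (k.+2)`!%:R 1) => // h /andP[]; rewrite normr_gt0 => h0 _.
    rewrite /GRing.scale /= mulr1 addr0 (flat_le0 k (lexx 0)) subr0.
    rewrite normrM normfV (ger0_norm (flat_ge0 _ _)) ler_pdivrMl ?normr_gt0//.
    by rewrite mulrCA -normrM -expr2 ger0_norm ?sqr_ge0// flat_small.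
  apply: DeriveDef; first by apply/cvg_ex; exists 0.
  exact: cvg_lim cv.
Unshelve. all: by end_near. Qed.
End flat.

Section bumps.
Context {R : realType} {n : nat}.

Lemma is_derive_coord (h : R -> R) (i j : 'I_n) (x : 'rV[R]_n) (d : R) :
  is_derive (x 0 i) 1 h d ->
  is_derive x (delta_mx 0 j) (fun y : 'rV[R]_n => h (y 0 i)) ((i == j)%:R * d).
Proof.
move=> hd.
have coordE (t : R) : (t *: delta_mx 0 j + x) 0 i = t * (i == j)%:R + x 0 i.
  by rewrite !mxE eqxx.
case: (eqVneq i j) => [ij|ij]; last first.
  rewrite mul0r.
  have cv : (fun t : R => t^-1 *: (h ((t *: delta_mx 0 j + x) 0 i) - h (x 0 i))) @ 0^' --> (0 : R).
    rewrite (_ : (fun t => _) = cst 0); first exact: cvg_cst.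
    by apply/funext => t; rewrite coordE (negbTE ij) mulr0 add0r subrr scaler0.
  apply: DeriveDef; first by apply/cvg_ex; exists 0.
  exact: cvg_lim cv.
have E : (fun t : R => t^-1 *: (h ((t *: delta_mx 0 j + x) 0 i) - h (x 0 i))) =
         (fun t : R => t^-1 *: (h (t *: 1 + x 0 i) - h (x 0 i))).
  by apply/funext => t; rewrite coordE ij eqxx.
case: hd => hd1 hd2; rewrite mul1r; apply: DeriveDef.
  by rewrite /derivable /= E.
by rewrite -hd2 /derive /= E.
Qed.

Lemma coordinate_continuous (i : 'I_n) : continuous (fun y : 'rV[R]_n => y 0 i).
Proof. exact: coord_continuous. Qed.

Lemma flat_aff_is_derive (k : nat) (s c x : R) :
  is_derive x 1 (fun y => flat k (s * (y - c)))
    (s * (flat k.+2 (s * (x - c)) - k%:R * flat k.+1 (s * (x - c)))).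
Proof.
rewrite mulrC.
apply: (is_derive1_comp (f := flat k) (g := fun y => s * (y - c))).
  exact: flat_is_derive.
have -> : (fun y : R => s * (y - c)) = cst s * (id - cst c) by apply/funext.
apply: is_derive_eq; rewrite /GRing.scale /= /cst; ring.
Qed.

(** All orders k have to be treated at once: differentiating raises k. *)
Lemma classC_flat_coord m k (s c : R) (i : 'I_n) :
  classC m (fun x : 'rV[R]_n => flat k (s * (x 0 i - c))).
Proof.
have cf k' : continuous (fun x : 'rV[R]_n => flat k' (s * (x 0 i - c))).
  move=> x.
  apply: (@continuous_comp _ _ _ (fun x : 'rV[R]_n => x 0 i) (fun y => flat k' (s * (y - c)))).
    exact: coordinate_continuous.
  apply: differentiable_continuous; apply/derivable1_diffP.
  by have [] := flat_aff_is_derive k' s c (x 0 i).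
elim: m k => [|m IH] k; split => // j.
have D (x : 'rV[R]_n) := is_derive_coord j (flat_aff_is_derive k s c (x 0 i)).
split; first by move=> x; have [] := D x.
rewrite (_ : pderive j _ = fun x : 'rV[R]_n => ((i == j)%:R * s) *
   (flat k.+2 (s * (x 0 i - c)) + (- k%:R) * flat k.+1 (s * (x 0 i - c)))).
  apply: (classCM (classC_cst _ _)); apply: classCD; first exact: IH.
  apply: (classCM (classC_cst _ _)); exact: IH.
apply/funext => x; rewrite /pderive; have [_ ->] := D x; ring.
Qed.

(** The shift and the sign of each factor are written as multiplication by 1 and -1 so
    that the derivative rule of [flat] along an affine map serves both factors. *)
Definition box_bump (a b : 'rV[R]_n) (x : 'rV[R]_n) : R :=
  \prod_i (flat 0 (1 * (x 0 i - a 0 i)) * flat 0 (- 1 * (x 0 i - b 0 i))).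

Lemma smooth_box_bump a b : smooth (box_bump a b).
Proof.
apply: smooth_prod => i; apply: smoothM;
  apply/smoothP => m; exact: classC_flat_coord.
Qed.

Lemma box_bump01 a b x : 0 <= box_bump a b x <= 1.
Proof.
rewrite /box_bump; apply/andP; split.
  by apply: prodr_ge0 => i _; rewrite mulr_ge0// flat_ge0.
rewrite -[leRHS](@expr1n R #|'I_n|) -prodr_const; apply: ler_prod => i _.
by rewrite mulr_ge0 ?flat_ge0//= mulr_ile1 ?flat_ge0 ?flat_le1.
Qed.

Definition open_box (a b : 'rV[R]_n) : set 'rV[R]_n :=
  [set x | forall i, a 0 i < x 0 i < b 0 i].

Lemma box_bump_neq0 a b x : box_bump a b x != 0 <-> open_box a b x.
Proof.
rewrite /box_bump; split => [/prodf_neq0 h i|h].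
  have := h i isT; rewrite mulf_eq0 negb_or !mul1r !mulN1r.
  by rewrite !neq_lt !ltNge !flat_ge0/= -!ltNge !flat_gt0 oppr_gt0 subr_gt0 subr_lt0.
apply/prodf_neq0 => i _; have /andP[ai bi] := h i.
by rewrite mulf_neq0// gt_eqF// flat_gt0 ?mul1r ?mulN1r ?oppr_gt0 ?subr_gt0// subr_lt0.
Qed.

Lemma open_open_box a b : open (open_box a b).
Proof.
rewrite (_ : open_box a b = box_bump a b @^-1` [set y | y != 0]).
  apply: open_comp => [x _|]; last exact: open_neq.
  exact: smooth_cont (smooth_box_bump a b) x.
by apply/seteqP; split => x /box_bump_neq0.
Qed.

Lemma closure_box_bump a b :
  closure [set x | box_bump a b x != 0] `<=`
  [set x : 'rV[R]_n | forall i, a 0 i <= x 0 i <= b 0 i].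
Proof.
have cB : closed [set x : 'rV[R]_n | forall i, a 0 i <= x 0 i <= b 0 i].
  rewrite (_ : mkset _ = \bigcap_(i in setT)
     ((fun x : 'rV[R]_n => x 0 i) @^-1` `[a 0 i, b 0 i]%classic)); last first.
    apply/seteqP; split=> [x h i _|x h i]; first by rewrite /= in_itv/=; exact: h.
    by have := h i I; rewrite /= in_itv.
  apply: closed_bigI => i _; apply: preimage_closed; last exact: itv_closed.
  by move=> x _; exact: coordinate_continuous.
rewrite [X in _ `<=` X](closure_id _).1//; apply: closure_subset => x /box_bump_neq0 h i.
by have /andP[/ltW -> /ltW ->] := h i.
Qed.

Lemma compact_box (a b : 'rV[R]_n) :
  compact [set x : 'rV[R]_n | forall i, a 0 i <= x 0 i <= b 0 i].
Proof.
rewrite (_ : mkset _ = [set x : 'rV[R]_n | forall i, `[a 0 i, b 0 i]%classic (x 0 i)]).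
  apply: (@rV_compact _ _ (fun i => `[a 0 i, b 0 i]%classic)) => i.
  exact: segment_compact.
by apply/seteqP; split=> x h i; have := h i; rewrite /= in_itv.
Qed.

Lemma compact_closure_sub (A B : set 'rV[R]_n) : compact B -> closure A `<=` B ->
  compact (closure A).
Proof. by move=> cB AB; exact: (subclosed_compact (@closed_closure _ _) cB AB). Qed.

Lemma Cc_box_bump (Omega : set 'rV[R]_n) (a b : 'rV[R]_n) :
  [set x : 'rV[R]_n | forall i, a 0 i <= x 0 i <= b 0 i] `<=` Omega ->
  Cc_smooth Omega (box_bump a b).
Proof.
move=> abO; split; first exact: smooth_box_bump.
  exact: compact_closure_sub (@compact_box a b) (@closure_box_bump a b).
exact: subset_trans (@closure_box_bump a b) abO.
Qed.

Section Cc.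
Variable Omega : set 'rV[R]_n.
Implicit Types f g : 'rV[R]_n -> R.

(** Membership in C_c^oo is mostly obtained by comparing supports: the support of f is
    then a closed subset of a compact set. *)
Lemma Cc_support_sub (f g : 'rV[R]_n -> R) : smooth f -> Cc_smooth Omega g ->
  (forall x, g x = 0 -> f x = 0) -> Cc_smooth Omega f.
Proof.
move=> sf [sg cg gO] fg.
have fgS : closure [set x | f x != 0] `<=` closure [set x | g x != 0].
  by apply: closure_subset => x /=; apply: contra_neq; exact: fg.
split => //; first exact: compact_closure_sub cg fgS.
exact: subset_trans fgS gO.
Qed.

Lemma Cc_smooth0 : Cc_smooth Omega (cst 0).
Proof.
have E : closure [set x : 'rV[R]_n | (cst 0 : _ -> R) x != 0] = set0.
  rewrite (_ : mkset _ = set0) ?closure0//.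
  by apply/seteqP; split => // x /=; rewrite eqxx.
by split; rewrite ?E//; [exact: smooth_cst|exact: compact0].
Qed.

Lemma Cc_smoothD f g : Cc_smooth Omega f -> Cc_smooth Omega g ->
  Cc_smooth Omega (f \+ g).
Proof.
move=> [sf cf fO] [sg cg gO].
have S : closure [set x | (f \+ g) x != 0] `<=`
    closure [set x | f x != 0] `|` closure [set x | g x != 0].
  rewrite -closureU; apply: closure_subset => x /= h.
  apply/orP; apply: contraNT h; rewrite negb_or !negbK => /andP[/eqP-> /eqP->].
  by rewrite addr0.
split; first exact: smoothD.
  apply: compact_closure_sub S; exact: compactU.
by apply: subset_trans S _; rewrite subUset.
Qed.

Lemma Cc_smoothMl f g : smooth f -> Cc_smooth Omega g -> Cc_smooth Omega (f \* g).
Proof.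
move=> sf Cg; apply: (Cc_support_sub _ Cg); first by have [sg _ _] := Cg; exact: (smoothM sf sg).
by move=> x /= ->; rewrite mulr0.
Qed.

Lemma Cc_smoothZ (c : R) f : Cc_smooth Omega f -> Cc_smooth Omega (fun x => c * f x).
Proof. by move=> Cf; exact: (Cc_smoothMl (smooth_cst c) Cf). Qed.

Lemma Cc_smoothB f g : Cc_smooth Omega f -> Cc_smooth Omega g ->
  Cc_smooth Omega (f \- g).
Proof.
move=> Cf Cg; rewrite (_ : f \- g = f \+ (fun x => -1 * g x)).
  by apply: Cc_smoothD => //; exact: Cc_smoothZ.
by apply/funext => x /=; rewrite mulN1r.
Qed.

Lemma Cc_eq0 f (x : 'rV[R]_n) : Cc_smooth Omega f -> ~ Omega x -> f x = 0.
Proof.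
move=> [_ _ fO] nO; apply/eqP/negP => /negP fx; apply: nO; apply: fO.
exact: subset_closure.
Qed.

(** The complement of the support is open, so f vanishes near x. *)
Lemma pderive_eq0 f (x : 'rV[R]_n) j : ~ closure [set y | f y != 0] x -> pderive j f x = 0.
Proof.
move=> nx.
rewrite /pderive (@near_eq_derive _ _ _ _ (cst 0)) ?derive_cst//.
have : \near x, ~ closure [set y | f y != 0] x.
  apply: open_nbhs_nbhs; split=> //; exact: (closed_openC (@closed_closure _ _)).
apply: filterS => y ny /=; apply/eqP/negP => /negP fy; apply: ny.
exact: subset_closure.
Qed.

Lemma Cc_pderive j f : Cc_smooth Omega f -> Cc_smooth Omega (pderive j f).
Proof.
move=> [sf cf fO].
have S : closure [set x | pderive j f x != 0] `<=` closure [set x | f x != 0].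
  rewrite [X in _ `<=` X](closure_id _).1; last exact: closed_closure.
  apply: closure_subset => x /= h; apply: contrapT => nx.
  by move/eqP: h; apply; exact: pderive_eq0.
split; first exact: smooth_pderive.
  exact: compact_closure_sub cf S.
exact: subset_trans S fO.
Qed.

Lemma Cc_bounded f : Cc_smooth Omega f -> exists2 M, 0 <= M & forall x, `|f x| <= M.
Proof.
move=> [sf cf _].
have [f0|/existsNP[x0 fx0]] := pselect (forall x, f x = 0).
  by exists 0 => // x; rewrite f0 normr0.
have [||c cc cmax] := @compact_EVT_max _ _ (fun x => `|f x|) _ _ cf.
- by exists x0; apply: subset_closure; apply/eqP.
- apply: continuous_subspaceT => x; apply: continuous_comp; last exact: norm_continuous.
  exact: smooth_cont.
exists `|f c| => // x; have [fx|/eqP fx] := eqVneq (f x) 0.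
  by rewrite fx normr0.
by apply: cmax; rewrite inE; apply: subset_closure; apply/eqP.
Qed.

End Cc.
End bumps.

(** * Borel sets and Lebesgue measure on row vectors *)

Section borel_matrix.
Context {R : realType} {m k : nat}.
Local Notation M := 'M[R]_(m, k).

Definition mx_cube (c : M) (r : R) : set M :=
  [set A | forall i j, `|A i j - c i j| < r].

Lemma measurable_mx_cube c r : measurable (mx_cube c r).
Proof.
rewrite (_ : mx_cube c r = \bigcap_(ij in [set: 'I_m * 'I_k])
    (fun A : M => A ij.1 ij.2) @^-1` `]c ij.1 ij.2 - r, c ij.1 ij.2 + r[%classic).
  apply: fin_bigcap_measurable; first exact: finite_finset.
  move=> [i j] _; rewrite -[X in measurable X]setTI.
  exact: measurable_entry.
apply/seteqP; split => [A h [i j] _ /=|A h i j].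
  by rewrite in_itv/= -ltr_distl; exact: h.
by have := h (i, j) I; rewrite /= in_itv/= -ltr_distl.
Qed.

Lemma near_mx_cube (c : M) (U : set M) : nbhs c U ->
  exists2 r, 0 < r & mx_cube c r `<=` U.
Proof.
move=> /nbhs_ballP[r /= r0 rU]; exists r => // A h; apply: rU.
split => // i j /=.
by rewrite /ball /= distrC; exact: h.
Qed.

(** The sigma-algebra of the definitions is generated by cylinders. An open set is
    the union of the cubes with rational centre and rational radius that it contains. *)
Lemma open_measurable_mx (U : set M) : open U -> measurable U.
Proof.
move=> oU.
pose c (p : 'M[rat]_(m, k) * rat) : M := map_mx ratr p.1.
rewrite (_ : U = \bigcup_(p in [set p | mx_cube (c p) (ratr p.2) `<=` U])
    mx_cube (c p) (ratr p.2)).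
  rewrite bigcup_mkcond; apply: countable_bigcupT_measurable => [|p].
    exact: countableP.
  by case: ifP => // _; exact: measurable_mx_cube.
apply/seteqP; split => [A UA|A [p pU] Ap]; last exact: pU.
have [r r0 rU] := near_mx_cube (oU A UA).
have r2 : 0 < r / 2 by rewrite divr_gt0.
have [q] := rat_in_itvoo r2.
rewrite in_itv/= => /andP[q0 qr].
have qe i j : exists s : rat, `|A i j - ratr s| < ratr q.
  have [|s] := @rat_in_itvoo R (A i j - ratr q) (A i j + ratr q); first by lra.
  by rewrite in_itv/= => /andP[s1 s2]; exists s; rewrite ltr_norml; lra.
have [s sP] := choice (fun ij : 'I_m * 'I_k => qe ij.1 ij.2).
exists (\matrix_(i, j) s (i, j), q).
  move=> B /= BB; apply: rU => i j.
  have := BB i j; have := sP (i, j); rewrite /c !mxE /= => h1 h2.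
  by have := ler_distD (ratr (s (i, j))) (B i j) (A i j); rewrite [X in _ <= _ + X]distrC; lra.
by move=> i j; rewrite /c !mxE; exact: (sP (i, j)).
Qed.

Lemma continuous_measurable_mx (f : M -> R) : continuous f -> measurable_fun setT f.
Proof.
move=> cf.
apply: (measurability _ (measurable_realfun.RGenOInfty.measurableE R)) => //.
move=> _ [_ [x ->] <-]; rewrite setTI; apply: open_measurable_mx.
rewrite (_ : f @^-1` _ = f @^-1` [set y | x < y]).
  by apply: open_comp; [move=> y _; exact: cf|exact: open_gt].
by apply/seteqP; split => y /=; rewrite in_itv/= andbT.
Qed.

End borel_matrix.

Section lebesgue_rV_theory.
Context {R : realType}.

Lemma ge0_integral_consrV n (f : 'rV[R]_(1 + n) -> \bar R) :
  measurable_fun [set: 'rV[R]_(1 + n)] f -> (forall x, 0 <= f x)%E ->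
  (\int[lebesgue_rV]_x f x =
   \int[lebesgue_measure]_s \int[lebesgue_rV]_y f (@consrV _ n (s, y)))%E.
Proof.
move=> mf f0.
have mc := @measurable_consrV R n.
transitivity (\int[pushforward (lebesgue_measure \x (@lebesgue_rV R n))%E (@consrV R n)]_x f x)%E.
  by apply: eq_measure_integral => A mA _.
rewrite ge0_integral_pushforward//=.
rewrite fubini_tonelli1//=.
exact: measurableT_comp.
Qed.

Definition cube n (M : R) : set 'rV[R]_n := [set x | forall i, `|x 0 i| < M].

Lemma measurable_cube n M : measurable (@cube n M).
Proof.
rewrite (_ : cube M = @mx_cube R 1 n 0 M); first exact: measurable_mx_cube.
apply/seteqP; split => [x h i j|x h j]; last by have := h 0 j; rewrite mxE subr0.
by rewrite ord1 mxE subr0; exact: h.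
Qed.

Lemma lebesgue_cube_lty n M : (lebesgue_rV (@cube n M) < +oo)%E.
Proof.
elim: n => [|n IH].
  by rewrite /= diracE ltry.
rewrite /= /pushforward (_ : _ @^-1` _ = `]-M, M[%classic `*` @cube n M).
  rewrite product_measure1E//=; last exact: measurable_cube.
  rewrite lebesgue_measure_itv/=; case: ifPn => [h|_]; last by rewrite mul0e ltry.
  rewrite -EFinB lte_mul_pinfty// lee_fin; move: h; rewrite lte_fin; lra.
apply/seteqP; split => -[s y]; rewrite /consrV /=.
  move=> h; split => [|i] /=; rewrite ?in_itv/= -?ltr_norml.
    by have := h (@lshift 1 n ord0); rewrite (@row_mxEl _ 1 1 n) mxE.
  by have := h (@rshift 1 n i); rewrite (@row_mxEr _ 1 1 n).
rewrite in_itv/= -ltr_norml => -[h1 h2] i.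
by case: (@split_ordP 1 n i) => j ->;
  [rewrite (@row_mxEl _ 1 1 n) mxE|rewrite (@row_mxEr _ 1 1 n)].
Qed.

Lemma mx_coord_le_norm m n (x : 'M[R]_(m, n)) i j : `|x i j| <= `|x|.
Proof.
rewrite {2}/Num.norm /= mx_normrE.
exact: (@le_bigmax _ _ _ 0 (fun ij : 'I_m * 'I_n => `|x ij.1 ij.2|) (i, j)).
Qed.

Lemma bounded_sub_cube n (A : set 'rV[R]_n) : bounded_set A ->
  exists2 M, 0 < M & A `<=` cube M.
Proof.
move=> /ex_strict_bound_gt0[M M0 AM]; exists M => // x Ax i.
by apply: le_lt_trans (AM x Ax) => /=; exact: mx_coord_le_norm.
Qed.

Lemma bounded_lebesgue_lty n (A : set 'rV[R]_n) : measurable A -> bounded_set A ->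
  (lebesgue_rV A < +oo)%E.
Proof.
move=> mA /bounded_sub_cube[M _ AM].
apply: le_lt_trans (lebesgue_cube_lty n M); apply: le_measure => //; rewrite inE//.
exact: measurable_cube.
Qed.

End lebesgue_rV_theory.

(** * Weighted approximation of indicators by test functions *)

Section density.
Context {R : realType} {n : nat}.
Variable Omega : set 'rV[R]_n.
Hypothesis openO : open Omega.
Let mO : measurable Omega := open_measurable_mx openO.
Variable w : 'rV[R]_n -> R.
Hypothesis w0 : forall x, Omega x -> 0 <= w x.
Hypothesis iw : lebesgue_rV.-integrable Omega (EFin \o w).
Implicit Types f g : 'rV[R]_n -> R.

Local Notation mu := (@lebesgue_rV R n).

Let mw : measurable_fun Omega w.
Proof. by case/integrableP : iw => /measurable_EFinP. Qed.

Definition weighted_dist f g : \bar R := (\int[mu]_(x in Omega) (`|f x - g x| * w x)%:E)%E.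

Let mdist f g : measurable_fun setT f -> measurable_fun setT g ->
  measurable_fun Omega (fun x => (`|f x - g x| * w x)%:E).
Proof.
move=> mf mg; apply/measurable_EFinP; apply: measurable_funM => //.
apply: measurableT_comp => //.
by apply: measurable_funB; exact: measurable_funTS.
Qed.

Lemma weighted_dist_le f g f1 g1 f2 g2 :
  measurable_fun setT f -> measurable_fun setT g ->
  measurable_fun setT f1 -> measurable_fun setT g1 ->
  measurable_fun setT f2 -> measurable_fun setT g2 ->
  (forall x, Omega x -> `|f x - g x| <= `|f1 x - g1 x| + `|f2 x - g2 x|) ->
  (weighted_dist f g <= weighted_dist f1 g1 + weighted_dist f2 g2)%E.
Proof.
move=> mf mg mf1 mg1 mf2 mg2 h.
have p a b x : Omega x -> (0 <= (`|a x - b x| * w x)%:E)%E.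
  by move=> Ox; rewrite lee_fin mulr_ge0 ?w0.
rewrite /weighted_dist -ge0_integralD//=; try by [exact: mdist|move=> x Ox; exact: p].
apply: ge0_le_integral => //=.
- by move=> x Ox; exact: p.
- exact: mdist.
- by apply: emeasurable_funD; exact: mdist.
- move=> x Ox; rewrite -EFinD lee_fin -mulrDl ler_wpM2r ?w0//; exact: h.
Qed.

(** Dominated convergence, with dominating function 2 w. *)
Lemma weighted_dist_cvg (f_ : nat -> 'rV[R]_n -> R) f (e : R) :
  (forall k, measurable_fun setT (f_ k)) -> measurable_fun setT f ->
  (forall k x, `|f_ k x| <= 1) ->
  (forall x, Omega x -> f_ ^~ x @ \oo --> f x) ->
  0 < e -> exists k, (weighted_dist (f_ k) f < e%:E)%E.
Proof.
move=> mf_ mf f1 ff e0.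
have mE (h : 'rV[R]_n -> R) : measurable_fun setT h -> measurable_fun Omega (fun x => (h x * w x)%:E).
  move=> mh; apply/measurable_EFinP; apply: measurable_funM => //.
  exact: measurable_funTS.
have H1 : {ae mu, forall x, Omega x ->
    (fun k => (f_ k x * w x)%:E) @ \oo --> (f x * w x)%:E}.
  apply: aeW => x Ox; apply: cvg_EFin; first exact: nearW.
  by apply: cvgM; [exact: ff|exact: cvg_cst].
have H2 : {ae mu, forall x k, Omega x -> (`|(f_ k x * w x)%:E| <= (w x)%:E)%E}.
  apply: aeW => x k Ox; rewrite abse_EFin lee_fin normrM (ger0_norm (w0 Ox)).
  by rewrite ler_piMl ?w0.
have [_ + _] := dominated_convergence mO (fun k => mE _ (mf_ k)) (mE _ mf) H1 iw H2.
move=> cv.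
have {cv} : (fun k => weighted_dist (f_ k) f) @ \oo --> 0%E.
  apply: cvg_trans cv.
  apply: near_eq_cvg; near=> k; apply: eq_integral => x /[!inE] Ox.
  by rewrite -EFinB abse_EFin -mulrBl normrM (ger0_norm (w0 Ox)).
move=> /fine_cvgP[fin] /cvgrPdist_lt /(_ e e0) h.
near \oo => k; exists k.
have fk : weighted_dist (f_ k) f \is a fin_num by near: k.
rewrite -(fineK fk) lte_fin.
have : `|0 - fine (weighted_dist (f_ k) f)| < e by near: k.
by rewrite sub0r normrN => /ltr_normlW.
Unshelve. all: by end_near. Qed.

Definition test_fun : set ('rV[R]_n -> R) :=
  [set phi | Cc_smooth Omega phi /\ forall x, 0 <= phi x <= 1].

Lemma test_measurable phi : test_fun phi -> measurable_fun setT phi.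
Proof. by move=> [[sp _ _] _]; apply: continuous_measurable_mx; exact: smooth_cont. Qed.

(** The measurable sets whose indicator is a limit, in L^1 of w dx, of test functions
    with values in the unit interval. These sets will be seen to form a sigma-algebra
    that contains the boxes inside Omega. *)
Definition approx : set (set 'rV[R]_n) :=
  [set E | measurable E /\ forall e, 0 < e ->
     exists2 phi, test_fun phi & (weighted_dist phi \1_E < e%:E)%E].

Let mind (E : set 'rV[R]_n) : measurable E -> measurable_fun setT (\1_E : _ -> R).
Proof. by move=> mE; exact: measurable_indic. Qed.

(** A set operation corresponds to an operation on indicators. If the latter keeps
    test functions and is Lipschitz on the unit square, it keeps approximable sets:
    union is a + b - a b and difference is a (1 - b). *)
Lemma approx_ops (op : R -> R -> R) (E F G : set 'rV[R]_n) :
  (forall phi psi, test_fun phi -> test_fun psi ->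
     test_fun (fun x => op (phi x) (psi x))) ->
  (forall a b c d : R, 0 <= a <= 1 -> 0 <= b <= 1 -> 0 <= c <= 1 -> 0 <= d <= 1 ->
     `|op a b - op c d| <= `|a - c| + `|b - d|) ->
  (forall x, Omega x -> \1_G x = op (\1_E x) (\1_F x) :> R) ->
  measurable G -> approx E -> approx F -> approx G.
Proof.
move=> top lop opE mG [mE aE] [mF aF]; split => // e e0.
have e2 : 0 < e / 2 by rewrite divr_gt0.
have [phi tp pe] := aE _ e2; have [psi ts se] := aF _ e2.
exists (fun x => op (phi x) (psi x)); first exact: top.
rewrite (splitr e) EFinD; apply: le_lt_trans (lteD pe se).
apply: weighted_dist_le => //; try exact: mind; try exact: test_measurable.
  exact: (test_measurable (top _ _ tp ts)).
have i01 (A : set 'rV[R]_n) x : 0 <= (\1_A x : R) <= 1.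
  by rewrite indicE ler0n lern1 leq_b1.
move=> x Ox; rewrite opE//; apply: lop => //; [by case: tp|by case: ts].
Qed.

Lemma approxU E F : approx E -> approx F -> approx (E `|` F).
Proof.
move=> aE aF; apply: (approx_ops (op := fun a b => a + b - a * b)) (aE) (aF).
- move=> phi psi [Cp p01] [Cs s01]; split.
    apply: Cc_smoothB; first exact: Cc_smoothD.
    by apply: Cc_smoothMl => //; case: Cp.
  by move=> x; have := p01 x; have := s01 x; nra.
- move=> a b c d a01 b01 c01 d01.
  have -> : a + b - a * b - (c + d - c * d) = (a - c) * (1 - b) + (b - d) * (1 - c) by ring.
  apply: le_trans (ler_normD _ _) _; rewrite !normrM.
  by apply: lerD; rewrite ler_piMr// ger0_norm; lra.
- move=> x _; rewrite !indicE in_setU.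
  by case: (x \in E); case: (x \in F) => /=; ring.
- by apply: measurableU; [case: aE|case: aF].
Qed.

Lemma approxD E F : approx E -> approx F -> approx (E `\` F).
Proof.
move=> aE aF; apply: (approx_ops (op := fun a b => a - a * b)) (aE) (aF).
- move=> phi psi [Cp p01] [Cs s01]; split.
    apply: Cc_smoothB => //.
    by apply: Cc_smoothMl => //; case: Cp.
  by move=> x; have := p01 x; have := s01 x; nra.
- move=> a b c d a01 b01 c01 d01.
  have -> : a - a * b - (c - c * d) = (a - c) * (1 - b) - (b - d) * c by ring.
  apply: le_trans (ler_normB _ _) _; rewrite !normrM.
  by apply: lerD; rewrite ler_piMr// ger0_norm; lra.
- move=> x _; rewrite !indicE in_setD.
  by case: (x \in E); case: (x \in F) => /=; ring.
- by apply: measurableD; [case: aE|case: aF].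
Qed.

Lemma approx_lim (E_ : nat -> set 'rV[R]_n) E : measurable E ->
  (forall k, approx (E_ k)) ->
  (forall x, Omega x -> \forall k \near \oo, E_ k x <-> E x) ->
  approx E.
Proof.
move=> mE aE cE; split => // e e0.
have e2 : 0 < e / 2 by rewrite divr_gt0.
have mEk k : measurable (E_ k) by case: (aE k).
have [||||k kE] := @weighted_dist_cvg (fun k => \1_(E_ k)) \1_E _ _ _ _ _ e2.
- by move=> k; exact: mind.
- exact: mind.
- by move=> k x; rewrite indicE ger0_norm ?ler0n// lern1 leq_b1.
- move=> x Ox; apply: cvg_near_cst; near=> k; rewrite !indicE.
  have [kE Ek] : E_ k x <-> E x by near: k; exact: cE.
  by rewrite (_ : (x \in E_ k) = (x \in E))//; apply/idP/idP; rewrite !inE.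
have [_ /(_ _ e2)[phi tp pe]] := aE k; exists phi => //.
rewrite (splitr e) EFinD; apply: le_lt_trans (lteD pe kE).
apply: weighted_dist_le; try exact: mind; try exact: test_measurable => //.
move=> x _; exact: ler_distD.
Unshelve. all: by end_near. Qed.

Lemma approx0 : approx set0.
Proof.
split => // e e0; exists (cst 0); first by split; [exact: Cc_smooth0|move=> x /=; rewrite lexx ler01].
rewrite /weighted_dist integral0_eq ?lte_fin// => x _.
by rewrite indic0 subrr normr0 mul0r.
Qed.

Lemma approx_bigcup (E_ : nat -> set 'rV[R]_n) : (forall k, approx (E_ k)) ->
  approx (\bigcup_k E_ k).
Proof.
move=> aE; apply: (@approx_lim (fun k => \big[setU/set0]_(i < k) E_ i)).
- by apply: bigcup_measurable => k _; case: (aE k).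
- by move=> k; elim/big_ind : _ => //; [exact: approx0|exact: approxU].
- move=> x _; have [[m _ Emx]|nE] := pselect ((\bigcup_k E_ k) x).
    exists m.+1 => // k /= mk; split => _; first by exists m.
    by rewrite -bigcup_mkord; exists m.
  apply: nearW => k; split => //; rewrite -bigcup_mkord => -[m mk Emx].
  by case: nE; exists m.
Qed.

(** If b is a bump that is positive exactly on the box, the functions 1 - (1 - b)^k
    converge to the indicator of the box and vanish where b does. *)
Lemma approx_open_box (a b : 'rV[R]_n) :
  [set x : 'rV[R]_n | forall i, a 0 i <= x 0 i <= b 0 i] `<=` Omega ->
  approx (open_box a b).
Proof.
move=> abO.
have mB : measurable (open_box a b) by apply: open_measurable_mx; exact: open_open_box.
split => // e e0.
pose f_ k : 'rV[R]_n -> R := fun x => 1 - (1 - box_bump a b x) ^+ k.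
have b01 x := box_bump01 a b x.
have Tf k : test_fun (f_ k).
  split => [|x].
    apply: (@Cc_support_sub _ _ _ _ (box_bump a b)).
    - apply: smoothB; first exact: smooth_cst.
      apply: smooth_exp; apply: smoothB; [exact: smooth_cst|exact: smooth_box_bump].
    - exact: Cc_box_bump.
    - by move=> x bx; rewrite /f_ bx subr0 expr1n subrr.
  have h : 0 <= 1 - box_bump a b x <= 1 by have := b01 x; lra.
  have [h1 h2] := andP h.
  by rewrite /f_ subr_ge0 exprn_ile1//= lerBlDr lerDl exprn_ge0.
have [||||k kE] := @weighted_dist_cvg f_ \1_(open_box a b) _ _ _ _ _ e0.
- by move=> k; exact: test_measurable.
- exact: mind.
- by move=> k x; have [_ /(_ x)/andP[h1 h2]] := Tf k; rewrite ger0_norm.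
- move=> x _; rewrite indicE.
  case: (boolP (x \in open_box a b)) => [/[!inE] xB|/negP xB].
    rewrite -[X in _ --> X]subr0; apply: cvgB; first exact: cvg_cst.
    apply: cvg_expr; have /eqP := (box_bump_neq0 a b x).2 xB.
    by have := b01 x; move=> /andP[h1 h2] /eqP h3; rewrite ger0_norm; lra.
  have -> : f_ ^~ x = cst 0; last exact: cvg_cst.
  apply/funext => k; rewrite /f_.
  have -> : box_bump a b x = 0.
    by apply/eqP/negPn/negP => /box_bump_neq0 h; apply: xB; rewrite inE.
  by rewrite subr0 expr1n subrr.
by exists (f_ k).
Qed.

End density.

Section box_cover.
Context {R : realType} {n : nat}.

Definition closed_box (a b : 'rV[R]_n) : set 'rV[R]_n :=
  [set x | forall i, a 0 i <= x 0 i <= b 0 i].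

Lemma open_box_sub (a b : 'rV[R]_n) : open_box a b `<=` closed_box a b.
Proof. by move=> x h i; have /andP[/ltW-> /ltW->] := h i. Qed.

(** Boxes with rational centre and rational size. Enumerating all of them and putting
    the empty set in place of those that do not fit avoids choosing an enumeration of
    the good ones. *)
Lemma open_box_cover (U : set 'rV[R]_n) : open U ->
  exists E_ : nat -> set 'rV[R]_n, U = \bigcup_k E_ k /\
    forall k, E_ k = set0 \/
      exists a b, closed_box a b `<=` U /\ E_ k = open_box a b.
Proof.
move=> oU.
pose lo (p : 'rV[rat]_n * rat) : 'rV[R]_n := \row_i (ratr (p.1 0 i) - ratr p.2).
pose hi (p : 'rV[rat]_n * rat) : 'rV[R]_n := \row_i (ratr (p.1 0 i) + ratr p.2).
pose B p := if `[< closed_box (lo p) (hi p) `<=` U >] then open_box (lo p) (hi p) else set0.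
exists (fun k => if unpickle k is Some p then B p else set0); split; last first.
  move=> k; case: unpickle => [p|]; last by left.
  rewrite /B; case: ifPn => [/asboolP pU|_]; last by left.
  by right; exists (lo p), (hi p).
apply/seteqP; split => [x Ux|x [k _]]; last first.
  case: unpickle => [p|//]; rewrite /B; case: ifPn => [/asboolP pU|//] xB.
  exact/pU/open_box_sub.
have [r r0 rU] := near_mx_cube (oU x Ux).
have [q] := @rat_in_itvoo R 0 (r / 2) (divr_gt0 r0 (ltr0Sn R 1)).
rewrite in_itv/= => /andP[q0 qr].
have qe i : exists s : rat, `|x 0 i - ratr s| < ratr q.
  have [|s] := @rat_in_itvoo R (x 0 i - ratr q) (x 0 i + ratr q); first by lra.
  by rewrite in_itv/= => /andP[s1 s2]; exists s; rewrite ltr_norml; lra.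
have [s sP] := choice qe.
pose p := (\row_i s i, q) : 'rV[rat]_n * rat.
exists (pickle p) => //; rewrite pickleK /B ifT.
  by move=> i; rewrite !mxE/=; have := sP i; rewrite ltr_norml; lra.
apply/asboolP => y yp; apply: rU => i j; rewrite ord1.
have := yp j; have := sP j; rewrite !mxE/= !ltr_norml; lra.
Qed.

End box_cover.

Section approx_measurable.
Context {R : realType} {n : nat}.
Variable Omega : set 'rV[R]_n.
Hypothesis openO : open Omega.
Variable w : 'rV[R]_n -> R.
Hypothesis w0 : forall x, Omega x -> 0 <= w x.
Hypothesis iw : lebesgue_rV.-integrable Omega (EFin \o w).

(** Only the trace of a set on Omega matters for the weighted distance, so an arbitrary
    open U may be replaced by its intersection with Omega. *)
Lemma approx_open (U : set 'rV[R]_n) : open U -> approx Omega w U.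
Proof.
move=> oU.
have [E_ [UE EP]] := open_box_cover (openI oU openO).
have aUO : approx Omega w (U `&` Omega).
  rewrite UE; apply: (approx_bigcup openO w0 iw) => k.
  case: (EP k) => [->|[a [b [abU ->]]]]; first exact: approx0.
  apply: (approx_open_box openO w0 iw) => x h.
  by have [] := abU x h.
apply: (@approx_lim _ _ _ openO _ w0 iw (fun=> U `&` Omega)) => //.
  exact: open_measurable_mx.
by move=> x Ox; apply: nearW => k; split=> [[]|].
Qed.

(** The approximable sets form a sigma-algebra, which contains the open sets, in
    particular the open half-spaces that generate the Borel sets. *)
Lemma approx_measurable (E : set 'rV[R]_n) : measurable E -> approx Omega w E.
Proof.
have aC F : approx Omega w F -> approx Omega w (~` F).
  by move=> aF; rewrite -setTD; apply: (approxD openO w0 iw) => //; exact/approx_open/openT.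
have a0 := @approx0 _ _ Omega w.
have aU := approx_bigcup openO w0 iw.
apply: smallest_sub.
  split => //.
    by move=> A aA; rewrite setTD; exact: aC.
move=> _ [i [j [B mB ->]]].
move: B mB.
pose S : set (set R) := [set B | approx Omega w [set A : 'rV[R]_n | B (A i j)]].
suff h : (@ocitv R).-sigma.-measurable `<=` S by exact: h.
rewrite measurable_realfun.RGenOInfty.measurableE.
apply: smallest_sub.
  split.
  - exact: a0.
  - by move=> A; rewrite setTD; exact: aC.
  - move=> F aF; exact: (aU _ aF).
move=> _ [x ->]; apply: approx_open.
rewrite (_ : mkset _ = (fun A : 'rV[R]_n => A i j) @^-1` [set y | x < y]).
  by apply: open_comp; [move=> y _; exact: coord_continuous|exact: open_gt].
by apply/seteqP; split => y /=; rewrite in_itv/= andbT.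
Qed.

End approx_measurable.

(** * Lebesgue spaces of matrix-valued functions *)

Section enorm_theory.
Context {R : realType} {k l : nat}.
Implicit Types A B : 'M[R]_(k, l).

Lemma enorm_ge0 A : 0 <= enorm A.
Proof. exact: sqrtr_ge0. Qed.

Lemma enorm0 : enorm (0 : 'M[R]_(k, l)) = 0.
Proof.
rewrite /enorm big1 ?sqrtr0// => i _; rewrite big1// => j _.
by rewrite mxE expr0n.
Qed.

Lemma entry_le_enorm A i j : `|A i j| <= enorm A.
Proof.
rewrite /enorm -sqrtr_sqr ler_wsqrtr//.
rewrite (bigD1 i)//= (bigD1 j)//= -addrA lerDl addr_ge0//.
  by apply: sumr_ge0 => a _; exact: sqr_ge0.
by apply: sumr_ge0 => a _; apply: sumr_ge0 => b _; exact: sqr_ge0.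
Qed.

Lemma sum_sqr_le (I : Type) (s : seq I) (f : I -> R) : (forall i, 0 <= f i) ->
  \sum_(i <- s) f i ^+ 2 <= (\sum_(i <- s) f i) ^+ 2.
Proof.
move=> f0; elim: s => [|i s IH]; first by rewrite !big_nil expr0n.
rewrite !big_cons; have : 0 <= \sum_(j <- s) f j by exact: sumr_ge0.
by have := f0 i; nra.
Qed.

Lemma enorm_le_sum A : enorm A <= \sum_i \sum_j `|A i j|.
Proof.
have S0 : 0 <= \sum_i \sum_j `|A i j|.
  by apply: sumr_ge0 => i _; exact: sumr_ge0.
rewrite -[leRHS]ger0_norm// -sqrtr_sqr /enorm ler_wsqrtr//.
apply: le_trans (sum_sqr_le _ _); last by move=> i; exact: sumr_ge0.
apply: ler_sum => i _; apply: le_trans (sum_sqr_le _ _) => //.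
by apply: ler_sum => j _; rewrite real_normK// num_real.
Qed.

Lemma measurable_enorm : measurable_fun setT (@enorm R k l).
Proof.
apply: (measurableT_comp (f := @Num.sqrt R)).
  by apply: continuous_measurable_fun; exact: sqrt_continuous.
apply: measurable_sum => i; apply: measurable_sum => j.
apply: measurable_funX; exact: measurable_entry.
Qed.

Lemma measurable_fun_mx d (T : measurableType d) (D : set T) (f : T -> 'M[R]_(k, l)) :
  (forall i j, measurable_fun D (fun x => f x i j)) -> measurable_fun D f.
Proof.
move=> mf mD; apply: (@measurability _ _ _ _ D f (@matrix_cylinders _ R k l)) => //.
by move=> _ [_ [i [j [B mB ->]]] <-]; exact: mf.
Qed.

Lemma measurable_fun_entry d (T : measurableType d) (D : set T) (f : T -> 'M[R]_(k, l)) i j :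
  measurable_fun D f -> measurable_fun D (fun x => f x i j).
Proof.
move=> mf; apply: (measurableT_comp (f := fun A : 'M[R]_(k, l) => A i j)) => //.
exact: measurable_entry.
Qed.

Lemma measurable_fun_enorm d (T : measurableType d) (D : set T) (f : T -> 'M[R]_(k, l)) :
  measurable_fun D f -> measurable_fun D (fun x => enorm (f x)).
Proof. by move=> mf; apply: measurableT_comp => //; exact: measurable_enorm. Qed.

End enorm_theory.

Section Lp_theory.
Context {R : realType} {n k l : nat}.
Implicit Types (D : set 'rV[R]_n) (f g : 'rV[R]_n -> 'M[R]_(k, l)) (q : R).
Local Notation mu := (@lebesgue_rV R n).

Lemma Lpnorm1E D f : Lpnorm D 1 f = (\int[mu]_(x in D) (enorm (f x))%:E)%E.
Proof.
rewrite /Lpnorm Lnorm1 [RHS]integral_mkcond; apply: eq_integral => x _.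
rewrite /patch; case: ifP => _; last by rewrite abse0.
by rewrite gee0_abs// lee_fin enorm_ge0.
Qed.

Lemma Lpnorm_powE D q f : q != 0 ->
  (Lpnorm D q f `^ q = \int[mu]_(x in D) (enorm (f x) `^ q)%:E)%E.
Proof.
move=> q0; rewrite /Lpnorm poweR_Lnorm// [RHS]integral_mkcond.
apply: eq_integral => x _; rewrite /patch; case: ifP => _; last first.
  by rewrite abse0 poweR0r.
by rewrite gee0_abs ?lee_fin ?enorm_ge0.
Qed.

Lemma Lpnorm_ltyP D q f : 0 < q ->
  (Lpnorm D q f < +oo)%E <-> (\int[mu]_(x in D) (enorm (f x) `^ q)%:E < +oo)%E.
Proof.
move=> q0; have q0' : q != 0 by rewrite gt_eqF.
rewrite -Lpnorm_powE//; split; first exact: poweR_lty.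
exact: lty_poweRy.
Qed.

Lemma Lpnorm_ge0 D q f : (0 <= Lpnorm D q f)%E.
Proof. exact: Lnorm_ge0. Qed.

(** The Euclidean norm of a matrix lies between the absolute value of each entry and
    the sum of these, so integrability may be tested entry by entry. All questions
    about L^1 functions with matrix values are reduced to scalar ones in this way. *)
Lemma integrable_entriesP D f : measurable D ->
  (measurable_fun D f /\ (Lpnorm D 1 f < +oo)%E) <->
  forall i j, mu.-integrable D (fun x => (f x i j)%:E).
Proof.
move=> mD; rewrite Lpnorm1E; split.
  move=> [mf fi] i j; apply: (@le_integrable _ _ _ _ _ mD _ (fun x => (enorm (f x))%:E)).
  - by apply/measurable_EFinP; exact: measurable_fun_entry.
  - by move=> x _; rewrite !abse_EFin lee_fin (ger0_norm (enorm_ge0 _)) entry_le_enorm.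
  apply/integrableP; split; first by apply/measurable_EFinP; exact: measurable_fun_enorm.
  by under eq_integral do rewrite gee0_abs ?lee_fin ?enorm_ge0//.
move=> fi.
have mf : measurable_fun D f.
  by apply: measurable_fun_mx => i j; apply/measurable_EFinP; case/integrableP: (fi i j).
split=> //.
have : mu.-integrable D (fun x => (enorm (f x))%:E).
  apply: (@le_integrable _ _ _ _ _ mD _ (fun x => \sum_i \sum_j `|(f x i j)%:E|)%E).
  - by apply/measurable_EFinP; exact: measurable_fun_enorm.
  - move=> x _; rewrite abse_EFin (ger0_norm (enorm_ge0 _)) gee0_abs; last first.
      by apply: sume_ge0 => i _; apply: sume_ge0.
    under eq_bigr do rewrite sumEFin; rewrite sumEFin lee_fin; exact: enorm_le_sum.
  - apply: integrable_sum => // i _; apply: integrable_sum => // j _.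
    exact: integrable_abse.
by case/integrableP => _; under eq_integral do rewrite gee0_abs ?lee_fin ?enorm_ge0//.
Qed.

Lemma Lp1P D f : measurable D ->
  Lp D 1 f <-> forall i j, mu.-integrable D (fun x => (f x i j)%:E).
Proof. exact: integrable_entriesP. Qed.

(** On a set of finite measure, because s <= 1 + s^q. *)
Lemma Lp_L1 D q f : measurable D -> (mu D < +oo)%E -> 1 <= q ->
  Lp D q f -> Lp D 1 f.
Proof.
move=> mD Dfin q1 [mf /Lpnorm_ltyP fq]; split => //; rewrite Lpnorm1E.
have q0 : 0 < q by rewrite (lt_le_trans _ q1).
have mfq : measurable_fun D (fun x => (enorm (f x) `^ q)%:E).
  apply/measurable_EFinP; apply: (measurableT_comp (f := fun t : R => t `^ q)).
    exact: measurable_powR.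
  exact: measurable_fun_enorm.
apply: (@le_lt_trans _ _ (\int[mu]_(x in D) (1 + (enorm (f x) `^ q)%:E))%E).
  apply: ge0_le_integral => //.
  - by move=> x _; rewrite lee_fin enorm_ge0.
  - by apply/measurable_EFinP; exact: measurable_fun_enorm.
  - exact: emeasurable_funD.
  move=> x _; rewrite -EFinD lee_fin.
  have [h|/ltW h] := leP (enorm (f x)) 1; first by rewrite ler_wpDr// powR_ge0.
  by rewrite ler_wpDl// -[leLHS]powRr1 ?enorm_ge0// ler_powR.
rewrite ge0_integralD//=; last by move=> x _; rewrite lee_fin powR_ge0.
by rewrite integral_cst// mul1e lte_add_pinfty// fq.
Qed.

Lemma measurable_enorm_powR D q f : measurable_fun D f ->
  measurable_fun D (fun x => (enorm (f x) `^ q)%:E).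
Proof.
move=> mf; apply/measurable_EFinP; apply: (measurableT_comp (f := fun t : R => t `^ q)).
  exact: measurable_powR.
exact: measurable_fun_enorm.
Qed.

Lemma powR_add_le (s t q : R) : 0 <= s -> 0 <= t -> 0 <= q ->
  (s + t) `^ q <= 2 `^ q * (s `^ q + t `^ q).
Proof.
move=> s0 t0 q0; wlog st : s t s0 t0 / s <= t.
  by move=> h; have [/h|/ltW/h] := leP s t; [exact|rewrite addrC [_ `^ q + _]addrC; exact].
apply: (@le_trans _ _ ((2 * t) `^ q)).
  by apply: ge0_ler_powR; rewrite ?nnegrE; lra.
by rewrite powRM// ler_wpM2l ?powR_ge0// lerDr powR_ge0.
Qed.

Lemma enorm_lin_le (a b : R) (A B : 'M[R]_(k, l)) :
  enorm (a *: A + b *: B) <= (k * l)%:R * (`|a| + `|b|) * (enorm A + enorm B).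
Proof.
apply: le_trans (enorm_le_sum _) _.
apply: (@le_trans _ _ (\sum_(i < k) \sum_(j < l) (`|a| + `|b|) * (enorm A + enorm B))); last first.
  by rewrite !sumr_const !card_ord -mulrnA -[leRHS]mulrA [leRHS]mulr_natl mulnC.
apply: ler_sum => i _; apply: ler_sum => j _; rewrite !mxE.
apply: le_trans (ler_normD _ _) _; rewrite !normrM.
have hA := entry_le_enorm A i j; have hB := entry_le_enorm B i j.
have := normr_ge0 a; have := normr_ge0 b; have := normr_ge0 (A i j); have := normr_ge0 (B i j).
by nra.
Qed.

Lemma Lp_lin D q (a b : R) f g : measurable D -> 1 <= q -> Lp D q f -> Lp D q g ->
  Lp D q (fun x => a *: f x + b *: g x).
Proof.
move=> mD q1.
have q0 : 0 < q by rewrite (lt_le_trans _ q1).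
move=> [mf /(Lpnorm_ltyP _ _ q0) fq] [mg /(Lpnorm_ltyP _ _ q0) gq].
have mfg : measurable_fun D (fun x => a *: f x + b *: g x).
  apply: measurable_fun_mx => i j.
  rewrite (_ : (fun x => _) = (fun x => a * f x i j + b * g x i j)); last first.
    by apply/funext => x; rewrite !mxE.
  by apply: measurable_funD; apply: measurable_funM => //; exact: measurable_fun_entry.
split => //; apply/(Lpnorm_ltyP _ _ q0).
pose K : R := ((k * l)%:R * (`|a| + `|b|)) `^ q * 2 `^ q.
have K0 : 0 <= K by rewrite mulr_ge0// powR_ge0.
have mpf := measurable_enorm_powR q mf; have mpg := measurable_enorm_powR q mg.
apply: (@le_lt_trans _ _ (\int[mu]_(x in D)
    (K%:E * ((enorm (f x) `^ q)%:E + (enorm (g x) `^ q)%:E)))%E).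
  apply: ge0_le_integral; first exact: mD.
  - by move=> x _; rewrite lee_fin powR_ge0.
  - exact: measurable_enorm_powR.
  - by apply: measurable_funeM; exact: (emeasurable_funD mpf mpg).
  move=> x _; rewrite -EFinD -EFinM lee_fin.
  apply: (@le_trans _ _ (((k * l)%:R * (`|a| + `|b|) * (enorm (f x) + enorm (g x))) `^ q)).
    apply: ge0_ler_powR; rewrite ?nnegrE ?enorm_ge0//; first exact: ltW.
      by rewrite !mulr_ge0 ?addr_ge0 ?enorm_ge0.
    exact: enorm_lin_le.
  rewrite powRM ?mulr_ge0 ?addr_ge0 ?enorm_ge0// /K -mulrA ler_wpM2l ?powR_ge0//.
  by apply: powR_add_le; rewrite ?enorm_ge0// ltW.
rewrite ge0_integralZl_EFin//; last 2 first.
- by move=> x _; rewrite -EFinD lee_fin addr_ge0// powR_ge0.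
- exact: (emeasurable_funD mpf mpg).
have p0 h x : D x -> (0 <= (enorm (h x : 'M[R]_(k, l)) `^ q)%:E)%E.
  by move=> _; rewrite lee_fin powR_ge0.
rewrite (ge0_integralD mu mD (p0 f) mpf (p0 g) mpg).
have fgq := lte_add_pinfty fq gq.
by apply: lte_mul_pinfty fgq => //; rewrite lee_fin.
Qed.

(** The inclusion of L^q in L^1 is continuous at 0. For a fixed threshold t > 0,
    s <= t + t (s/t)^q for all s >= 0; this is integrated, with t chosen according to
    d and to the measure of D. *)
Lemma Lp_small D q (d : R) : measurable D -> (mu D < +oo)%E -> 1 <= q -> 0 < d ->
  exists2 e, 0 < e & forall f, measurable_fun D f -> (Lpnorm D q f < e%:E)%E ->
    (Lpnorm D 1 f < d%:E)%E.
Proof.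
move=> mD Dfin q1 d0.
have q0 : 0 < q by rewrite (lt_le_trans _ q1).
have [m mE] : exists m, mu D = m%:E.
  by exists (fine (mu D)); rewrite fineK// ge0_fin_numE.
have m0 : 0 <= m by rewrite -lee_fin -mE.
(* t (m + 1) = d / 2, and the q-th power of e is t^q (m + 1) *)
pose t := d / (2 * (m + 1)).
have t0 : 0 < t by rewrite divr_gt0// mulr_gt0// ltr_wpDl.
pose e := t * (m + 1) `^ q^-1.
have e0 : 0 < e by rewrite mulr_gt0// powR_gt0// ltr_wpDl.
exists e => // f mf fe.
have fq : (\int[mu]_(x in D) (enorm (f x) `^ q)%:E <= (t `^ q * (m + 1))%:E)%E.
  rewrite -Lpnorm_powE ?gt_eqF//.
  have -> : (t `^ q * (m + 1))%:E = (e%:E `^ q)%E.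
    rewrite poweR_EFin /e powRM ?powR_ge0// ?ltW// -powRrM mulVf ?gt_eqF//.
    by rewrite powRr1// ltW// ltr_wpDl.
  apply: gt0_ler_poweR.
  - exact: ltW.
  - by rewrite in_itv/= leey Lpnorm_ge0.
  - by rewrite in_itv/= leey lee_fin ltW.
  - exact: ltW.
rewrite Lpnorm1E.
have mpf := measurable_enorm_powR q mf.
have tq : 0 <= t * t `^ (- q) by rewrite mulr_ge0 ?powR_ge0// ltW.
apply: (@le_lt_trans _ _ (\int[mu]_(x in D)
   (t%:E + (t * t `^ (- q))%:E * (enorm (f x) `^ q)%:E))%E).
  apply: ge0_le_integral => //.
  - by move=> x _; rewrite lee_fin enorm_ge0.
  - by apply/measurable_EFinP; exact: measurable_fun_enorm.
  - by apply: emeasurable_funD => //; exact: measurable_funeM.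
  move=> x _; rewrite -EFinM -EFinD lee_fin.
  have [h|/ltW h] := leP (enorm (f x)) t.
    by rewrite ler_wpDr// mulr_ge0// powR_ge0.
  apply: ler_wpDl; first exact: ltW.
  have -> : t * t `^ (- q) * enorm (f x) `^ q = t * (enorm (f x) / t) `^ q.
    rewrite powRM ?enorm_ge0 ?invr_ge0 ?ltW// powRN -mulrA; congr (_ * _).
    by rewrite mulrC -[in t^-1 `^ q]powR_inv1 ?ltW// -powRrM mulN1r powRN.
  rewrite mulrC -ler_pdivrMr//.
  have h1 : 1 <= enorm (f x) / t by rewrite ler_pdivlMr// mul1r.
  by rewrite -[leLHS]powRr1 ?(le_trans _ h1)// ler_powR.
rewrite ge0_integralD//=; last 3 first.
- by move=> x _; rewrite lee_fin ltW.
- by move=> x _; rewrite -EFinM lee_fin mulr_ge0// powR_ge0.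
- exact: measurable_funeM.
rewrite integral_cst//= mE ge0_integralZl_EFin//; last by move=> x _; rewrite lee_fin powR_ge0.
apply: (@le_lt_trans _ _ (t * m + t * t `^ (- q) * (t `^ q * (m + 1)))%:E).
  rewrite EFinD EFinM leeD2l// [in leRHS]EFinM.
  exact: lee_wpmul2l.
rewrite lte_fin.
have -> : t * t `^ (- q) * (t `^ q * (m + 1)) = t * (m + 1).
  rewrite powRN mulrA -(mulrA t) mulVf ?mulr1// gt_eqF// powR_gt0//.
have -> : d = t * (2 * (m + 1)) by rewrite /t divfK// gt_eqF// mulr_gt0// ltr_wpDl.
nra.
Qed.

End Lp_theory.

(** * The fundamental lemma of the calculus of variations *)

Section fundamental.
Context {R : realType} {n : nat}.
Variable Omega : set 'rV[R]_n.
Hypothesis openO : open Omega.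
Let mO : measurable Omega := open_measurable_mx openO.
Local Notation mu := (@lebesgue_rV R n).

Lemma closed_measurable_mx (K : set 'rV[R]_n) : closed K -> measurable K.
Proof. by move=> /closed_openC /open_measurable_mx /measurableC; rewrite setCK. Qed.

Lemma compact_measurable_mx (K : set 'rV[R]_n) : compact K -> measurable K.
Proof.
move=> cK; apply: closed_measurable_mx; apply: compact_closed cK.
exact: (@norm_hausdorff _ 'rV[R]_n).
Qed.

Definition loc_integrable (g : 'rV[R]_n -> R) : Prop :=
  measurable_fun Omega g /\
  forall K, compact K -> K `<=` Omega -> mu.-integrable K (EFin \o g).

Lemma Cc_measurable (D : set 'rV[R]_n) phi : Cc_smooth Omega phi -> measurable_fun D phi.
Proof.
case=> sp _ _; apply: measurable_funTS.
by apply: continuous_measurable_mx; exact: smooth_cont.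
Qed.

Lemma loc_integrableM g phi : loc_integrable g -> Cc_smooth Omega phi ->
  mu.-integrable Omega (fun x => (g x * phi x)%:E).
Proof.
move=> [mg ig] Cp; have [sp cK KO] := Cp.
set K := closure _ in cK KO.
have mK := compact_measurable_mx cK.
have [M M0 pM] := Cc_bounded Cp.
have iK : mu.-integrable K (fun x => (g x * phi x)%:E).
  have := @integrableMl _ _ _ mu K mK (EFin \o g) phi (ig _ cK KO) (Cc_measurable Cp).
  apply; exists M; split; first exact: num_real.
  by move=> r Mr x _; exact: le_trans (pM x) (ltW Mr).
have : mu.-integrable setT ((fun x => (g x * phi x)%:E) \_ K) by exact: (integrable_mkcond _ mK).1 iK.
have -> : (fun x => (g x * phi x)%:E) \_ K = (fun x => (g x * phi x)%:E) \_ Omega.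
  apply/funext => x; rewrite /patch; case: ifPn => [|xK].
    by rewrite inE => /KO xO; rewrite mem_set.
  case: ifPn => // _; rewrite (_ : phi x = 0) ?mulr0//.
  apply/eqP/negP => /negP px; move/negP: xK; apply; rewrite inE.
  exact: subset_closure.
exact: (integrable_mkcond _ mO).2.
Qed.

(** On a box whose closure lies in Omega, g is integrable and the indicator of any
    measurable subset E is approximated by test functions in L^1 of |g| dx. So the
    integral of g over every such E vanishes. *)
Lemma fundamental_lemma g : loc_integrable g ->
  (forall phi, Cc_smooth Omega phi -> \int[mu]_(x in Omega) (g x * phi x) = 0) ->
  {ae mu, forall x, Omega x -> g x = 0}.
Proof.
move=> [mg ig] g0.
have [E_ [OE EP]] := open_box_cover openO.
suff h k : {ae mu, forall x, E_ k x -> g x = 0}.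
  have : {ae mu, forall x k, E_ k x -> g x = 0} by apply/ae_foralln.
  apply: filterS => x gx; rewrite OE => -[k _]; exact: gx.
case: (EP k) => [->|[a [b [abO ->]]]]; first exact: aeW.
set B := open_box a b.
have BO : B `<=` Omega := subset_trans (@open_box_sub _ _ a b) abO.
have oB : open B by exact: open_open_box.
have mB := open_measurable_mx oB.
have iB : mu.-integrable B (EFin \o g).
  have cK := @compact_box _ _ a b.
  apply: integrableS (ig _ cK abO) => //; first exact: compact_measurable_mx.
  exact: open_box_sub.
have iB' : mu.-integrable B (EFin \o (fun x => `|g x|)) by exact: integrable_norm.
have gB phi : Cc_smooth B phi -> \int[mu]_(x in B) (g x * phi x) = 0.
  move=> Cp; rewrite -[RHS](g0 phi); last first.
    by case: Cp => sp cp pB; split => //; exact: subset_trans pB BO.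
  rewrite Rintegral_mkcond [RHS]Rintegral_mkcond; congr Rintegral.
  apply/funext => x; rewrite /patch; case: ifPn => [|/negP xB].
    by rewrite inE => /BO xO; rewrite mem_set.
  case: ifP => // _; rewrite (Cc_eq0 Cp) ?mulr0// => xB'; apply: xB.
  by rewrite inE.
have mg' : measurable_fun B g by case/integrableP : iB => /measurable_EFinP.
suff : ae_eq mu B (EFin \o g) (cst 0%E).
  by apply: filterS => x /= h Bx; have [] := h Bx.
apply: (integral_ae_eq mB iB) => // E EB mE.
rewrite integral0.
have iE : mu.-integrable E (EFin \o g) by exact: integrableS iB.
have Efin := integrable_fin_num mE iE.
rewrite -(fineK Efin); congr EFin; apply/eqP; rewrite -normr_le0.
apply/ler_addgt0Pr => e e0; rewrite add0r.
have [_ /(_ e e0)[phi [Cp p01] pe]] :=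
  @approx_measurable _ _ B oB (fun x => `|g x|) (fun x _ => normr_ge0 _) iB' E mE.
have ip : mu.-integrable B (fun x => (g x * phi x)%:E).
  have [M M0 pM] := Cc_bounded Cp.
  apply: (@integrableMl _ _ _ mu B mB (EFin \o g) phi iB).
    apply: measurable_funTS; apply: continuous_measurable_mx.
    by case: Cp => sp _ _; exact: smooth_cont sp.
  exists M; split; first exact: num_real.
  by move=> r Mr x _; exact: le_trans (pM x) (ltW Mr).
have iE' : mu.-integrable B (fun x => (g x * \1_E x)%:E).
  apply: (@integrableMl _ _ _ mu B mB (EFin \o g) \1_E iB).
    by apply/measurable_funTS/measurable_indic.
  exists 1; split; first exact: num_real.
  move=> r Mr x _ /=; apply: le_trans _ (ltW Mr).
  by rewrite indicE ger0_norm ?ler0n// lern1 leq_b1.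
have -> : fine (\int[mu]_(x in E) (EFin \o g) x) = \int[mu]_(x in B) (g x * \1_E x - g x * phi x).
  rewrite RintegralB// (gB _ Cp) subr0 /Rintegral; congr fine.
  rewrite [LHS]integral_mkcond [RHS]integral_mkcond; apply: eq_integral => x _.
  rewrite /patch indicE; case: ifPn => [|xE].
    by rewrite inE => /EB xB; rewrite mem_set//= mulr1.
  by case: ifP => // _; rewrite mulr0.
rewrite -lee_fin EFin_normr_Rintegral//; last first.
  exact: (integrableB mB iE' ip).
apply: ltW; apply: le_lt_trans pe; apply: le_trans (le_abse_integral _ _ _) _ => //.
  apply/measurable_EFinP; apply: measurable_funB; apply/measurable_EFinP.
    by case/integrableP: iE'.
  by case/integrableP: ip.
rewrite le_eqVlt; apply/orP; left; apply/eqP; apply: eq_integral => x _.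
rewrite abse_EFin; congr EFin.
by rewrite -mulrBr normrM mulrC distrC.
Qed.

End fundamental.

(** * The integral of a partial derivative *)

Section fubini_rV.
Context {R : realType}.
Local Notation mu n := (@lebesgue_rV R n).

(** Lebesgue measure on R^(1+n) is the image of a product measure under [consrV], and
    Fubini's theorem applies to the product. *)
Lemma integrable_consrV n (f : 'rV[R]_(1 + n) -> \bar R) :
  (mu n.+1).-integrable setT f ->
  (lebesgue_measure \x mu n)%E.-integrable setT (f \o @consrV R n).
Proof.
move=> /integrableP[mf fi]; apply/integrableP; split.
  by apply: measurableT_comp mf _; exact: measurable_consrV.
move: fi; rewrite ge0_integral_consrV//; last exact: measurableT_comp.
rewrite fubini_tonelli1//=.
by apply: measurableT_comp => //; apply: measurableT_comp mf _; exact: measurable_consrV.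
Qed.

Lemma integral_consrV_prod n (f : 'rV[R]_(1 + n) -> \bar R) :
  (mu n.+1).-integrable setT f ->
  (\int[mu n.+1]_x f x = \int[lebesgue_measure \x mu n]_z f (@consrV R n z))%E.
Proof.
move=> fi; have [mf _] := integrableP _ _ _ fi.
transitivity (\int[pushforward (lebesgue_measure \x mu n)%E (@consrV R n)]_x f x)%E.
  by apply: eq_measure_integral; [exact: measurable_consrV|].
rewrite integral_pushforward//; first exact: measurable_consrV.
exact: integrable_consrV.
Qed.

Lemma integral_consrV12 n (f : 'rV[R]_(1 + n) -> \bar R) :
  (mu n.+1).-integrable setT f ->
  (\int[mu n.+1]_x f x = \int[lebesgue_measure]_s \int[mu n]_y f (@consrV R n (s, y)))%E.
Proof.
move=> fi; rewrite integral_consrV_prod//.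
by rewrite -(integral12_prod_meas1 (integrable_consrV fi)).
Qed.

Lemma integral_consrV21 n (f : 'rV[R]_(1 + n) -> \bar R) :
  (mu n.+1).-integrable setT f ->
  (\int[mu n.+1]_x f x = \int[mu n]_y \int[lebesgue_measure]_s f (@consrV R n (s, y)))%E.
Proof.
move=> fi; rewrite integral_consrV_prod//.
by rewrite -(integral21_prod_meas1 (integrable_consrV fi)).
Qed.

Lemma cube_sub_box n (M : R) : @cube R n M `<=`
  closed_box (const_mx (- M)) (const_mx M).
Proof. by move=> x h i; rewrite !mxE; have := h i; rewrite ltr_norml => /andP[/ltW-> /ltW->]. Qed.

Lemma continuous_cube_bounded n (f : 'rV[R]_n -> R) M : continuous f ->
  (forall x, ~ cube M x -> f x = 0) -> exists2 C, 0 <= C & forall x, `|f x| <= C.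
Proof.
move=> cf f0.
have [/(_ _)|/existsNP[x0 fx0]] := pselect (forall x, f x = 0).
  by move=> fz; exists 0 => // x; rewrite fz normr0.
have x0B : closed_box (const_mx (- M)) (const_mx M) x0.
  by apply: cube_sub_box; apply: contrapT => /f0.
have [||c cc cmax] := @compact_EVT_max _ _ (fun x => `|f x|) _ _ (@compact_box _ _ (const_mx (- M)) (const_mx M)).
- by exists x0.
- by apply: continuous_subspaceT => x; apply: continuous_comp; [exact: cf|exact: norm_continuous].
exists `|f c| => // x; have [xM|nxM] := pselect (cube M x); last by rewrite f0// normr0.
by apply: cmax; rewrite inE; exact: cube_sub_box.
Qed.

Lemma continuous_cube_integrable n (f : 'rV[R]_n -> R) M : continuous f ->
  (forall x, ~ cube M x -> f x = 0) -> (mu n).-integrable setT (EFin \o f).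
Proof.
move=> cf f0; have [C C0 fC] := continuous_cube_bounded cf f0.
have mc := @measurable_cube R n M.
have : (mu n).-integrable (cube M) (EFin \o f).
  apply: measurable_bounded_integrable => //; first exact: lebesgue_cube_lty.
    by apply: measurable_funTS; exact: continuous_measurable_mx.
  exists C; split; first exact: num_real.
  by move=> r Cr x _; exact: le_trans (fC x) (ltW Cr).
move/(integrable_mkcond _ mc).1; congr (is_true (_.-integrable _ _)).
apply/funext => x; rewrite /patch; case: ifPn => // /negP xM /=.
by rewrite f0// => h; apply: xM; rewrite inE.
Qed.

Lemma pderive_cube0 n (f : 'rV[R]_n -> R) M j :
  (forall x, ~ cube M x -> f x = 0) -> forall x, ~ cube (M + 1) x -> pderive j f x = 0.
Proof.
move=> f0 x nx; apply: pderive_eq0 => xc; apply: nx.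
have /(_ _ _)/= h := @closure_subset _ _ _ _ x xc.
have {}xc : closure (closed_box (const_mx (- M)) (const_mx M)) x.
  apply: h => y /= fy; apply: cube_sub_box; apply: contrapT => /f0 fy0.
  by rewrite fy0 eqxx in fy.
have cB : closed (closed_box (const_mx (- M)) (const_mx M : 'rV[R]_n)).
  apply: compact_closed; last exact: compact_box.
  exact: (@norm_hausdorff _ 'rV[R]_n).
rewrite -(closure_id _).1 // in xc => i.
by have := xc i; rewrite !mxE ltr_norml; lra.
Qed.

Lemma integral_derive0 (f df : R -> R) (M : R) : continuous df ->
  (forall s : R, is_derive s 1 f (df s)) -> (forall s, M <= `|s| -> f s = 0) ->
  (forall s, M <= `|s| -> df s = 0) ->
  (\int[lebesgue_measure]_s (df s)%:E = 0)%E.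
Proof.
move=> cdf fD f0 df0.
pose K : R := `|M| + 1.
have K0 : 0 < K by rewrite ltr_wpDl.
have MK : M <= K by rewrite (le_trans (ler_norm M))// lerDl.
have -> : (\int[lebesgue_measure]_s (df s)%:E =
   \int[lebesgue_measure]_(s in `[(- K)%R, K]) (df s)%:E)%E.
  rewrite [RHS]integral_mkcond; apply: eq_integral => s _; rewrite /patch.
  case: ifPn => // /negP; rewrite inE /= in_itv/= -ler_norml => /negP; rewrite -ltNge => h.
  by rewrite df0// (le_trans MK)// ltW.
have cf : continuous f.
  move=> s; apply: differentiable_continuous; apply/derivable1_diffP.
  by have [] := fD s.
rewrite (@continuous_FTC2 _ df f).
- rewrite !f0 ?subee// ?normrN gtr0_norm//.
- by lra.
- exact: continuous_subspaceT.
- split.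
  + by move=> s _; have [] := fD s.
  + by apply: cvg_at_right_filter; exact: cf.
  + by apply: cvg_at_left_filter; exact: cf.
- by move=> s _; rewrite derive1E; have [_ ->] := fD s.
Qed.

Lemma consrV_delta0 n (s h : R) (y : 'rV[R]_n) :
  h *: delta_mx 0 (lshift n 0) + @consrV R n (s, y) = consrV (h *: 1 + s, y).
Proof.
apply/rowP => i; rewrite /consrV /= !mxE eqxx /=.
case: (split_ordP i) => j ->.
  by rewrite !mxE eq_lshift ord1.
by rewrite eq_rlshift mulr0 add0r.
Qed.

Lemma consrV_delta1 n (s h : R) (y : 'rV[R]_n) (j : 'I_n) :
  h *: delta_mx 0 (rshift 1 j) + @consrV R n (s, y) = consrV (s, h *: delta_mx 0 j + y).
Proof.
apply/rowP => i; rewrite /consrV /= !mxE eqxx /=.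
case: (split_ordP i) => k ->.
  by rewrite eq_lrshift mulr0 add0r !mxE.
by rewrite !mxE eq_rshift.
Qed.

Lemma continuous_coords (T : topologicalType) n (g : T -> 'rV[R]_n) :
  (forall i, continuous (fun t => g t 0 i)) -> continuous g.
Proof.
move=> cg x U /near_mx_cube[r r0 rU].
suff : \forall t \near x, forall j, `|g t 0 j - g x 0 j| < r.
  by apply: filterS => t h; apply: rU => i j; rewrite ord1.
apply: filter_forall => j.
have /cvgrPdist_lt/(_ r r0) := cg j x.
by apply: filterS => t; rewrite distrC.
Qed.

Lemma consrV_continuous1 n (y : 'rV[R]_n) : continuous (fun s => @consrV R n (s, y)).
Proof.
apply: continuous_coords => i; rewrite /consrV /=.
case: (split_ordP i) => j ->.
  under eq_fun do rewrite row_mxEl mxE.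
  by move=> s; exact: cvg_id.
under eq_fun do rewrite row_mxEr.
exact: cst_continuous.
Qed.

Lemma consrV_continuous2 n (s : R) : continuous (fun y => @consrV R n (s, y)).
Proof.
apply: continuous_coords => i; rewrite /consrV /=.
case: (split_ordP i) => j ->.
  under eq_fun do rewrite row_mxEl mxE.
  exact: cst_continuous.
under eq_fun do rewrite row_mxEr.
exact: coord_continuous.
Qed.

Lemma consrV_cube n M s (y : 'rV[R]_n) : cube M (@consrV R n (s, y)) ->
  `|s| < M /\ cube M y.
Proof.
move=> h; split.
  by have := h (lshift n 0); rewrite /consrV row_mxEl mxE.
by move=> i; have := h (rshift 1 i); rewrite /consrV row_mxEr.
Qed.

Lemma is_derive_consrV0 n (f : 'rV[R]_(1 + n) -> R) s (y : 'rV[R]_n) :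
  derivable f (consrV (s, y)) (delta_mx 0 (lshift n 0)) ->
  is_derive s 1 (fun s => f (consrV (s, y))) (pderive (lshift n 0) f (consrV (s, y))).
Proof.
rewrite /pderive /derivable /derive /=.
under eq_fun do rewrite consrV_delta0.
by move=> h; apply: DeriveDef.
Qed.

Lemma pderive_consrV1 n (f : 'rV[R]_(1 + n) -> R) s (y : 'rV[R]_n) (j : 'I_n) :
  (derivable f (consrV (s, y)) (delta_mx 0 (rshift 1 j)) ->
   derivable (fun y => f (consrV (s, y))) y (delta_mx 0 j)) /\
  pderive (rshift 1 j) f (consrV (s, y)) = pderive j (fun y => f (consrV (s, y))) y.
Proof.
rewrite /pderive /derivable /derive /=.
by under eq_fun do rewrite consrV_delta1.
Qed.

(** Integrate first along the j-th coordinate, where the fundamental theorem of calculus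
    gives 0. The induction on n peels off the first coordinate, so that either j is
    this coordinate or the induction hypothesis applies to the slices. *)
Lemma integral_pderive0 n (f : 'rV[R]_n -> R) M (j : 'I_n) : continuous f ->
  (forall x, derivable f x (delta_mx 0 j)) -> continuous (pderive j f) ->
  (forall x, ~ cube M x -> f x = 0) ->
  (\int[mu n]_x (pderive j f x)%:E = 0)%E.
Proof.
elim: n f j => [f [] //|n IH] f j cf df cdf f0.
have df0 := pderive_cube0 j f0.
have idf := continuous_cube_integrable cdf df0.
have [i ji|i ji] := @split_ordP 1 n j; rewrite {}ji in df cdf df0 idf *.
  rewrite (integral_consrV21 idf) /=; apply: integral0_eq => y _.
  rewrite ord1 in df cdf df0 *.
  apply: (@integral_derive0 (fun s => f (consrV (s, y))) _ (M + 1)).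
  - by move=> s; apply: continuous_comp; [exact: consrV_continuous1|exact: cdf].
  - by move=> s; exact: is_derive_consrV0.
  - by move=> s h; apply: f0 => /consrV_cube[]; lra.
  - by move=> s h; apply: df0 => /consrV_cube[]; lra.
rewrite (integral_consrV12 idf) /=; apply: integral0_eq => s _.
have E y := (pderive_consrV1 f s y i).2.
under eq_integral do rewrite E.
apply: IH.
- by move=> y; apply: continuous_comp; [exact: consrV_continuous2|exact: cf].
- by move=> y; apply: (pderive_consrV1 f s y i).1.
- rewrite (_ : pderive i _ = (fun y => pderive (rshift 1 i) f (consrV (s, y)))); last first.
    by apply/funext => y; rewrite E.
  by move=> y; apply: continuous_comp; [exact: consrV_continuous2|exact: cdf].
- by move=> y ny; apply: f0 => /consrV_cube[].
Qed.

End fubini_rV.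

(** * Weak gradients *)

Section weak_gradients.
Context {R : realType} {n : nat}.
Variable Omega : set 'rV[R]_n.
Hypothesis openO : open Omega.
Let mO : measurable Omega := open_measurable_mx openO.
Local Notation mu := (@lebesgue_rV R n).

Lemma L1loc_entry k l (f : 'rV[R]_n -> 'M[R]_(k, l)) i j :
  L1loc Omega f -> loc_integrable Omega (fun x => f x i j).
Proof.
move=> [mf fK]; split; first exact: measurable_fun_entry.
move=> K cK KO; have mK := compact_measurable_mx cK.
apply: (integrable_entriesP f mK).1; split; last exact: fK.
exact: measurable_funS mO KO mf.
Qed.

Lemma L1locP k l (f : 'rV[R]_n -> 'M[R]_(k, l)) :
  L1loc Omega f <-> forall i j, loc_integrable Omega (fun x => f x i j).
Proof.
split=> [h i j|h]; first exact: L1loc_entry.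
have mf : measurable_fun Omega f by apply: measurable_fun_mx => i j; have [] := h i j.
split => // K cK KO; have mK := compact_measurable_mx cK.
suff fi i j : mu.-integrable K (fun x => (f x i j)%:E).
  by have [] := (integrable_entriesP f mK).2 fi.
by have [_ /(_ K cK KO)] := h i j.
Qed.

Lemma loc_integrable_lin (f g : 'rV[R]_n -> R) (a b : R) :
  loc_integrable Omega f -> loc_integrable Omega g ->
  loc_integrable Omega (fun x => a * f x + b * g x).
Proof.
move=> [mf fK] [mg gK]; split.
  by apply: measurable_funD; apply: measurable_funM.
move=> K cK KO; have mK := compact_measurable_mx cK.
exact: (integrableD mK (integrableZl mK a (fK _ cK KO)) (integrableZl mK b (gK _ cK KO))).
Qed.

Lemma integrable_loc (f : 'rV[R]_n -> R) : mu.-integrable Omega (EFin \o f) ->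
  loc_integrable Omega f.
Proof.
move=> fi; split; first by case/integrableP : fi => /measurable_EFinP.
move=> K cK KO; apply: integrableS fi => //; exact: compact_measurable_mx.
Qed.

Lemma L1loc_lin k l (f g : 'rV[R]_n -> 'M[R]_(k, l)) (a b : R) :
  L1loc Omega f -> L1loc Omega g -> L1loc Omega (fun x => a *: f x + b *: g x).
Proof.
move=> /L1locP hf /L1locP hg; apply/L1locP => i j.
rewrite (_ : (fun x => _) = (fun x => a * f x i j + b * g x i j)).
  exact: loc_integrable_lin.
by apply/funext => x; rewrite !mxE.
Qed.

Lemma Lp1_L1loc k l (f : 'rV[R]_n -> 'M[R]_(k, l)) : Lp Omega 1 f -> L1loc Omega f.
Proof. by move=> /(Lp1P _ mO) h; apply/L1locP => i j; apply: integrable_loc; exact: h. Qed.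

Context {N : nat}.
Implicit Types (u v : 'rV[R]_n -> 'rV[R]_N) (G H : 'rV[R]_n -> 'M[R]_(N, n)).

(** This is what makes every statement about [weak_gradient] independent of the choice
    operator behind it: integrals over Omega may be computed with any weak gradient. *)
Lemma weak_gradient_unique u G H : is_weak_gradient Omega u G ->
  is_weak_gradient Omega u H -> {ae mu, forall x, Omega x -> G x = H x}.
Proof.
move=> [_ lG uG] [_ lH uH].
have : {ae mu, forall x, forall ij : 'I_N * 'I_n, Omega x -> G x ij.1 ij.2 = H x ij.1 ij.2}.
  suff h (ij : 'I_N * 'I_n) : {ae mu, forall x, Omega x -> G x ij.1 ij.2 = H x ij.1 ij.2}.
    by apply: filter_forall.
  case: ij => i j /=.
  have lGH := loc_integrable_lin 1 (-1) (L1loc_entry i j lG) (L1loc_entry i j lH).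
  suff : {ae mu, forall x, Omega x -> 1 * G x i j + -1 * H x i j = 0}.
    by apply: filterS => x h /h /eqP; rewrite mul1r mulN1r subr_eq0 => /eqP.
  apply: (fundamental_lemma openO lGH) => phi Cp.
  have iG := loc_integrableM openO (L1loc_entry i j lG) Cp.
  have iH := loc_integrableM openO (L1loc_entry i j lH) Cp.
  under eq_Rintegral do rewrite mul1r mulN1r mulrBl.
  rewrite RintegralB//; apply/eqP; rewrite subr_eq0; apply/eqP.
  by apply: oppr_inj; rewrite -uG// -uH.
apply: filterS => x h Ox; apply/matrixP => i j; exact: (h (i, j)).
Qed.

Lemma weak_gradientP u G : is_weak_gradient Omega u G ->
  is_weak_gradient Omega u (weak_gradient Omega u).
Proof. by move=> uG; apply: (@xgetPex _ (fun=> 0) [set G | is_weak_gradient Omega u G]); exists G. Qed.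

Lemma weak_gradient_ae u G : is_weak_gradient Omega u G ->
  {ae mu, forall x, Omega x -> weak_gradient Omega u x = G x}.
Proof. by move=> uG; exact: (weak_gradient_unique (weak_gradientP uG) uG). Qed.

Lemma is_weak_gradient_lin u v G H (a b : R) : is_weak_gradient Omega u G ->
  is_weak_gradient Omega v H ->
  is_weak_gradient Omega (fun x => a *: u x + b *: v x) (fun x => a *: G x + b *: H x).
Proof.
move=> [lu lG uG] [lv lH vH]; split; [exact: L1loc_lin|exact: L1loc_lin|].
move=> phi Cp i j; have Cdp := Cc_pderive j Cp.
have iu := loc_integrableM openO (L1loc_entry 0 i lu) Cdp.
have iv := loc_integrableM openO (L1loc_entry 0 i lv) Cdp.
have iG := loc_integrableM openO (L1loc_entry i j lG) Cp.
have iH := loc_integrableM openO (L1loc_entry i j lH) Cp.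
transitivity (\int[mu]_(x in Omega) (a * (u x 0 i * pderive j phi x) +
    b * (v x 0 i * pderive j phi x))).
  by apply: eq_Rintegral => x _; rewrite !mxE mulrDl -!mulrA.
rewrite (RintegralD mO (integrableZl mO a iu) (integrableZl mO b iv)).
rewrite (RintegralZl a mO iu) (RintegralZl b mO iv) uG// vH//.
transitivity (- \int[mu]_(x in Omega) (a * (G x i j * phi x) + b * (H x i j * phi x))).
  rewrite (RintegralD mO (integrableZl mO a iG) (integrableZl mO b iH)).
  by rewrite (RintegralZl a mO iG) (RintegralZl b mO iH) !mulrN opprD.
by congr (- _); apply: eq_Rintegral => x _; rewrite !mxE mulrDl -!mulrA.
Qed.

Lemma energyE (F : 'M[R]_(N, n) -> R) u G : continuous F ->
  (forall z, 0 <= F z) -> is_weak_gradient Omega u G ->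
  energy F Omega u = (\int[mu]_(x in Omega) (F (G x))%:E)%E.
Proof.
move=> cF F0 uG; have wG := weak_gradientP uG.
have mF H : L1loc Omega H -> measurable_fun Omega (fun x => (F (H x))%:E).
  move=> LH; have mH := LH.1; apply/measurable_EFinP; exact: (measurableT_comp (continuous_measurable_mx cF) mH).
apply: ge0_ae_eq_integral => //.
- by have [_ LwG _] := wG; exact: mF.
- by have [_ LG _] := uG; exact: mF.
- by move=> x _; rewrite lee_fin.
- by move=> x _; rewrite lee_fin.
- by apply: filterS (weak_gradient_ae uG) => x h Ox; rewrite h.
Qed.

Lemma Lpnorm_weak_gradient q u G : q != 0 -> is_weak_gradient Omega u G ->
  Lpnorm Omega q (weak_gradient Omega u) = Lpnorm Omega q G.
Proof.
move=> q0 uG; have wG := weak_gradientP uG.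
suff E : (Lpnorm Omega q (weak_gradient Omega u) `^ q = Lpnorm Omega q G `^ q)%E.
  have P (f : 'rV[R]_n -> 'M[R]_(N, n)) : Lpnorm Omega q f = ((Lpnorm Omega q f `^ q) `^ q^-1)%E.
    by rewrite -poweRrM divff// poweRe1// Lpnorm_ge0.
  by rewrite P E -P.
rewrite [LHS](Lpnorm_powE _ _ q0) [RHS](Lpnorm_powE _ _ q0).
apply: ge0_ae_eq_integral; first exact: mO.
- by have [_ [mwG _] _] := wG; exact: measurable_enorm_powR.
- by have [_ [mG _] _] := uG; exact: measurable_enorm_powR.
- by move=> x _; rewrite lee_fin powR_ge0.
- by move=> x _; rewrite lee_fin powR_ge0.
- by apply: filterS (weak_gradient_ae uG) => x h Ox; rewrite h.
Qed.

Definition classical_gradient (phi : 'rV[R]_n -> 'rV[R]_N) : 'rV[R]_n -> 'M[R]_(N, n) :=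
  fun x => \matrix_(i, j) pderive j (fun y => phi y 0 i) x.

Hypothesis boundedO : bounded_set Omega.

Lemma Cc_cube (phi : 'rV[R]_n -> R) : Cc_smooth Omega phi ->
  exists M, forall x, ~ cube M x -> phi x = 0.
Proof.
move=> Cp; have [M _ OM] := bounded_sub_cube boundedO.
by exists M => x nx; apply: (Cc_eq0 Cp) => /OM.
Qed.

Lemma Cc_integrable (phi : 'rV[R]_n -> R) : Cc_smooth Omega phi ->
  mu.-integrable Omega (EFin \o phi).
Proof.
move=> Cp; have [M pM] := Cc_cube Cp; have [sp _ _] := Cp.
by apply: integrableS (continuous_cube_integrable (smooth_cont sp) pM).
Qed.

Lemma integral_Omega_setT (f : 'rV[R]_n -> R) : (forall x, ~ Omega x -> f x = 0) ->
  \int[mu]_(x in Omega) f x = \int[mu]_x f x.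
Proof.
move=> f0; rewrite Rintegral_mkcond; congr Rintegral; apply/funext => x.
by rewrite /patch; case: ifPn => // /negP xO; rewrite f0// => h; apply: xO; rewrite inE.
Qed.

Lemma Cc_integration_by_parts (phi psi : 'rV[R]_n -> R) j :
  Cc_smooth Omega phi -> Cc_smooth Omega psi ->
  \int[mu]_(x in Omega) (phi x * pderive j psi x) =
  - \int[mu]_(x in Omega) (pderive j phi x * psi x).
Proof.
move=> Cp Cs; have [sp _ _] := Cp; have [ss _ _] := Cs.
have Cps : Cc_smooth Omega (phi \* psi) := Cc_smoothMl sp Cs.
have [M pM] := Cc_cube Cps; have [sps _ _] := Cps.
have := integral_pderive0 (smooth_cont sps) (fun x => @smooth_derivable _ _ _ j x sps)
  (smooth_cont (smooth_pderive j sps)) pM.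
have E x : pderive j (phi \* psi) x = phi x * pderive j psi x + pderive j phi x * psi x.
  rewrite /pderive deriveM; try exact: smooth_derivable.
  by rewrite [in RHS]mulrC [X in _ + X]mulrC [X in X + _]mulrC.
move=> /(congr1 fine) /= I0.
have {}I0 : \int[mu]_(x in Omega) (phi x * pderive j psi x + pderive j phi x * psi x) = 0.
  rewrite integral_Omega_setT => [|x xO].
    by rewrite -[RHS]I0 /Rintegral; congr fine; apply: eq_integral => x _; rewrite E.
  by rewrite (Cc_eq0 Cp xO) (Cc_eq0 Cs xO) mul0r mulr0 addr0.
have i1 := Cc_integrable (Cc_smoothMl sp (Cc_pderive j Cs)).
have i2 := Cc_integrable (Cc_smoothMl (smooth_pderive j sp) Cs).
by move: I0; rewrite (RintegralD mO i1 i2) => /eqP; rewrite addr_eq0 => /eqP.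
Qed.

(** Integrate a product of two test functions by parts. *)
Lemma is_weak_gradient_Cc (phi : 'rV[R]_n -> 'rV[R]_N) :
  (forall i, Cc_smooth Omega (fun x => phi x 0 i)) ->
  is_weak_gradient Omega phi (classical_gradient phi).
Proof.
move=> Cp; split.
- by apply/L1locP => i j; rewrite ord1; apply/integrable_loc/Cc_integrable/Cp.
- apply/L1locP => i j; rewrite /classical_gradient.
  under eq_fun do rewrite mxE.
  by apply/integrable_loc/Cc_integrable/Cc_pderive/Cp.
move=> psi Cs i j; rewrite Cc_integration_by_parts//.
by congr (- _); apply: eq_Rintegral => x _; rewrite mxE.
Qed.

End weak_gradients.

(** * Subgradients of convex functions *)

Section subgradients.
Context {R : realType} {N n : nat}.
Local Notation M := 'M[R]_(N, n).
Implicit Types (A B z : M).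

(** The Frobenius inner product of matrices. *)
Definition dotm B z : R := \sum_i \sum_j B i j * z i j.

Lemma dotmDr B z1 z2 : dotm B (z1 + z2) = dotm B z1 + dotm B z2.
Proof.
rewrite /dotm -big_split; apply: eq_bigr => i _; rewrite -big_split.
by apply: eq_bigr => j _; rewrite mxE mulrDr.
Qed.

Lemma dotmZr B t z : dotm B (t *: z) = t * dotm B z.
Proof.
rewrite /dotm mulr_sumr; apply: eq_bigr => i _; rewrite mulr_sumr.
by apply: eq_bigr => j _; rewrite mxE mulrCA.
Qed.

Lemma dotmBr B z1 z2 : dotm B (z1 - z2) = dotm B z1 - dotm B z2.
Proof. by rewrite -scaleN1r dotmDr dotmZr mulN1r. Qed.

Lemma dotmDl A B z : dotm (A + B) z = dotm A z + dotm B z.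
Proof.
rewrite /dotm -big_split; apply: eq_bigr => i _; rewrite -big_split.
by apply: eq_bigr => j _; rewrite mxE mulrDl.
Qed.

Lemma dotmZl t B z : dotm (t *: B) z = t * dotm B z.
Proof.
rewrite /dotm mulr_sumr; apply: eq_bigr => i _; rewrite mulr_sumr.
by apply: eq_bigr => j _; rewrite mxE mulrA.
Qed.

Lemma dotm0l z : dotm 0 z = 0.
Proof. by rewrite /dotm big1// => i _; rewrite big1// => j _; rewrite mxE mul0r. Qed.

Lemma dotm_delta_l (p : 'I_N * 'I_n) z : dotm (delta_mx p.1 p.2) z = z p.1 p.2.
Proof.
rewrite /dotm (bigD1 p.1)//= [X in _ + X]big1 ?addr0; last first.
  by move=> i /negbTE ip; rewrite big1// => j _; rewrite mxE ip mul0r.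
rewrite (bigD1 p.2)//= big1 ?addr0 ?mxE ?eqxx ?mul1r//.
by move=> j /negbTE jp; rewrite mxE jp andbF mul0r.
Qed.

Variable F : M -> R.
Hypothesis convF : convex_function [set: M] F.

Lemma convexP (a : R) z1 z2 : 0 <= a -> a <= 1 ->
  F (a *: z1 + (1 - a) *: z2) <= a * F z1 + (1 - a) * F z2.
Proof.
move=> a0 a1.
have := convF (@Itv01 _ a a0 a1) (mem_set (I : setT z1)) (mem_set (I : setT z2)).
by rewrite convRE.
Qed.

(** The finite-dimensional Hahn-Banach argument. The entries in s are the directions
    already treated. For a new direction e, convexity shows that every slope of F at c
    towards -e lies below every slope towards +e; the supremum of the former is the
    next coefficient of B. *)
Lemma subgradient_on (c : M) (s : seq ('I_N * 'I_n)) : exists B,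
  forall z, (forall p, p \notin s -> z p.1 p.2 = 0) -> F c + dotm B z <= F (c + z).
Proof.
elim: s => [|p s [B BP]].
  exists 0 => z z0; rewrite (_ : z = 0) ?addr0 ?dotm0l ?addr0//.
  by apply/matrixP => i j; rewrite mxE; exact: (z0 (i, j)).
pose V z := forall p, p \notin s -> z p.1 p.2 = 0 :> R.
pose e : M := delta_mx p.1 p.2.
pose S : set R := [set r | exists z t, [/\ V z, 0 < t & r = (F c + dotm B z - F (c + z - t *: e)) / t]].
have V0 : V 0 by move=> q _; rewrite mxE.
have key z z' (t s' : R) : V z -> V z' -> 0 < t -> 0 < s' ->
    (F c + dotm B z - F (c + z - t *: e)) / t <= (F (c + z' + s' *: e) - F c - dotm B z') / s'.
  move=> Vz Vz' t0 s0; rewrite ler_pdivrMr// mulrAC ler_pdivlMr//.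
  have st0 : 0 < s' + t by rewrite addr_gt0.
  (* the convex combination of c + z - t e and c + z' + s' e in which e cancels *)
  pose a := s' / (s' + t).
  have a0 : 0 <= a by rewrite divr_ge0// ltW.
  have a1 : a <= 1 by rewrite ler_pdivrMr// mul1r lerDl ltW.
  have a'E : 1 - a = t / (s' + t) by rewrite /a; field; rewrite gt_eqF.
  have V'' : V (a *: z + (1 - a) *: z').
    by move=> q qs; rewrite !mxE (Vz q qs) (Vz' q qs) !mulr0 addr0.
  have h1 := BP _ V''.
  have h2 := convexP (c + z - t *: e) (c + z' + s' *: e) a0 a1.
  have E : a *: (c + z - t *: e) + (1 - a) *: (c + z' + s' *: e) =
      c + (a *: z + (1 - a) *: z').
    apply/matrixP => i j; rewrite !mxE a'E /a; field; rewrite gt_eqF//.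
  rewrite E in h2; rewrite dotmDr !dotmZr in h1.
  have {h1 h2} h := le_trans h1 h2.
  have : (s' + t) * (F c + (a * dotm B z + (1 - a) * dotm B z')) <=
         (s' + t) * (a * F (c + z - t *: e) + (1 - a) * F (c + z' + s' *: e)).
    by rewrite ler_pM2l.
  rewrite a'E /a.
  set fz := F (c + z - _); set fz' := F (c + z' + _).
  have -> : (s' + t) * (F c + (s' / (s' + t) * dotm B z + t / (s' + t) * dotm B z')) =
    (s' + t) * F c + s' * dotm B z + t * dotm B z' by field; rewrite gt_eqF.
  have -> : (s' + t) * (s' / (s' + t) * fz + t / (s' + t) * fz') = s' * fz + t * fz'.
    by field; rewrite gt_eqF.
  by nra.
have S0 : S !=set0.
  by exists ((F c + dotm B 0 - F (c + 0 - 1 *: e)) / 1), 0, 1.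
have ubS : has_ubound S.
  exists ((F (c + 0 + 1 *: e) - F c - dotm B 0) / 1) => _ [z [t [Vz t0 ->]]].
  exact: key.
pose beta := sup S.
have lo z t : V z -> 0 < t -> F c + dotm B z - t * beta <= F (c + z - t *: e).
  move=> Vz t0.
  have : (F c + dotm B z - F (c + z - t *: e)) / t <= beta.
    by apply: sup_upper_bound => //; exists z, t.
  by rewrite ler_pdivrMr//; lra.
have hi z t : V z -> 0 < t -> F c + dotm B z + t * beta <= F (c + z + t *: e).
  move=> Vz t0.
  have : beta <= (F (c + z + t *: e) - F c - dotm B z) / t.
    apply: ge_sup => // _ [z' [t' [Vz' t'0 ->]]]; exact: key.
  by rewrite ler_pdivlMr//; lra.
(* the induction hypothesis leaves the entry p of B free; it is set to beta *)
exists (B + (beta - B p.1 p.2) *: e) => z zV.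
pose t := z p.1 p.2; pose z' := z - t *: e.
have Vz' : V z'.
  move=> q qs; rewrite /z' !mxE.
  have [->|qp] := eqVneq q p; first by rewrite !eqxx mulr1 subrr.
  have /negbTE -> : ~~ ((q.1 == p.1) && (q.2 == p.2)).
    by apply: contra qp => /andP[/eqP h1 /eqP h2]; apply/eqP/injective_projections.
  by rewrite mulr0 subr0; apply: zV; rewrite inE negb_or qp.
have zE : z = z' + t *: e by rewrite subrK.
have dz : dotm (B + (beta - B p.1 p.2) *: e) z = dotm B z' + t * beta.
  rewrite dotmDl dotmZl dotm_delta_l -/t [in dotm B z]zE dotmDr dotmZr.
  have -> : dotm B e = B p.1 p.2.
    rewrite -(dotm_delta_l p B) /dotm; apply: eq_bigr => i _; apply: eq_bigr => j _.
    by rewrite mulrC.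
  ring.
rewrite dz addrA zE addrA; have [t0|t0|t0] := ltgtP t 0.
- have := @lo z' (- t) Vz' _; rewrite scaleNr opprK mulNr opprK; apply.
  by rewrite oppr_gt0.
- exact: hi.
- by rewrite t0 mul0r scale0r !addr0; exact: BP.
Qed.

Lemma subgradient (c : M) : exists B, forall z, F c + dotm B (z - c) <= F z.
Proof.
have [B BP] := subgradient_on c (enum {: 'I_N * 'I_n}).
exists B => z; rewrite -[in leRHS](subrKC c z); apply: BP => p.
by rewrite mem_enum.
Qed.

Hypothesis cF : continuous F.

(** Take the tangents at the matrices with rational entries. To see that they approach
    F z, compare the tangent at a rational y near z with the value of F at the
    reflection 2 y - z of z, which takes the place of a bound on the subgradients. *)
Lemma convex_sup_affine : exists (a : nat -> R) (B : nat -> M),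
  (forall k z, a k + dotm (B k) z <= F z) /\
  (forall z e, 0 < e -> exists k, F z - e < a k + dotm (B k) z).
Proof.
have [sB sBP] := choice subgradient.
pose c k : M := if unpickle k is Some p then map_mx ratr (p : 'M[rat]_(N, n)) else 0.
exists (fun k => F (c k) - dotm (sB (c k)) (c k)), (fun k => sB (c k)).
split=> [k z|z e e0].
  by have := sBP (c k) z; rewrite dotmBr; lra.
have e2 : 0 < e / 3 by rewrite divr_gt0.
have [r r0 rP] : exists2 r, 0 < r & mx_cube z r `<=` [set y | `|F z - F y| < e / 3].
  by apply: near_mx_cube; have /cvgrPdist_lt := @cF z; exact.
have r3 : 0 < r / 3 by rewrite divr_gt0.
have qe (ij : 'I_N * 'I_n) : exists s : rat, `|ratr s - z ij.1 ij.2| < r / 3.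
  have [|s] := @rat_in_itvoo R (z ij.1 ij.2 - r / 3) (z ij.1 ij.2 + r / 3); first by lra.
  by rewrite in_itv/= => /andP[s1 s2]; exists s; rewrite ltr_norml; lra.
have [s sP] := choice qe.
exists (pickle (\matrix_(i, j) s (i, j) : 'M[rat]_(N, n))).
rewrite /c pickleK; set y := map_mx _ _.
have yz i j : `|y i j - z i j| < r / 3 by rewrite !mxE; exact: (sP (i, j)).
have h1 : `|F z - F y| < e / 3.
  by apply: rP => i j; apply: lt_trans (yz i j) _; lra.
have h2 : `|F z - F (y - (z - y))| < e / 3.
  apply: rP => i j; rewrite !mxE; have := yz i j; rewrite !mxE !ltr_norml; lra.
have := sBP y (y - (z - y)).
have -> : y - (z - y) - y = -1 *: (z - y) by rewrite addrAC subrr add0r scaleN1r.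
rewrite dotmZr mulN1r dotmBr.
by move: h1 h2; rewrite !ltr_norml; lra.
Qed.

End subgradients.

(** * Convergence and finite sums of integrals *)

Section integral_tools.
Context d (T : measurableType d) (R : realType) (mu : {measure set T -> \bar R}).

Lemma cvge0_near_lt (u : nat -> \bar R) (e : R) : u @ \oo --> 0%E -> 0 < e ->
  \forall k \near \oo, (u k < e%:E)%E.
Proof.
move=> /fine_cvgP[fin] /cvgrPdist_lt h e0; have {}h := h e e0.
near=> k; have fk : u k \is a fin_num by near: k.
rewrite -(fineK fk) lte_fin.
have : `|0 - fine (u k)| < e by near: k.
by rewrite sub0r normrN => /ltr_normlW.
Unshelve. all: by end_near. Qed.

Lemma ge0_cvge0 (u : nat -> \bar R) : (forall k, 0 <= u k)%E ->
  (forall e : R, 0 < e -> \forall k \near \oo, (u k <= e%:E)%E) -> u @ \oo --> 0%E.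
Proof.
move=> u0 h; apply/fine_cvgP; split.
  have := h 1 ltr01; apply: filterS => k uk.
  by rewrite ge0_fin_numE// (le_lt_trans uk)// ltry.
apply/cvgrPdist_le => e e0; have := h e e0; apply: filterS => k uk.
have fk : u k \is a fin_num by rewrite ge0_fin_numE// (le_lt_trans uk)// ltry.
rewrite sub0r normrN ger0_norm ?fine_ge0//.
by rewrite -lee_fin fineK.
Qed.

Lemma cvg_sum_seq (I : Type) (s : seq I) (f : I -> nat -> R) (l : I -> R) :
  (forall i, f i @ \oo --> l i) ->
  (fun k => \sum_(i <- s) f i k) @ \oo --> \sum_(i <- s) l i.
Proof.
move=> fl; elim: s => [|i s IH].
  by rewrite big_nil; under eq_fun do rewrite big_nil; exact: cvg_cst.
rewrite big_cons; under eq_fun do rewrite big_cons.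
by apply: cvgD; [exact: fl|exact: IH].
Qed.

Lemma limn_einf_ge_cvg (e_ : nat -> \bar R) (s_ : nat -> \bar R) l :
  (forall k, s_ k <= e_ k)%E -> s_ @ \oo --> l -> (l <= limn_einf e_)%E.
Proof.
move=> se sl; rewrite -(cvg_limn_einf_sup sl).1 !limn_einf_lim.
apply: lee_lim; [exact: is_cvg_einfs|exact: is_cvg_einfs|].
apply: nearW => k; apply/ereal_infP => _ [m /= km <-].
by apply: le_trans (se m); apply: ereal_inf_lbound; exists m.
Qed.

Lemma Rintegral_sum (I : Type) (s : seq I) (D : set T) (f : I -> T -> R) :
  measurable D -> (forall i, mu.-integrable D (EFin \o f i)) ->
  mu.-integrable D (EFin \o (fun x => \sum_(i <- s) f i x)) /\
  \int[mu]_(x in D) (\sum_(i <- s) f i x) = \sum_(i <- s) \int[mu]_(x in D) f i x.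
Proof.
move=> mD fi; elim: s => [|i s [IH1 IH2]].
  split.
    rewrite (_ : _ \o _ = cst 0%E); first exact: integrable0.
    by apply/funext => x; rewrite /= big_nil.
  rewrite big_nil; under eq_Rintegral do rewrite big_nil.
  by rewrite Rintegral_cst// mul0r.
split.
  rewrite (_ : _ \o _ = ((EFin \o f i) \+ (EFin \o (fun x => (\sum_(i <- s) f i x)%R)))%E).
    exact: (integrableD mD (fi i) IH1).
  by apply/funext => x; rewrite /= big_cons.
rewrite big_cons -IH2 -(RintegralD mD (fi i) IH1).
by apply: eq_Rintegral => x _; rewrite big_cons.
Qed.

Lemma EFin_Rintegral (D : set T) (f : T -> R) : measurable D ->
  mu.-integrable D (EFin \o f) ->
  (\int[mu]_(x in D) f x)%:E = (\int[mu]_(x in D) (f x)%:E)%E.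
Proof. by move=> mD fi; rewrite fineK//; exact: integrable_fin_num. Qed.

End integral_tools.

(** * Lower semicontinuity of convex energies *)

Section lower_semicontinuity.
Context {R : realType} {n N : nat}.
Variable Omega : set 'rV[R]_n.
Hypothesis openO : open Omega.
Hypothesis boundedO : bounded_set Omega.
Let mO : measurable Omega := open_measurable_mx openO.
Local Notation mu := (@lebesgue_rV R n).

(** The test function is bounded. *)
Lemma L1_test_cvg (u_ : nat -> 'rV[R]_n -> 'rV[R]_N) u psi i :
  (forall k, L1loc Omega (u_ k)) -> L1loc Omega u ->
  (fun k => Lpnorm Omega 1 (u_ k \- u)) @ \oo --> 0%E -> Cc_smooth Omega psi ->
  (fun k => \int[mu]_(x in Omega) (u_ k x 0 i * psi x)) @ \oo -->
  \int[mu]_(x in Omega) (u x 0 i * psi x).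
Proof.
move=> lu_ lu cu Cp; have [C C0 pC] := Cc_bounded Cp.
apply/cvgrPdist_lt => e e0.
have C1 : 0 < C + 1 by rewrite ltr_wpDl.
have := cvge0_near_lt cu (divr_gt0 e0 C1); apply: filterS => k uk.
have ik := loc_integrableM openO (L1loc_entry openO 0 i (lu_ k)) Cp.
have iu := loc_integrableM openO (L1loc_entry openO 0 i lu) Cp.
have iB := integrableB mO iu ik.
rewrite -(RintegralB mO iu ik) -lte_fin EFin_normr_Rintegral; [|exact: mO|exact: iB].
have mB : measurable_fun Omega (fun x => (u x 0 i * psi x - u_ k x 0 i * psi x)%:E).
  by case/integrableP : iB.
apply: le_lt_trans (le_abse_integral _ mO mB) _.
have mw : measurable_fun Omega (fun x => (enorm ((u_ k \- u) x))%:E).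
  apply/measurable_EFinP; apply: measurable_fun_enorm.
  apply: measurable_fun_mx => a b; rewrite (_ : (fun x => _) = (fun x => u_ k x a b - u x a b)).
    apply: measurable_funB; apply: measurable_fun_entry; [exact: (lu_ k).1|exact: lu.1].
  by apply/funext => x; rewrite !mxE.
apply: (@le_lt_trans _ _ (\int[mu]_(x in Omega) (C%:E * (enorm ((u_ k \- u) x))%:E))%E).
  apply: ge0_le_integral.
  - exact: mO.
  - by move=> x _; exact: abse_ge0.
  - exact: measurableT_comp mB.
  - exact: measurable_funeM.
  move=> x _; rewrite abse_EFin -EFinM lee_fin -mulrBl normrM mulrC.
  apply: ler_pM => //; rewrite distrC.
  by have := entry_le_enorm ((u_ k \- u) x) 0 i; rewrite !mxE.
rewrite (ge0_integralZl_EFin mu mO) //; last first.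
  by move=> x _; rewrite lee_fin enorm_ge0.
rewrite -Lpnorm1E; have fk : Lpnorm Omega 1 (u_ k \- u) \is a fin_num.
  by rewrite ge0_fin_numE ?Lpnorm_ge0// (lt_trans uk)// ltry.
have : fine (Lpnorm Omega 1 (u_ k \- u)) < e / (C + 1) by rewrite -lte_fin fineK.
have : 0 <= fine (Lpnorm Omega 1 (u_ k \- u)) by rewrite fine_ge0// Lpnorm_ge0.
rewrite -[X in (_ * X < _)%E](fineK fk) -EFinM lte_fin ltr_pdivlMr//.
by set t := fine _; move=> t0 tC; lra.
Qed.

Variable F : 'M[R]_(N, n) -> R.
Hypothesis F0 : forall z, 0 <= F z.

(** An affine minorant of F whose coefficients depend on x through test functions. Its
    integral along a weak gradient can be integrated by parts, and is therefore
    continuous for L^1 convergence of the underlying functions. *)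
Definition admissible (a : 'rV[R]_n -> R) (b : 'rV[R]_n -> 'M[R]_(N, n)) : Prop :=
  [/\ Cc_smooth Omega a, forall i j, Cc_smooth Omega (fun x => b x i j) &
      forall x z, a x + dotm (b x) z <= F z].

Lemma admissible_integral a b u G : admissible a b -> is_weak_gradient Omega u G ->
  mu.-integrable Omega (EFin \o (fun x => a x + dotm (b x) (G x))) /\
  \int[mu]_(x in Omega) (a x + dotm (b x) (G x)) = \int[mu]_(x in Omega) a x -
    \sum_i \sum_j \int[mu]_(x in Omega) (u x 0 i * pderive j (fun y => b y i j) x).
Proof.
move=> [Ca Cb _] [lu lG uG].
have ia := Cc_integrable openO boundedO Ca.
have iG i j := loc_integrableM openO (L1loc_entry openO i j lG) (Cb i j).
have S1 i := Rintegral_sum (index_enum 'I_n) mO (iG i).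
have [S2 S3] := Rintegral_sum (index_enum 'I_N) mO (fun i => (S1 i).1).
have E x : dotm (b x) (G x) = \sum_i \sum_j G x i j * b x i j.
  by apply: eq_bigr => i _; apply: eq_bigr => j _; rewrite mulrC.
have -> : (fun x => a x + dotm (b x) (G x)) = (fun x => a x + \sum_i \sum_j G x i j * b x i j).
  by apply/funext => x; rewrite E.
split; first exact: (integrableD mO ia S2).
rewrite (RintegralD mO ia S2) S3; congr (_ + _); rewrite -sumrN.
apply: eq_bigr => i _; rewrite (S1 i).2 -sumrN; apply: eq_bigr => j _.
by rewrite uG// opprK.
Qed.

(** The left-hand side is the limit of the integrals of the same minorant along H_ k,
    each of which is at most the energy of H_ k. *)
Lemma admissible_lsc a b u G u_ H_ : admissible a b ->
  continuous F ->
  is_weak_gradient Omega u G -> (forall k, is_weak_gradient Omega (u_ k) (H_ k)) ->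
  (fun k => Lpnorm Omega 1 (u_ k \- u)) @ \oo --> 0%E ->
  ((\int[mu]_(x in Omega) (a x + dotm (b x) (G x)))%:E <=
   limn_einf (fun k => \int[mu]_(x in Omega) (F (H_ k x))%:E))%E.
Proof.
move=> ab cF uG uH cu.
apply: (@limn_einf_ge_cvg _ _ (fun k => (\int[mu]_(x in Omega) (a x + dotm (b x) (H_ k x)))%:E)).
  move=> k; have [ik _] := admissible_integral ab (uH k).
  have mF : measurable_fun Omega (fun x => (F (H_ k x))%:E).
    have [_ [mH _] _] := uH k; apply/measurable_EFinP.
    exact: (measurableT_comp (continuous_measurable_mx cF) mH).
  have [Foo|] := ltP (\int[mu]_(x in Omega) (F (H_ k x))%:E)%E +oo%E; last first.
    by rewrite leye_eq => /eqP ->; rewrite leey.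
  rewrite EFin_Rintegral//; apply: le_integral => //.
    apply/integrableP; split => //.
    by under eq_integral do rewrite gee0_abs ?lee_fin ?F0//.
  by move=> x _; rewrite lee_fin; case: ab.
apply: cvg_EFin; first exact: nearW.
have [Ca Cb _] := ab.
rewrite (admissible_integral ab uG).2.
under eq_fun => k do rewrite (admissible_integral ab (uH k)).2.
apply: cvgB; first exact: cvg_cst.
apply: cvg_sum_seq => i; apply: cvg_sum_seq => j.
apply: L1_test_cvg => //.
- by move=> k; case: (uH k).
- by case: uG.
- exact: Cc_pderive.
Qed.

Hypothesis cF : continuous F.
Variables (al : nat -> R) (B : nat -> 'M[R]_(N, n)).
Hypothesis alB_le : forall k z, al k + dotm (B k) z <= F z.
Hypothesis alB_sup : forall z e, 0 < e -> exists k, F z - e < al k + dotm (B k) z.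

(** Starting from 0 keeps these functions nonnegative; 0 is a minorant of F. They
    increase to F, so monotone convergence reduces lower semicontinuity of the energy
    to that of the integral of one of them along G. *)
Fixpoint max_affine (m : nat) (z : 'M[R]_(N, n)) : R :=
  if m is m'.+1 then Num.max (max_affine m' z) (al m' + dotm (B m') z) else 0.

Lemma max_affine_le m z : max_affine m z <= F z.
Proof. by elim: m => [|m IH] //=; rewrite ge_max IH alB_le. Qed.

Lemma max_affine_ge0 m z : 0 <= max_affine m z.
Proof. by elim: m => [|m IH] //=; rewrite le_max IH. Qed.

Lemma max_affine_nd z : {homo max_affine ^~ z : m k / (m <= k)%N >-> m <= k}.
Proof.
apply: homo_leq => [//|y x w|m]; first exact: le_trans.
by rewrite /= le_max lexx.
Qed.

Lemma max_affine_cvg z : max_affine ^~ z @ \oo --> F z.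
Proof.
apply/cvgrPdist_lt => e e0; have [k kP] := alB_sup z e0.
near=> m.
have km : (k < m)%N by near: m; exists k.+1.
have h1 : al k + dotm (B k) z <= max_affine m z.
  by apply: le_trans (max_affine_nd z km); rewrite /= le_max lexx orbT.
rewrite ger0_norm ?subr_ge0 ?max_affine_le//; lra.
Unshelve. all: by end_near. Qed.

Variable G : 'rV[R]_n -> 'M[R]_(N, n).
Hypothesis G1 : Lp Omega 1 G.
Hypothesis Ofin : (mu Omega < +oo)%E.

Let iG i j : mu.-integrable Omega (fun x => (G x i j)%:E).
Proof. exact: (Lp1P _ mO).1. Qed.

Lemma affine_integrable (c : R) (A : 'M[R]_(N, n)) :
  mu.-integrable Omega (EFin \o (fun x => c + dotm A (G x))).
Proof.
have S1 i : mu.-integrable Omega (EFin \o (fun x => \sum_j A i j * G x i j)).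
  apply: (Rintegral_sum (index_enum 'I_n) mO (fun j => _)).1 => j.
  exact: (integrableZl mO (A i j) (iG i j)).
have S2 := (Rintegral_sum (index_enum 'I_N) mO S1).1.
have ic : mu.-integrable Omega (EFin \o (cst c : 'rV[R]_n -> R)).
  apply: measurable_bounded_integrable => //.
  exists `|c|; split; first exact: num_real.
  by move=> r cr x _; exact: ltW.
exact: (integrableD mO ic S2).
Qed.

Lemma max_affine_integrable m :
  mu.-integrable Omega (EFin \o (fun x => max_affine m (G x))).
Proof.
elim: m => [|m IH] /=; first exact: integrable0.
have ia := affine_integrable (al m) (B m).
have mI : measurable_fun Omega (fun x => max_affine m (G x)).
  by case/integrableP : IH => /measurable_EFinP.
have ma : measurable_fun Omega (fun x => al m + dotm (B m) (G x)).
  by case/integrableP : ia => /measurable_EFinP.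
apply: (@le_integrable _ _ _ mu Omega mO _ _ _ _
   (integrableD mO (integrable_norm IH) (integrable_norm ia))).
  by apply/measurable_EFinP; exact: measurable_maxr.
move=> x _.
change (`|(max_affine m.+1 (G x))%:E| <=
  `|(`|max_affine m (G x)| + `|al m + dotm (B m) (G x)|)%:E|)%E.
rewrite !abse_EFin lee_fin [leRHS]ger0_norm ?addr_ge0//=.
by rewrite /Num.max; case: ifP => _; rewrite ?lerDl ?lerDr.
Qed.

(** By induction on m, the maximum of two affine functions is replaced by a convex
    combination of them: with E the set where the new function is the larger one along
    G, and phi a test function close to the indicator of E in L^1 of the weight |l - f|,
    the combination with coefficients 1 - phi and phi is again admissible. *)
Lemma max_affine_approx m (e : R) : 0 < e -> exists a b, admissible a b /\
  (\int[mu]_(x in Omega) (`|a x + dotm (b x) (G x) - max_affine m (G x)|)%:E < e%:E)%E.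
Proof.
elim: m e => [|m IH] e e0.
  exists (cst 0), (cst 0); split.
    split; first exact: Cc_smooth0.
      move=> i j; rewrite (_ : (fun x => _) = cst 0); first exact: Cc_smooth0.
      by apply/funext => x; rewrite mxE.
    by move=> x z; rewrite /= dotm0l addr0.
  rewrite integral0_eq ?lte_fin// => x _.
  by rewrite /= dotm0l addr0 subrr normr0.
have e2 : 0 < e / 2 by rewrite divr_gt0.
have [a [b [ab abe]]] := IH _ e2.
have [Ca Cb abF] := ab.
have iM := max_affine_integrable m.
have iA := affine_integrable (al m) (B m).
have iS : mu.-integrable Omega (EFin \o (fun x => a x + dotm (b x) (G x))).
  have ia := Cc_integrable openO boundedO Ca.
  have lG := Lp1_L1loc openO G1.
  have iGb i j : mu.-integrable Omega (EFin \o (fun x => b x i j * G x i j)).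
    rewrite (_ : _ \o _ = (fun x => (G x i j * b x i j)%:E)).
      exact: (loc_integrableM openO (L1loc_entry openO i j lG) (Cb i j)).
    by apply/funext => x; rewrite /= mulrC.
  have S1 i := (Rintegral_sum (index_enum 'I_n) mO (iGb i)).1.
  have S2 := (Rintegral_sum (index_enum 'I_N) mO S1).1.
  exact: (integrableD mO ia S2).
have mm f : mu.-integrable Omega (EFin \o f) -> measurable_fun Omega f.
  by case/integrableP => /measurable_EFinP.
pose S x := a x + dotm (b x) (G x).
pose l x := al m + dotm (B m) (G x).
pose f x := max_affine m (G x).
pose w x := `|l x - f x|.
have iw : mu.-integrable Omega (EFin \o w) by exact: integrable_norm (integrableB mO iA iM).
pose E := Omega `&` (l \- f) @^-1` `]0, +oo[%classic.
have mE : measurable E.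
  by apply: (measurable_funB (mm _ iA) (mm _ iM)) => //; exact: measurable_itv.
have [_ /(_ _ e2)[phi [Cp p01] pe]] :=
  @approx_measurable _ _ Omega openO w (fun x _ => normr_ge0 _) iw E mE.
have [sp _ _] := Cp.
pose psi := (cst 1 \- phi : 'rV[R]_n -> R).
have sps : smooth psi by apply: smoothB sp; exact: smooth_cst.
exists (fun x => psi x * a x + al m * phi x), (fun x => psi x *: b x + phi x *: B m).
split.
  split.
  - by apply: Cc_smoothD; [exact: (Cc_smoothMl sps Ca)|exact: Cc_smoothZ].
  - move=> i j; rewrite (_ : (fun x => _) =
        (psi \* (fun x => b x i j)) \+ (fun x => B m i j * phi x)).
      by apply: Cc_smoothD; [exact: (Cc_smoothMl sps (Cb i j))|exact: Cc_smoothZ].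
    by apply/funext => x; rewrite !mxE [phi x * _]mulrC.
  move=> x z; rewrite dotmDl !dotmZl /psi /=.
  have h1 := abF x z; have h2 := alB_le m z; have := p01 x; have := F0 z.
  by nra.
have mS : measurable_fun Omega S := mm _ iS.
have mf : measurable_fun Omega f := mm _ iM.
have ml : measurable_fun Omega l := mm _ iA.
have mphi : measurable_fun Omega phi := @Cc_measurable _ _ Omega Omega phi Cp.
have m1 : measurable_fun Omega (fun x => (`|S x - f x|)%:E).
  by apply/measurable_EFinP; apply: measurableT_comp => //; exact: measurable_funB.
have m2 : measurable_fun Omega (fun x => (`|phi x - \1_E x| * w x)%:E).
  apply/measurable_EFinP; apply: measurable_funM; last exact: mm.
  apply: measurableT_comp => //; apply: measurable_funB => //.
apply: (@le_lt_trans _ _ (\int[mu]_(x in Omega)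
   ((`|S x - f x|)%:E + (`|phi x - \1_E x| * w x)%:E))%E).
  apply: ge0_le_integral.
  - exact: mO.
  - by move=> x _; rewrite lee_fin.
  - apply/measurable_EFinP; apply: measurableT_comp => //.
    rewrite (_ : (fun x => _) = (fun x => (1 - phi x) * S x + phi x * l x - Num.max (f x) (l x))).
      apply: measurable_funB; last exact: measurable_maxr.
      apply: measurable_funD; apply: measurable_funM => //.
      exact: measurable_funB.
    apply/funext => x; rewrite dotmDl !dotmZl /psi /S /l /f /=; ring.
  - exact: emeasurable_funD.
  move=> x Ox; rewrite -EFinD lee_fin dotmDl !dotmZl /psi /=.
  have maxE : Num.max (f x) (l x) = f x + \1_E x * (l x - f x).
    rewrite indicE; case: (boolP (x \in E)) => [|/negP xE].
      rewrite inE => -[_ /=]; rewrite in_itv/= andbT subr_gt0 => /ltW /max_idPr ->.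
      by rewrite mul1r subrKC.
    rewrite mul0r addr0; apply/max_idPl; rewrite leNgt; apply/negP => lf; apply: xE.
    by rewrite inE; split => //=; rewrite in_itv/= andbT subr_gt0.
  rewrite -/(f x) -/(l x) maxE.
  have -> : (1 - phi x) * a x + al m * phi x + ((1 - phi x) * dotm (b x) (G x) +
      phi x * dotm (B m) (G x)) - (f x + \1_E x * (l x - f x)) =
    (1 - phi x) * (S x - f x) + (phi x - \1_E x) * (l x - f x).
    rewrite /S /l; ring.
  apply: le_trans (ler_normD _ _) _; rewrite !normrM lerD2r ler_piMl//.
  by have := p01 x; move=> /andP[h1 h2]; rewrite ger0_norm; lra.
rewrite (ge0_integralD mu mO _ m1 _ m2); last 2 first.
- by move=> x _; rewrite lee_fin.
- by move=> x _; rewrite lee_fin mulr_ge0 // /w normr_ge0.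
by rewrite [in ltRHS](splitr e) EFinD; exact: lteD abe pe.
Qed.

(** The energy at the limit is the supremum of the integrals of admissible minorants,
    and these pass to the limit under L^1 convergence of the functions alone. *)
Lemma convex_lsc u u_ H_ :
  is_weak_gradient Omega u G -> (forall k, is_weak_gradient Omega (u_ k) (H_ k)) ->
  (fun k => Lpnorm Omega 1 (u_ k \- u)) @ \oo --> 0%E ->
  (\int[mu]_(x in Omega) (F (G x))%:E <=
   limn_einf (fun k => \int[mu]_(x in Omega) (F (H_ k x))%:E))%E.
Proof.
move=> uG uH cu.
have cv : (fun m => \int[mu]_(x in Omega) (max_affine m (G x))%:E)%E @ \oo -->
    (\int[mu]_(x in Omega) (F (G x))%:E)%E.
  have -> : (\int[mu]_(x in Omega) (F (G x))%:E)%E =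
     (\int[mu]_(x in Omega) (limn (fun m => (max_affine m (G x))%:E)))%E.
    apply: eq_integral => x _; apply/esym/cvg_lim => //.
    apply: cvg_EFin; first exact: nearW.
    exact: max_affine_cvg.
  apply: cvg_monotone_convergence => //.
  - by move=> m; case/integrableP : (max_affine_integrable m).
  - by move=> m x _; rewrite lee_fin max_affine_ge0.
  - by move=> x _ m k mk; rewrite lee_fin; exact: max_affine_nd.
rewrite -(cvg_lim _ cv)//; apply: lime_le; first by apply/cvg_ex; eexists; exact: cv.
apply: nearW => m; apply/lee_addgt0Pr => e e0.
have [a [b [ab abe]]] := max_affine_approx m e0.
have [iS _] := admissible_integral ab uG.
have iM := max_affine_integrable m.
apply: le_trans (leeD (admissible_lsc ab cF uG uH cu) (ltW abe)).
rewrite (EFin_Rintegral mO iS).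
have iD := integrable_norm (integrableB mO iS iM).
rewrite -(integralD mO iS iD).
apply: (le_integral mO iM (integrableD mO iS iD)) => x _.
rewrite /= -EFinD lee_fin.
by have := ler_norm (max_affine m (G x) - (a x + dotm (b x) (G x))); rewrite distrC; lra.
Qed.

End lower_semicontinuity.

(** * Diagonal subsequences and binary trees of sets *)

Section extraction.
Context {R : realType}.

(** A free ultrafilter U on the natural numbers assigns to all bounded sequences a limit
    at once. For each m, the indices k at which the first m + 1 sequences are within
    1/(m+1) of their limits form a member of U, which is infinite; h m is taken
    from it. *)
Lemma diagonal_extraction (a : nat -> nat -> R) :
  (forall i, exists C, forall k, `|a i k| <= C) ->
  exists (h : nat -> nat) (L : nat -> R), (forall m, (m <= h m)%N) /\
    forall i, a i \o h @ \oo --> L i.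
Proof.
move=> ab.
have [U [UU ooU]] := @ultraFilterLemma _ (\oo : set_system nat) _.
have PU : ProperFilter U by exact: ultra_proper.
have Lex i : exists l : R, a i @ U --> l.
  have [C aC] := ab i.
  have cC : compact `[-C, C]%classic by exact: segment_compact.
  have aU : (a i @ U) `[-C, C]%classic.
    apply: (@filterS _ U _ setT); last exact: filterT.
    by move=> k _ /=; rewrite in_itv/= -ler_norml.
  have [l [_ cl]] := cC (a i @ U) _ aU.
  exists l; apply/cvgrPdist_lt => e e0.
  have [//|nU] := in_ultra_setVsetC [set k | `|l - a i k| < e] UU.
  have [||x [/= h1 h2]] := cl [set x | ~ `|l - x| < e] (ball l e).
  - exact: nU.
  - exact: nbhsx_ballx.
  - by case: h1.
have [L LP] := choice Lex.
pose S m : set nat := [set k | forall i, (i <= m)%N -> `|L i - a i k| < m.+1%:R^-1].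
have US m : U (S m).
  suff : \forall k \near U, forall i : 'I_m.+1, `|L i - a i k| < m.+1%:R^-1.
    by apply: filterS => k h i im; exact: (h (Ordinal (im : (i < m.+1)%N))).
  apply: filter_forall => i.
  have m0 : 0 < m.+1%:R^-1 :> R by rewrite invr_gt0.
  by have /cvgrPdist_lt/(_ _ m0) := LP i.
have nx (p : nat * nat) : exists k, (p.1 < k)%N /\ S p.2 k.
  have UT : U [set k | (p.1 < k)%N] by apply: ooU; exists p.1.+1.
  by have [k [k1 k2]] := @filter_ex _ U _ _ (filterI UT (US p.2)); exists k.
have [f fP] := choice nx.
pose h := fix h m := if m is m'.+1 then f (h m', m) else f (0%N, 0%N).
have hS m : S m (h m) by case: m => [|m]; [exact: (fP (0%N, 0%N)).2|exact: (fP (h m, m.+1)).2].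
have hm m : (m <= h m)%N.
  elim: m => // m IH; have [h1 _] := fP (h m, m.+1).
  exact: (leq_ltn_trans IH h1).
exists h, L; split => // i; apply/cvgrPdist_lt => e e0.
near=> m; have im : (i <= m)%N by near: m; exists i.
apply: lt_trans (hS m i im) _.
by near: m; exact: near_infty_natSinv_lt (PosNum e0).
Unshelve. all: by end_near. Qed.

End extraction.

Section trees.

(** Words encode the nodes of a binary tree, the last letter chosen being the head: the
    children of w are true :: w and false :: w, and the root is the empty word. *)
Fixpoint level (l : nat) : seq (seq bool) :=
  if l is l'.+1 then [seq true :: w | w <- level l'] ++ [seq false :: w | w <- level l']
  else [:: [::]].

Lemma level_size l w : w \in level l -> size w = l.
Proof.
elim: l w => [|l IH] w; first by rewrite inE => /eqP ->.
by rewrite mem_cat => /orP[] /mapP[v vl ->] /=; rewrite (IH v).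
Qed.

Lemma big_level (V : nmodType) l (f : seq bool -> V) :
  \sum_(w <- level l.+1) f w = \sum_(w <- level l) (f (true :: w) + f (false :: w)).
Proof. by rewrite /= big_cat !big_map [RHS]big_split. Qed.

Context d (T : measurableType d) (R : realType) (mu : {measure set T -> \bar R}).
Variable D : seq bool -> set T.
Hypothesis mD : forall w, measurable (D w).
Hypothesis DU : forall w, D w = D (true :: w) `|` D (false :: w).
Hypothesis DI : forall w, D (true :: w) `&` D (false :: w) = set0.

Let dD w : [disjoint D (true :: w) & D (false :: w)].
Proof. by apply/eqP; exact: DI. Qed.

Lemma tree_sub w v : D (v ++ w) `<=` D w.
Proof.
elim: v => [//|c v IH]; apply: subset_trans IH; rewrite cat_cons [X in _ `<=` X]DU.
by case: c; [exact: subsetUl|exact: subsetUr].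
Qed.

Lemma tree_sub_root w : D w `<=` D [::].
Proof. by have := @tree_sub [::] w; rewrite cats0. Qed.

Lemma tree_integral l (f : T -> \bar R) : measurable_fun (D [::]) f ->
  (\int[mu]_(x in D [::]) f x = \sum_(w <- level l) \int[mu]_(x in D w) f x)%E.
Proof.
move=> mf; elim: l => [|l IH]; first by rewrite big_seq1.
rewrite big_level IH; apply: eq_bigr => w _; rewrite [in LHS]DU integral_setU//.
by rewrite -DU; exact: measurable_funS (mD _) (@tree_sub_root w) mf.
Qed.

Lemma tree_measurable d' (T' : measurableType d') l (f : T -> T') :
  (forall w, w \in level l -> measurable_fun (D w) f) -> measurable_fun (D [::]) f.
Proof.
elim: l => [|l IH] h; first by apply: h; rewrite inE.
apply: IH => w wl; rewrite DU; apply/measurable_funU => //.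
split; apply: h; rewrite mem_cat; apply/orP; [left|right]; exact: map_f.
Qed.

End trees.

(** * The Poincare inequality on a box *)

Section bounded_support.
Context d (T : measurableType d) (R : realType) (mu : {measure set T -> \bar R}).
Variables (D : set T) (f : T -> R) (C : R).
Hypotheses (mD : measurable D) (Dfin : (mu D < +oo)%E) (mf : measurable_fun setT f)
  (fC : forall x, `|f x| <= C) (f0 : forall x, ~ D x -> f x = 0).

Lemma restrict_support : f \_ D = f.
Proof.
apply/funext => x; rewrite /patch; case: ifPn => // /negP xD.
by rewrite f0// => h; apply: xD; rewrite inE.
Qed.

Lemma bounded_support_integrable : mu.-integrable setT (EFin \o f).
Proof.
have : mu.-integrable D (EFin \o f).
  apply: measurable_bounded_integrable => //; first exact: measurable_funTS.
  exists C; split; first exact: num_real.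
  by move=> r Cr x _; exact: le_trans (fC x) (ltW Cr).
by move/(integrable_mkcond _ mD).1; rewrite restrict_EFin restrict_support.
Qed.

Lemma integral_support : (\int[mu]_x `|f x|%:E = \int[mu]_(x in D) `|f x|%:E)%E.
Proof.
rewrite [RHS]integral_mkcond; apply: eq_integral => x _; rewrite /patch.
case: ifPn => // /negP xD; rewrite f0 ?normr0// => h; apply: xD; by rewrite inE.
Qed.

Lemma bounded_support_le : (`|\int[mu]_x f x|%:E <= C%:E * mu D)%E.
Proof.
have fi := bounded_support_integrable.
rewrite EFin_normr_Rintegral//.
apply: le_trans (le_abse_integral mu measurableT _) _; first exact/measurable_EFinP.
rewrite integral_support -integral_cst//; apply: ge0_le_integral => //.
- by apply/measurable_EFinP; apply: measurableT_comp => //; exact: measurable_funTS.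
- by move=> x _; rewrite lee_fin.
Qed.

End bounded_support.

Section mean_oscillation.
Context d (T : measurableType d) (R : realType) (mu : {measure set T -> \bar R}).
Variables (I : set T) (c : R).
Hypotheses (mI : measurable I) (c0 : 0 < c) (muI : mu I = c%:E).

(** For s in I, averaging f s - f s' over s' in I shows that c |f s| differs from
    the absolute value of the integral by at most c t. *)
Lemma mean_oscillation (f : T -> R) (t : \bar R) (C : R) :
  measurable_fun setT f -> (forall s, `|f s| <= C) ->
  (forall s, ~ I s -> f s = 0) -> (0 <= t)%E ->
  (forall s s', I s -> I s' -> (`|f s - f s'|%:E <= t)%E) ->
  (\int[mu]_s `|f s|%:E <= `|\int[mu]_s f s|%:E + c%:E * t)%E.
Proof.
move=> mf fC f0 t0 ft.
have muIoo : (mu I < +oo)%E by rewrite muI ltry.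
case: t t0 ft => [t t0 ft|_ _|//]; last first.
  by rewrite gt0_muley ?lte_fin// addey ?leey.
have fi : mu.-integrable I (EFin \o f).
  apply: measurable_bounded_integrable => //.
    exact: measurable_funTS.
  exists C; split; first exact: num_real.
  by move=> r Cr x _; exact: le_trans (fC x) (ltW Cr).
have fIE : \int[mu]_s f s = \int[mu]_(s in I) f s.
  rewrite [RHS]Rintegral_mkcond; congr Rintegral; apply/funext => s.
  by rewrite /patch; case: ifPn => // /negP sI; apply: f0 => h; apply: sI; rewrite inE.
set A := \int[mu]_s f s in fIE *.
have pt s : I s -> `|f s| <= `|A| / c + t.
  move=> sI.
  have ic : mu.-integrable I (EFin \o (cst (f s) : T -> R)).
    apply: measurable_bounded_integrable => //.
    exists `|f s|; split; first exact: num_real.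
    by move=> r cr x _; exact: ltW.
  have E : c * f s - A = \int[mu]_(s' in I) (f s - f s').
    by rewrite (RintegralB mI ic fi) Rintegral_cst//= muI/= mulrC fIE.
  have iB := integrableB mI ic fi.
  have le1 : `|c * f s - A| <= c * t.
    rewrite E -lee_fin EFin_normr_Rintegral; [|exact: mI|exact: iB].
    have mB : measurable_fun I (fun s' => (f s - f s')%:E) by case/integrableP: iB.
    apply: le_trans (le_abse_integral _ mI mB) _.
    apply: (@le_trans _ _ (\int[mu]_(s' in I) (cst t%:E s'))%E).
      apply: ge0_le_integral => //; first exact: measurableT_comp mB.
      by move=> s' /= s'I; apply: ft.
    by rewrite integral_cst//= muI -EFinM mulrC.
  rewrite -(ler_pM2l c0) mulrDr mulrCA divff ?gt_eqF// mulr1.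
  have : `|c * f s| <= `|A| + `|c * f s - A|.
    by rewrite -[X in `|X| <= _](subrKC A) ler_normD.
  rewrite normrM (gtr0_norm c0); lra.
have -> : (\int[mu]_s `|f s|%:E = \int[mu]_(s in I) `|f s|%:E)%E.
  rewrite [RHS]integral_mkcond; apply: eq_integral => s _.
  rewrite /patch; case: ifPn => // /negP sI; rewrite f0 ?normr0// => h.
  by apply: sI; rewrite inE.
apply: (@le_trans _ _ (\int[mu]_(s in I) (cst (`|A| / c + t)%:E s))%E).
  apply: ge0_le_integral.
  - exact: mI.
  - by move=> s _; rewrite lee_fin.
  - by apply/measurable_EFinP; apply: measurableT_comp => //; exact: measurable_funTS.
  - exact: measurable_cst.
  by move=> s /= sI; rewrite lee_fin; exact: pt.
rewrite integral_cst//= muI -!EFinM -EFinD lee_fin mulrDl divfK ?gt_eqF//.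
by rewrite [t * _]mulrC.
Qed.

End mean_oscillation.

Section box_poincare.
Context {R : realType}.
Local Notation mu n := (@lebesgue_rV R n).
Local Notation leb := (@lebesgue_measure R).

Definition half_open_box n (a b : 'rV[R]_n) : set 'rV[R]_n :=
  [set x | forall i, a 0 i <= x 0 i < b 0 i].

Definition set_coord n (x : 'rV[R]_n) (j : 'I_n) (t : R) : 'rV[R]_n :=
  \row_i (if i == j then t else x 0 i).

Lemma set_coord0_consrV n s t (y : 'rV[R]_n) : set_coord (consrV (s, y)) (lshift n 0) t = consrV (t, y).
Proof.
apply/rowP => i; rewrite mxE /consrV /=; case: (split_ordP i) => j ->.
  by rewrite ord1 eqxx row_mxEl mxE.
by rewrite eq_rlshift !row_mxEr.
Qed.

Lemma set_coord1_consrV n s t (y : 'rV[R]_n) j :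
  set_coord (consrV (s, y)) (rshift 1 j) t = consrV (s, set_coord y j t).
Proof.
apply/rowP => i; rewrite mxE /consrV /=; case: (split_ordP i) => k ->.
  by rewrite eq_lrshift !row_mxEl.
by rewrite eq_rshift !row_mxEr mxE.
Qed.

Lemma half_open_box_consrV n (a b : 'rV[R]_(1 + n)) s (y : 'rV[R]_n) :
  half_open_box a b (consrV (s, y)) <->
  (a 0 (lshift n 0) <= s < b 0 (lshift n 0)) /\ half_open_box (rsubmx a) (rsubmx b) y.
Proof.
rewrite /consrV; split=> [h|[h1 h2] i].
  split; first by have := h (lshift n 0); rewrite row_mxEl mxE.
  by move=> i; have := h (rshift 1 i); rewrite row_mxEr !mxE.
case: (split_ordP i) => k ->; first by rewrite row_mxEl ord1 mxE.
by rewrite row_mxEr; have := h2 k; rewrite !mxE.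
Qed.

Lemma half_open_box_cube n (a b : 'rV[R]_n) : exists M, half_open_box a b `<=` cube M.
Proof.
exists (`|a| + `|b| + 1) => x h i.
have /andP[h1 h2] := h i.
have ha := mx_coord_le_norm a 0 i; have hb := mx_coord_le_norm b 0 i.
by move: ha hb; rewrite !ler_norml ltr_norml; have := normr_ge0 a; have := normr_ge0 b; lra.
Qed.

Lemma measurable_half_open_box n (a b : 'rV[R]_n) : measurable (half_open_box a b).
Proof.
rewrite (_ : half_open_box a b = \bigcap_(i in [set: 'I_n])
    (fun x : 'rV[R]_n => x 0 i) @^-1` `[a 0 i, b 0 i[%classic).
  apply: fin_bigcap_measurable; first exact: finite_finset.
  by move=> i _; rewrite -[X in measurable X]setTI; exact: measurable_entry.
apply/seteqP; split => [x h i _|x h i]; first by rewrite /= in_itv/=; exact: h.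
by have := h i I; rewrite /= in_itv.
Qed.

Lemma half_open_box_lty n (a b : 'rV[R]_n) : (mu n (half_open_box a b) < +oo)%E.
Proof.
have [M hM] := half_open_box_cube a b; apply: le_lt_trans (lebesgue_cube_lty n M).
by apply: le_measure => //; rewrite inE; [exact: measurable_half_open_box|exact: measurable_cube].
Qed.

(** The function g' j plays the part of the absolute value of the j-th derivative, but
    all that is asked of it is to control the increments of g along the lines in
    direction j. This formulation is inherited by the partial integral of g over the
    first coordinate, which makes an induction on the dimension possible; on each
    line, [mean_oscillation] is applied. *)
Lemma box_poincare n (a b : 'rV[R]_n) (g : 'rV[R]_n -> R)
    (g' : 'I_n -> 'rV[R]_n -> \bar R) (C : R) :
  (forall i, a 0 i < b 0 i) -> measurable_fun setT g -> (forall x, `|g x| <= C) ->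
  (forall x, ~ half_open_box a b x -> g x = 0) ->
  (forall j, measurable_fun setT (g' j)) -> (forall j x, 0 <= g' j x)%E ->
  (forall x j t, half_open_box a b x -> half_open_box a b (set_coord x j t) ->
     (`|g x - g (set_coord x j t)|%:E <= \int[leb]_s g' j (set_coord x j s))%E) ->
  (\int[mu n]_x `|g x|%:E <= `|\int[mu n]_x g x|%:E +
     \sum_j (b 0 j - a 0 j)%:E * \int[mu n]_x g' j x)%E.
Proof.
elim: n a b g g' C => [|n IH] a b g g' C ab mg gC g0 mg' g'0 gg'.
  have gE : g = cst (g 0).
    by apply/funext => x; congr g; apply/rowP => -[].
  rewrite big_ord0 adde0 gE /cst.
  have int0 (r : R) : (\int[mu 0]_x r%:E = r%:E)%E.
    by have := integral_cst (mu 0) measurableT r%:E; rewrite /= diracT mule1.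
  by rewrite int0 lee_fin /Rintegral int0.
pose a' : 'rV[R]_n := @rsubmx _ 1 1 n a; pose b' : 'rV[R]_n := @rsubmx _ 1 1 n b.
pose i0 : 'I_(1 + n) := lshift n 0.
pose I : set (measurableTypeR R) := [set s | a 0 i0 <= s < b 0 i0].
pose c := b 0 i0 - a 0 i0.
have c0 : 0 < c by rewrite subr_gt0.
have IE : I = `[a 0 i0, b 0 i0[%classic.
  by apply/seteqP; split => s; rewrite /I /= in_itv.
have mI : measurable I by rewrite IE; exact: measurable_itv.
have muI : leb I = c%:E by rewrite IE lebesgue_measure_itv/= lte_fin ab.
have Ioo : (leb I < +oo)%E by rewrite muI ltry.
pose F s (y : 'rV[R]_n) := g (consrV (s, y)).
have Fy y : measurable_fun [set: measurableTypeR R] (F ^~ y).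
  apply: (measurableT_comp mg).
  exact: (measurable_fun_pair1 y (@measurable_consrV R n)).
have F_out s y : ~ half_open_box a' b' y -> F s y = 0.
  by move=> ny; apply: g0 => /(@half_open_box_consrV n a b)[].
have F_outI s y : ~ I s -> F s y = 0.
  by move=> ns; apply: g0 => /(@half_open_box_consrV n a b)[].
have gi : (mu n.+1).-integrable setT (EFin \o g).
  exact: (bounded_support_integrable (measurable_half_open_box a b) (half_open_box_lty a b) mg gC g0).
have Fi y : leb.-integrable setT (EFin \o (F ^~ y)).
  by apply: (bounded_support_integrable mI Ioo (Fy y) (fun s => gC _)) => s; exact: F_outI.
pose G y := \int[leb]_s F s y.
have GE y : ((G y)%:E = \int[leb]_s (F s y)%:E)%E by rewrite EFin_Rintegral.
have mG : measurable_fun setT G.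
  apply: (measurableT_comp (fine_measurable _)) => //.
  exact: (measurable_fubini_G (m1 := leb) (m2 := mu n) (integrable_consrV gi)).
have GC y : `|G y| <= C * c.
  have := bounded_support_le mI Ioo (Fy y) (fun s => gC _) (fun s => F_outI s y).
  by rewrite -lee_fin EFinM -muI.
have G0 y : ~ half_open_box a' b' y -> G y = 0.
  move=> ny; rewrite /G /Rintegral integral0_eq// => s _.
  by rewrite F_out.
pose G' j y := (\int[leb]_s g' (rshift 1 j) (consrV (s, y)))%E.
have mgc j : measurable_fun setT (g' j \o @consrV R n).
  by apply: measurableT_comp => //; exact: measurable_consrV.
have mG' j : measurable_fun setT (G' j).
  apply: (measurable_fun_fubini_tonelli_G (m1 := leb)
    (g' (rshift 1 j) \o @consrV R n)) => //.
  by move=> x; exact: g'0.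
have G'0 j y : (0 <= G' j y)%E by apply: integral_ge0 => s _; exact: g'0.
have GG' y j t : half_open_box a' b' y -> half_open_box a' b' (set_coord y j t) ->
    (`|G y - G (set_coord y j t)|%:E <= \int[leb]_r G' j (set_coord y j r))%E.
  move=> yQ y'Q; set y' := set_coord y j t in y'Q *.
  have iB := integrableB measurableT (Fi y) (Fi y').
  rewrite /G -(RintegralB measurableT (Fi y) (Fi y')) (EFin_normr_Rintegral _ iB)//.
  have mB : measurable_fun setT (fun s => (F s y - F s y')%:E) by case/integrableP: iB.
  apply: le_trans (le_abse_integral leb measurableT mB) _.
  pose k (p : measurableTypeR R * measurableTypeR R) : \bar R :=
    g' (rshift 1 j) (consrV (p.1, set_coord y j p.2)).
  have mk : measurable_fun setT k.
    apply: (measurableT_comp (mg' (rshift 1 j))).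
    apply: measurable_fun_mx => z i; rewrite ord1 /consrV /=.
    case: (@split_ordP 1 n i) => l ->.
      under eq_fun do rewrite (@row_mxEl _ 1 1 n) mxE.
      exact: measurable_fst.
    under eq_fun do rewrite (@row_mxEr _ 1 1 n) mxE.
    case: (l == j); [exact: measurable_snd|exact: measurable_cst].
  have k0 p : (0 <= k p)%E by exact: g'0.
  rewrite /G' -(fubini_tonelli (m1 := leb) (m2 := leb) k mk k0).
  apply: ge0_le_integral => //.
  - exact: measurableT_comp mB.
  - exact: (measurable_fun_fubini_tonelli_F (m2 := leb) k mk k0).
  move=> s _; rewrite abse_EFin.
  have [sI|nsI] := pselect (I s); last first.
    by rewrite !F_outI// subrr normr0; apply: integral_ge0 => r _; exact: k0.
  have := @gg' (consrV (s, y)) (rshift 1 j) t.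
  rewrite set_coord1_consrV; under eq_integral do rewrite set_coord1_consrV.
  by apply; apply/(@half_open_box_consrV n a b).
have {}IH := IH a' b' G G' (C * c) _ mG GC G0 mG' G'0 GG'.
have int21 (h : 'rV[R]_(1 + n) -> \bar R) : measurable_fun [set: 'rV[R]_(1 + n)] h ->
    (forall x, 0 <= h x)%E ->
    (\int[mu n.+1]_x h x = \int[mu n]_y \int[leb]_s h (consrV (s, y)))%E.
  move=> mh h0; rewrite ge0_integral_consrV//.
  apply: (fubini_tonelli (m1 := leb) (m2 := mu n) (h \o @consrV R n)).
    by apply: measurableT_comp mh _; exact: measurable_consrV.
  by move=> x; exact: h0.

have IG0 j : (\int[mu n]_y G' j y = \int[mu n.+1]_x g' (rshift 1 j) x)%E.
  by rewrite int21.
pose T0 y := (\int[leb]_s g' i0 (consrV (s, y)))%E.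
have mT0 : measurable_fun setT T0.
  apply: (measurable_fun_fubini_tonelli_G (m1 := leb) (g' i0 \o @consrV R n)) => //.
  by move=> x; exact: g'0.
have T00 y : (0 <= T0 y)%E by apply: integral_ge0 => s _; exact: g'0.
have step y : (\int[leb]_s `|F s y|%:E <= `|G y|%:E + c%:E * T0 y)%E.
  have [yQ|nyQ] := pselect (half_open_box a' b' y); last first.
    rewrite integral0_eq ?adde_ge0 ?lee_fin ?mule_ge0 ?lee_fin ?(ltW c0)//.
    by move=> s _; rewrite F_out// normr0.
  apply: (mean_oscillation mI c0 muI (Fy y) (fun s => gC _)).
  - by move=> s; exact: F_outI.
  - exact: T00.
  move=> s s' sI s'I; have := @gg' (consrV (s, y)) i0 s'.
  rewrite set_coord0_consrV; under eq_integral do rewrite set_coord0_consrV.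
  by apply; apply/(@half_open_box_consrV n a b).
have mgn : measurable_fun [set: 'rV[R]_(1 + n)] (fun x => `|g x|%:E).
  by apply/measurable_EFinP; exact: measurableT_comp.
have mGn : measurable_fun setT (fun y => `|G y|%:E).
  by apply/measurable_EFinP; exact: measurableT_comp.
rewrite int21//.
apply: (@le_trans _ _ (\int[mu n]_y (`|G y|%:E + c%:E * T0 y))%E).
  apply: ge0_le_integral.
  - exact: measurableT.
  - by move=> y _; exact: integral_ge0.
  - have mgnc : measurable_fun setT (fun p => `|g (@consrV R n p)|%:E).
      by apply: measurableT_comp mgn _; exact: measurable_consrV.
    exact: (measurable_fun_fubini_tonelli_G (m1 := leb) _ mgnc (fun p => normr_ge0 _)).
  - exact: (emeasurable_funD mGn (measurable_funeM c%:E mT0)).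
  by move=> y _; exact: step.
rewrite ge0_integralD//; last 2 first.
- by move=> y _; rewrite mule_ge0// lee_fin ltW.
- exact: measurable_funeM.
rewrite ge0_integralZl_EFin//; last exact: ltW.
have -> : (\int[mu n]_y T0 y = \int[mu n.+1]_x g' i0 x)%E by rewrite int21.
have GgE : \int[mu n]_y G y = \int[mu n.+1]_x g x.
  rewrite /Rintegral (integral_consrV21 gi); congr fine.
  by apply: eq_integral => y _; rewrite GE.
have bsum : (\sum_j (b 0 j - a 0 j)%:E * \int[mu n.+1]_x g' j x =
    c%:E * \int[mu n.+1]_x g' i0 x +
    \sum_j (b' 0 j - a' 0 j)%:E * \int[mu n]_y G' j y)%E.
  rewrite (@big_split_ord _ _ _ 1 n) /= big_ord1; congr (_ + _)%E.
  by apply: eq_bigr => j _; rewrite IG0 !mxE.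
rewrite bsum addeCA addeC; apply: leeD => //.
by rewrite -GgE; apply: IH => i; rewrite !mxE.
Qed.

End box_poincare.

(** * A measure from the masses of nested cells *)

Section quantile.
Context {R : realType}.
Local Notation leb := (@lebesgue_measure R).
Variable L : seq bool -> R.
Hypothesis L0 : forall w, 0 <= L w.
Hypothesis LD : forall w, L w = L (true :: w) + L (false :: w).

(** The words of a given length are laid out on the real line as consecutive
    intervals, the interval of w having length L w and being subdivided by those of
    its children, false :: w on the left. Thus a tree of masses L becomes a tree of
    intervals with these lengths. *)
Fixpoint slot_start (w : seq bool) : R :=
  if w is b :: v then (if b then slot_start v + L (false :: v) else slot_start v) else 0.

Definition slot (w : seq bool) : set (measurableTypeR R) :=
  `[slot_start w, slot_start w + L w[%classic.

Lemma slot_split w : slot w = slot (true :: w) `|` slot (false :: w).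
Proof.
have := L0 (true :: w); have := L0 (false :: w) => l0 l1.
have E : slot_start w + L (false :: w) + L (true :: w) = slot_start w + L w.
  by rewrite (LD w) addrAC -!addrA [L (true :: w) + _]addrC.
apply/seteqP; rewrite /slot; split => [t|t [|]] /=; rewrite !in_itv/= ?E.
- move=> /andP[h1 h2]; have [h|h] := ltP t (slot_start w + L (false :: w)).
    by right; rewrite h1.
  by left.
- by move=> /andP[h1 ->]; rewrite andbT; lra.
- by move=> /andP[-> h]; rewrite /=; rewrite (LD w); lra.
Qed.

Lemma slot_disj w : slot (true :: w) `&` slot (false :: w) = set0.
Proof.
apply/seteqP; split => // t []; rewrite /slot /= !in_itv/= => /andP[h1 _] /andP[_ h2].
by move: h1; rewrite leNgt h2.
Qed.

Lemma measurable_slot w : measurable (slot w).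
Proof. exact: measurable_itv. Qed.

Lemma leb_slot w : leb (slot w) = (L w)%:E.
Proof.
rewrite /slot lebesgue_measure_itv/= lte_fin ltrDl; case: ifPn => [_|].
  by rewrite -EFinB addrAC subrr add0r.
by rewrite -leNgt => h; congr EFin; apply/eqP; rewrite eq_le L0 h.
Qed.

(** The word of length l whose interval contains t. *)
Fixpoint word_at (l : nat) (t : R) : seq bool :=
  if l is l'.+1 then
    let w := word_at l' t in (slot_start w + L (false :: w) <= t) :: w
  else [::].

Lemma slot_word_at l w t : size w = l -> slot w t -> word_at l t = w.
Proof.
elim: l w => [|l IH] [|b w] //= [sw] h.
have wt : slot w t by rewrite slot_split; case: b h; [left|right].
rewrite (IH w sw wt); congr (_ :: _); move: h; rewrite /slot.
by case: b; rewrite /= in_itv/= => /andP[h1 h2] //; rewrite leNgt h2.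
Qed.

Lemma word_at_level l t : word_at l t \in level l.
Proof.
elim: l => //= l IH; rewrite mem_cat; case: (_ <= _); apply/orP; [left|right];
  exact: map_f.
Qed.

Lemma measurable_word_at d' (T' : measurableType d') l (f : seq bool -> T') :
  measurable_fun (slot [::]) (fun t => f (word_at l t)).
Proof.
apply: (tree_measurable measurable_slot slot_split (l := l)) => w wl.
have sw := level_size wl.
apply: (eq_measurable_fun (cst (f w))); last exact: measurable_cst.
by move=> t; rewrite inE => tw; rewrite (slot_word_at sw tw).
Qed.

Context {n : nat}.
Variables (p : seq bool -> 'rV[R]_n) (delta : nat -> R).
Hypothesis p_close : forall v w i, `|p (v ++ w) 0 i - p w 0 i| <= delta (size w).
Hypothesis delta0 : delta @ \oo --> 0.

Lemma word_at_suffix l m t : (l <= m)%N -> exists v, word_at m t = v ++ word_at l t.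
Proof.
move=> /subnKC <-; elim: (m - l)%N => [|k [v IH]]; first by exists [::]; rewrite addn0.
by rewrite addnS /= IH; exists ((slot_start (v ++ word_at l t) + L (false :: v ++ word_at l t) <= t) :: v).
Qed.

Lemma size_word_at l t : size (word_at l t) = l.
Proof. exact: level_size (word_at_level l t). Qed.

(** The intervals around t shrink along a sequence of words, and the points p of
    these words converge. In dimension one and for dyadic intervals, this is the
    quantile function of the measure with masses L. The image of Lebesgue measure
    under this map will be the limit measure: finite additivity of the masses along
    the tree becomes countable additivity because Lebesgue measure has it. *)
Definition quantile (t : R) : 'rV[R]_n := \row_i limn (fun l => p (word_at l t) 0 i).

(** The points p of the words around t form a Cauchy sequence since each of these words
    extends the previous ones. *)
Lemma quantile_cvg t i : (fun l => p (word_at l t) 0 i) @ \oo --> quantile t 0 i.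
Proof.
rewrite mxE; apply/cauchy_cvgP/cauchy_exP => e e0 /=.
have /cvgrPdist_lt/(_ _ e0)[l _ lP] := delta0.
exists (p (word_at l t) 0 i); exists l => // m /= lm.
have [v ->] := word_at_suffix t lm.
rewrite /ball/= distrC; apply: le_lt_trans (p_close _ _ _) _.
rewrite size_word_at; have := lP l (leqnn l).
by rewrite sub0r normrN => /ltr_normlW.
Qed.

Lemma quantile_close l t i : `|quantile t 0 i - p (word_at l t) 0 i| <= delta l.
Proof.
have cv : (fun m => `|p (word_at m t) 0 i - p (word_at l t) 0 i|) @ \oo -->
    `|quantile t 0 i - p (word_at l t) 0 i|.
  by apply: cvg_norm; apply: cvgB; [exact: quantile_cvg|exact: cvg_cst].
rewrite -(cvg_lim _ cv)//; apply: limr_le; first by apply/cvg_ex; eexists; exact: cv.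
exists l => // m /= lm; have [v ->] := word_at_suffix t lm.
by have := p_close v (word_at l t) i; rewrite size_word_at.
Qed.

Lemma measurable_quantile : measurable_fun (slot [::]) quantile.
Proof.
apply: measurable_fun_mx => z i; rewrite ord1.
apply: (measurable_fun_cvg (h := fun l t => p (word_at l t) 0 i)).
- by move=> l; exact: (measurable_word_at l (fun w => p w 0 i)).
- by move=> t _; exact: quantile_cvg.
Qed.

End quantile.

(** * Vague limits of nonnegative densities *)

Section restricted_measure.
Context d (T : measurableType d) (R : realType) (mu : {measure set T -> \bar R}).
Variables (D : set T) (mD : measurable D) (Dfin : (mu D < +oo)%E).

Lemma integral_mfrestr (f : T -> \bar R) : measurable_fun setT f ->
  (\int[mfrestr mD Dfin]_x f x = \int[mu]_(x in D) f x)%E.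
Proof.
move=> mf; have mDc : measurable (~` D) by exact: measurableC.
have null : mfrestr mD Dfin (~` D) = 0%E.
  by rewrite /mfrestr /mrestr setICl measure0.
have mfU : measurable_fun (D `|` ~` D) f by exact: measurable_funTS.
have dD : [disjoint D & ~` D] by apply/eqP; exact: setICr.
have -> : (\int[mfrestr mD Dfin]_x f x = \int[mfrestr mD Dfin]_(x in D `|` ~` D) f x)%E.
  by rewrite setUv.
rewrite (integral_setU _ mD mDc mfU dD).
rewrite [X in (_ + X)%E](null_set_integral mDc _ null) ?adde0; last exact: measurable_funTS.
by apply: eq_measure_integral => A mA AD; rewrite /= /mfrestr /mrestr setIidl.
Qed.

End restricted_measure.

Section tree_approximation.
Context d (T : measurableType d) (R : realType) (mu : {measure set T -> \bar R}).
Variable D : seq bool -> set T.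
Hypothesis mD : forall w, measurable (D w).
Hypothesis DU : forall w, D w = D (true :: w) `|` D (false :: w).
Hypothesis DI : forall w, D (true :: w) `&` D (false :: w) = set0.

Lemma tree_Rintegral l (f : T -> R) : mu.-integrable (D [::]) (EFin \o f) ->
  \int[mu]_(x in D [::]) f x = \sum_(w <- level l) \int[mu]_(x in D w) f x.
Proof.
move=> fi; elim: l => [|l IH]; first by rewrite big_seq1.
rewrite big_level IH; apply: eq_bigr => w _; rewrite [in LHS]DU Rintegral_setU//.
  rewrite -DU; apply: integrableS fi => //; exact: tree_sub_root.
by apply/eqP; exact: DI.
Qed.

(** A Riemann sum over the nodes at depth l. It is used twice, for the densities g k on
    cells and for the constant density on the intervals of the quantile map. *)
Lemma tree_sum_close (f g : T -> R) (c : seq bool -> R) (C eta : R) l :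
  mu.-integrable (D [::]) (EFin \o g) -> (forall x, D [::] x -> 0 <= g x) ->
  measurable_fun (D [::]) f -> (forall x, D [::] x -> `|f x| <= C) ->
  (forall w x, w \in level l -> D w x -> `|f x - c w| <= eta) ->
  `|\int[mu]_(x in D [::]) (f x * g x) -
    \sum_(w <- level l) c w * \int[mu]_(x in D w) g x| <=
  eta * \int[mu]_(x in D [::]) g x.
Proof.
move=> gi g0 mf fC fc.
have bf : [bounded f x | x in D [::]].
  exists C; split; first exact: num_real.
  by move=> r Cr x Dx; exact: le_trans (fC x Dx) (ltW Cr).
have fgi : mu.-integrable (D [::]) (EFin \o (fun x => f x * g x)).
  exact: (integrableMr (mD [::]) mf bf gi).
rewrite (tree_Rintegral l fgi) -sumrB (tree_Rintegral l gi) mulr_sumr.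
apply: le_trans (ler_norm_sum _ _ _) _.
rewrite big_seq [leRHS]big_seq; apply: ler_sum => w wl.
have DS : D w `<=` D [::]  by exact: tree_sub_root.
have giw : mu.-integrable (D w) (EFin \o g) := integrableS (mD _) (mD _) DS gi.
have fgiw : mu.-integrable (D w) (EFin \o (fun x => f x * g x)) :=
  integrableS (mD _) (mD _) DS fgi.
have cgiw := integrableZl (mD w) (c w) giw.
have egiw := integrableZl (mD w) eta giw.
have iB := integrableB (mD w) fgiw cgiw.
rewrite -(RintegralZl (c w) (mD w) giw) -(RintegralB (mD w) fgiw cgiw).
rewrite -(RintegralZl eta (mD w) giw).
apply: le_trans (le_normr_Rintegral (mD w) iB) _.
apply: (le_Rintegral (mD w) (integrable_norm iB) egiw) => x Dwx.
rewrite /= -mulrBl normrM (ger0_norm (g0 _ (DS _ Dwx))) ler_wpM2r//; last exact: fc.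
exact: g0 (DS _ Dwx).
Qed.

End tree_approximation.

Lemma combine_errors (R : realFieldType) (x s t y M M' eta e : R) : 0 < e -> 0 <= M ->
  eta = e / (4 * (M + 1)) -> `|x - s| <= eta * M -> `|s - t| <= e / 4 ->
  `|t - y| <= eta * M' -> `|M - M'| <= 1 -> `|x - y| <= e.
Proof.
move=> e0 M0 etaE h1 h2 h3; rewrite ler_distlC => /andP[_ MM].
have M1 : 0 < M + 1 by rewrite ltr_wpDl.
have eta0 : 0 < eta by rewrite etaE divr_gt0// mulr_gt0.
have etaM : eta * (M + 1) = e / 4 by rewrite etaE; field; rewrite gt_eqF.
have b1 : eta * M <= e / 4 by nra.
have b2 : eta * M' <= e / 4 by rewrite -etaM ler_wpM2l// ltW.
have tri := ler_distD s x y; have tri2 := ler_distD t s y.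
lra.
Qed.

Section vague_limit.
Context {R : realType} {n : nat}.
Local Notation mu := (@lebesgue_rV R n).
Local Notation leb := (@lebesgue_measure R).
Variable D : seq bool -> set 'rV[R]_n.
Hypothesis mD : forall w, measurable (D w).
Hypothesis DU : forall w, D w = D (true :: w) `|` D (false :: w).
Hypothesis DI : forall w, D (true :: w) `&` D (false :: w) = set0.
Variables (p : seq bool -> 'rV[R]_n) (delta : nat -> R).
Hypothesis p_close : forall v w i, `|p (v ++ w) 0 i - p w 0 i| <= delta (size w).
Hypothesis D_close : forall w x i, D w x -> `|x 0 i - p w 0 i| <= delta (size w).
Hypothesis delta0 : delta @ \oo --> 0.

Variables (g : nat -> 'rV[R]_n -> R) (L : seq bool -> R).
Hypothesis gi : forall k, mu.-integrable (D [::]) (EFin \o g k).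
Hypothesis g0 : forall k x, D [::] x -> 0 <= g k x.
Hypothesis gL : forall w, (fun k => \int[mu]_(x in D w) g k x) @ \oo --> L w.

Let L0 w : 0 <= L w.
Proof.
rewrite -(cvg_lim _ (@gL w))//; apply: limr_ge; first by apply/cvg_ex; eexists; exact: gL.
apply: nearW => k; apply: Rintegral_ge0 => x Dx; apply: g0; exact: tree_sub_root Dx.
Qed.

Let LD w : L w = L (true :: w) + L (false :: w).
Proof.
rewrite -(cvg_lim _ (@gL w))//; apply: cvg_lim => //.
rewrite [X in X @ _](_ : _ = (fun k => \int[mu]_(x in D (true :: w)) g k x +
    \int[mu]_(x in D (false :: w)) g k x)); first by apply: cvgD; exact: gL.
apply/funext => k; rewrite DU Rintegral_setU//.
  rewrite -DU; apply: integrableS (gi k) => //; exact: tree_sub_root.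
by apply/eqP; exact: DI.
Qed.

(** Uniform continuity for the maximum norm, written in coordinates since cells and
    quantile maps are controlled coordinate by coordinate. *)
Definition uniformly_continuous (phi : 'rV[R]_n -> R) : Prop := forall e : R, 0 < e ->
  exists2 r : R, 0 < r & forall x y : 'rV[R]_n,
    (forall i, `|x 0 i - y 0 i| <= r) -> `|phi x - phi y| <= e.

Lemma quantile_measure : exists nu : {finite_measure set 'rV[R]_n -> \bar R},
  forall (phi : 'rV[R]_n -> R) C, measurable_fun setT phi ->
    (forall x, `|phi x| <= C) ->
    \int[nu]_x phi x = \int[leb]_(t in slot L [::]) (phi (quantile L p t)).
Proof.
pose S0 := slot L [::].
have mS0 : measurable S0 := measurable_slot L [::].
have S0E : leb S0 = (L [::])%:E := leb_slot L0 [::].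
have S0fin : (leb S0 < +oo)%E by rewrite S0E ltry.
pose Q := quantile L p.
have mQ : measurable_fun S0 Q := measurable_quantile L0 LD p_close delta0.
pose X : measurableTypeR R -> 'rV[R]_n := Q \_ S0.
have mX : measurable_fun setT X by exact: (measurable_restrictT _ mS0).1 mQ.
pose lam := mfrestr mS0 S0fin.
pose nu1 : {measure set 'rV[R]_n -> \bar R} :=
  measure_function_pushforward__canonical__measure_function_Measure lam mX.
have nufin : fin_num_fun (nu1 : set 'rV[R]_n -> \bar R).
  move=> A mA; apply: fin_num_measure; have := mX measurableT A mA; by rewrite setTI.
pose nuM := isMeasure.Build _ _ _ (nu1 : set 'rV[R]_n -> \bar R) (measure0 nu1)
  (measure_ge0 nu1) (@measure_semi_sigma_additive _ _ _ nu1).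
pose nu2 : {measure set 'rV[R]_n -> \bar R} :=
  HB.pack (nu1 : set 'rV[R]_n -> \bar R) nuM.
pose nuF := Measure_isFinite.Build _ _ _ nu2 nufin.
pose nu : {finite_measure set 'rV[R]_n -> \bar R} :=
  HB.pack (nu1 : set 'rV[R]_n -> \bar R) nuM nuF.
exists nu => phi C mphi phiC.
have mphiE : measurable_fun setT (EFin \o phi) by exact/measurable_EFinP.
have mphiX : measurable_fun setT (phi \o X) by exact: measurableT_comp.
have i1 : lam.-integrable setT (EFin \o (phi \o X)).
    apply: measurable_bounded_integrable => //.
    by rewrite /= /mfrestr /mrestr setTI.
    exists C; split; first exact: num_real.
    by move=> r Cr x _; exact: le_trans (phiC _) (ltW Cr).
rewrite /Rintegral; congr fine.
transitivity (\int[nu1]_x (phi x)%:E)%E; first exact: eq_measure_integral.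
rewrite (integral_pushforward mX mphiE i1)// preimage_setT.
rewrite integral_mfrestr; last exact/measurable_EFinP.
by apply: eq_integral => t tS; rewrite /= /X /patch tS.
Qed.

(** The two integrals are compared with the Riemann sums of phi over the nodes at a
    fixed depth: at that depth the sums converge because the masses do. The total mass
    of g k is bounded, as it converges, so the error is uniform in k. *)
Theorem vague_limit : exists nu : {finite_measure set 'rV[R]_n -> \bar R},
  forall (phi : 'rV[R]_n -> R) C, measurable_fun setT phi ->
    (forall x, `|phi x| <= C) -> uniformly_continuous phi ->
    (fun k => \int[mu]_(x in D [::]) (phi x * g k x)) @ \oo --> \int[nu]_x phi x.
Proof.
have [nu nuE] := quantile_measure.
exists nu => phi C mphi phiC uphi.
pose S0 := slot L [::].
have mS0 : measurable S0 := measurable_slot L [::].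
have S0E : leb S0 = (L [::])%:E := leb_slot L0 [::].
have S0fin : (leb S0 < +oo)%E by rewrite S0E ltry.
pose Q := quantile L p.
have mQ : measurable_fun S0 Q := measurable_quantile L0 LD p_close delta0.
rewrite (nuE phi C mphi phiC); apply/cvgrPdist_le => e e0.
have M0 : 0 <= L [::] by exact: L0.
have M2 : 0 < 4 * (L [::] + 1) by rewrite mulr_gt0// ltr_wpDl.
pose eta := e / (4 * (L [::] + 1)).
have eta0 : 0 < eta by rewrite divr_gt0.
have [r r0 rP] := uphi _ eta0.
have [l lr] : exists l, delta l <= r.
  have /cvgrPdist_le/(_ _ r0)[l _ lP] := delta0; exists l.
  have := lP l (leqnn l); rewrite sub0r normrN; exact: le_trans (ler_norm _).
pose sigma (h : seq bool -> R) := \sum_(w <- level l) phi (p w) * h w.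
have close1 : `|\int[leb]_(t in S0) (phi (Q t)) - sigma L| <= eta * L [::].
  have := @tree_sum_close _ _ R leb (slot L) (measurable_slot L) (slot_split L0 LD)
    (slot_disj L) (phi \o Q) (cst 1) (phi \o p) C eta l.
  have E1 w : \int[leb]_(x in slot L w) (cst 1 x) = L w.
    by rewrite Rintegral_cst ?mul1r//= ?leb_slot//; exact: measurable_slot.
  rewrite E1; under eq_Rintegral do rewrite mulr1.
  under eq_bigr do rewrite E1.
  apply => //.
  - apply: measurable_bounded_integrable => //; exists 1; split; first exact: num_real.
    by move=> y y1 x _; rewrite /= normr1 ltW.
  - exact: measurableT_comp mphi mQ.
  - by move=> t _; exact: phiC.
  - move=> w t wl tw; apply: rP => i; apply: le_trans lr.
    have := @quantile_close _ L _ _ _ p_close delta0 l t i.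
    by rewrite (slot_word_at L0 LD (level_size wl) tw).
have close2 k : `|\int[mu]_(x in D [::]) (phi x * g k x) -
    sigma (fun w => \int[mu]_(x in D w) g k x)| <= eta * \int[mu]_(x in D [::]) g k x.
  apply: (tree_sum_close mD DU DI (C := C) (gi k)) => //.
  - exact: g0.
  - exact: measurable_funTS.
  - move=> w x wl xw; apply: rP => i; apply: le_trans lr.
    by rewrite -(level_size wl); exact: D_close.
have cvs : (fun k => sigma (fun w => \int[mu]_(x in D w) g k x)) @ \oo --> sigma L.
  apply: cvg_sum_seq => w; apply: cvgM; [exact: cvg_cst|exact: gL].
have e4 : 0 < e / 4 by rewrite divr_gt0.
have /cvgrPdist_le/(_ _ e4) := cvs.
have /cvgrPdist_le/(_ _ ltr01) := @gL [::].
apply: filterS2 => k h1 h2.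
have h3 := close2 k; rewrite distrC in h3.
exact: (combine_errors e0 M0 erefl close1 h2 h3 h1).
Qed.

End vague_limit.

(** * Dyadic cells of a cube *)

Section cells.
Context {R : realType} {n : nat}.
Hypothesis n_gt0 : (0 < n)%N.
Variable K : R.
Hypothesis K0 : 0 < K.

(** A word of length l is split by halving the coordinate l modulo n, so that the n
    coordinates are halved in turn. *)
Fixpoint cell_bounds (w : seq bool) : 'rV[R]_n * 'rV[R]_n :=
  if w is b :: v then
    let ac := cell_bounds v in
    let mid i := (ac.1 0 i + ac.2 0 i) / 2 in
    (\row_i (if b && (i == size v %% n :> nat)%N then mid i else ac.1 0 i),
     \row_i (if ~~ b && (i == size v %% n :> nat)%N then mid i else ac.2 0 i))
  else (const_mx (- K), const_mx K).

Definition lo w := (cell_bounds w).1.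
Definition hi w := (cell_bounds w).2.
Definition cell w : set 'rV[R]_n := half_open_box (lo w) (hi w).
Definition side (l : nat) : R := 2 * K / 2 ^+ (l %/ n).

Lemma lo_lt_hi w i : lo w 0 i < hi w 0 i.
Proof.
elim: w i => [|b v IH] i; rewrite /lo /hi /= !mxE; first by rewrite gtrN.
by have := IH i; rewrite /lo /hi; case: b => /=; case: ifP => _; lra.
Qed.

Lemma bounds_cons b v i :
  lo v 0 i <= lo (b :: v) 0 i /\ hi (b :: v) 0 i <= hi v 0 i.
Proof.
have := lo_lt_hi v i; rewrite /lo /hi /= !mxE.
by case: b => /=; case: ifP => _; lra.
Qed.

Lemma bounds_cat v w i : lo w 0 i <= lo (v ++ w) 0 i /\ hi (v ++ w) 0 i <= hi w 0 i.
Proof.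
elim: v => [|b v [h1 h2]]; first by split.
by have [h3 h4] := bounds_cons b (v ++ w) i; rewrite cat_cons; split;
  [exact: le_trans h3|exact: le_trans h2].
Qed.

(** The coordinate i is halved at the step from depth l to depth l + 1 exactly when
    l + n - i is a multiple of n; this turns the number of halvings into a quotient. *)
Lemma dvdn_coord l i : (i < n)%N -> (n %| l + (n - i))%N = (i == l %% n)%N.
Proof.
move=> i_n; rewrite {1}(divn_eq l n) -addnA dvdn_addr ?dvdn_mull//.
have ln : (l %% n < n)%N by rewrite ltn_mod.
apply/idP/eqP => [/dvdnP[k E]|->]; last by rewrite subnKC// ltnW.
by case: k E => [|[|k]] E; nia.
Qed.

Lemma width w i : hi w 0 i - lo w 0 i = 2 * K / 2 ^+ ((size w + (n - i.+1)) %/ n).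
Proof.
elim: w => [|b v IH].
  rewrite /hi /lo /= !mxE add0n divn_small; last by have := ltn_ord i; lia.
  by rewrite expr0; field.
have E : (((size v).+1 + (n - i.+1)) %/ n =
    (i == size v %% n :> nat) + (size v + (n - i.+1)) %/ n)%N.
  rewrite addSn divnS// -dvdn_coord//; congr ((n %| _) + _)%N.
  by have := ltn_ord i; lia.
rewrite /= E; rewrite /hi /lo /= !mxE; rewrite /hi /lo in IH.
have p2 : 2 ^+ ((size v + (n - i.+1)) %/ n) != 0 :> R by rewrite expf_neq0.
have H : (cell_bounds v).2 0 i = (cell_bounds v).1 0 i +
    2 * K / 2 ^+ ((size v + (n - i.+1)) %/ n) by rewrite -IH; ring.
case: (i == _ :> nat); rewrite ?andbT ?andbF ?add0n ?add1n ?exprS.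
  by case: b; rewrite /= H; field.
by rewrite H; ring.
Qed.

Lemma width_le w i : hi w 0 i - lo w 0 i <= side (size w).
Proof.
rewrite width /side; apply: ler_wpM2l; first by rewrite mulr_ge0// ltW.
rewrite lef_pV2 ?posrE ?exprn_gt0//.
by rewrite ler_weXn2l ?ler1n// leq_div2r// leq_addr.
Qed.

Lemma side_ge0 l : 0 <= side l.
Proof. by rewrite divr_ge0 ?exprn_ge0// mulr_ge0// ltW. Qed.

Lemma side_cvg : side @ \oo --> 0.
Proof.
apply/cvgrPdist_lt => e e0.
have K2 : 0 < 2 * K by rewrite mulr_gt0.
have [m _ mP] : \forall m \near \oo, 2^-1 ^+ m < e / (2 * K).
  have h : 0 < e / (2 * K) by rewrite divr_gt0.
  have : (fun m => 2^-1 ^+ m : R) @ \oo --> 0.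
    by apply: cvg_expr; rewrite ger0_norm; lra.
  move/cvgrPdist_lt => /(_ _ h); apply: filterS => m.
  by rewrite sub0r normrN => /ltr_normlW.
exists (m * n)%N => // l /= ml.
rewrite sub0r normrN ger0_norm ?side_ge0// /side -exprVn.
have := mP (l %/ n)%N; rewrite /= leq_divRL// => /(_ ml).
by rewrite ltr_pdivlMr// mulrC.
Qed.

Lemma measurable_cell w : measurable (cell w).
Proof. exact: measurable_half_open_box. Qed.

Lemma split_coord (v : seq bool) : exists i : 'I_n, (i == size v %% n :> nat)%N.
Proof. by exists (Ordinal (ltn_pmod (size v) n_gt0)) => /=. Qed.

Lemma cell_split w : cell w = cell (true :: w) `|` cell (false :: w).
Proof.
apply/seteqP; split => [x xw|x [] xw i]; last 2 first.
- have [h1 h2] := bounds_cons true w i; have /andP[h3 h4] := xw i.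
  by rewrite (le_trans h1 h3) (lt_le_trans h4 h2).
- have [h1 h2] := bounds_cons false w i; have /andP[h3 h4] := xw i.
  by rewrite (le_trans h1 h3) (lt_le_trans h4 h2).
have [i0 i0P] := split_coord w.
have [h|h] := leP ((lo w 0 i0 + hi w 0 i0) / 2) (x 0 i0); [left|right] => i;
  have /andP[h3 h4] := xw i; rewrite /lo /hi /= !mxE /=.
  case: ifPn => [/eqP iw|_]; last by rewrite h3 h4.
  have -> : i = i0 by apply/val_inj; rewrite /= iw (eqP i0P).
  by have := xw i0; rewrite h => /andP[_ ->].
rewrite h3/=; case: ifPn => [/eqP iw|_] //.
by have -> : i = i0 by apply/val_inj; rewrite /= iw (eqP i0P).
Qed.

Lemma cell_disj w : cell (true :: w) `&` cell (false :: w) = set0.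
Proof.
apply/seteqP; split => // x [xt xf]; have [i0 i0P] := split_coord w.
have := xt i0; have := xf i0; rewrite /lo /hi /= !mxE /= i0P => /andP[_ h1] /andP[h2 _].
by move: h1; rewrite ltNge h2.
Qed.

Lemma lo_close v w i : `|lo (v ++ w) 0 i - lo w 0 i| <= side (size w).
Proof.
have [h1 h2] := bounds_cat v w i; have h3 := lo_lt_hi (v ++ w) i.
have := width_le w i; rewrite ger0_norm ?subr_ge0//; lra.
Qed.

Lemma cell_close w x i : cell w x -> `|x 0 i - lo w 0 i| <= side (size w).
Proof.
move=> /(_ i)/andP[h1 h2]; have := width_le w i.
rewrite ger0_norm ?subr_ge0//; lra.
Qed.

Lemma cube_cell : cube K `<=` cell [::].
Proof. by move=> x h i; rewrite /lo /hi /= !mxE; have := h i; rewrite ltr_norml; lra. Qed.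

End cells.

Section line_estimates.
Context {R : realType} {n : nat}.
Local Notation leb := (@lebesgue_measure R).
Local Notation mu := (@lebesgue_rV R n).

Lemma line_ftc (f df : R -> R) (a b s t : R) : continuous df ->
  (forall s : R, is_derive s 1 f (df s)) -> a <= s < b -> a <= t < b ->
  (`|f s - f t|%:E <= \int[leb]_(r in `[a, b[) `|df r|%:E)%E.
Proof.
move=> cdf fD; wlog st : s t / s <= t.
  by move=> h; have [/h|/ltW/h hh] := leP s t; [exact|rewrite distrC => hs ht; exact: hh].
move=> /andP[as_ sb] /andP[at_ tb].
move: st; rewrite le_eqVlt => /predU1P[->|st].
  by rewrite subrr normr0; exact: integral_ge0.
have cf : continuous f.
  move=> r; apply: differentiable_continuous; apply/derivable1_diffP.
  by have [] := fD r.
have : (\int[leb]_(r in `[s, t]) (df r)%:E = (f t)%:E - (f s)%:E)%E.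
  apply: continuous_FTC2 => //.
  - exact: continuous_subspaceT.
  - split.
    + by move=> r _; have [] := fD r.
    + by apply: cvg_at_right_filter; exact: cf.
    + by apply: cvg_at_left_filter; exact: cf.
  - by move=> r _; rewrite derive1E; have [_ ->] := fD r.
move=> E; rewrite distrC -abse_EFin EFinB -E.
have mdf D : measurable_fun D (fun r => (df r)%:E).
  by apply/measurable_EFinP; apply: measurable_funTS; exact: continuous_measurable_fun.
apply: (le_trans (le_abse_integral leb _ (mdf _))) => //.
apply: ge0_subset_integral => //.
  by apply: measurableT_comp => //; exact: mdf.
by move=> r; rewrite /= !in_itv/= => /andP[h1 h2]; apply/andP; split; lra.
Qed.

Lemma set_coord_shift (x : 'rV[R]_n) j (s h : R) :
  h *: delta_mx 0 j + set_coord x j s = set_coord x j (h *: 1 + s).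
Proof.
apply/rowP => i; rewrite !mxE eqxx /=.
by case: eqVneq => _; rewrite ?mulr1 ?mulr0 ?add0r// /GRing.scale /= mulr1.
Qed.

Lemma is_derive_set_coord (f : 'rV[R]_n -> R) (x : 'rV[R]_n) j (s : R) :
  derivable f (set_coord x j s) (delta_mx 0 j) ->
  is_derive s 1 (fun s => f (set_coord x j s)) (pderive j f (set_coord x j s)).
Proof.
rewrite /pderive /derivable /derive /=.
under eq_fun do rewrite set_coord_shift.
by move=> h; apply: DeriveDef.
Qed.

Lemma set_coord_continuous (x : 'rV[R]_n) j : continuous (set_coord x j).
Proof.
apply: continuous_coords => i; under eq_fun do rewrite mxE.
by case: (i == j); [move=> s; exact: cvg_id|exact: cst_continuous].
Qed.

Lemma set_coord_id (x : 'rV[R]_n) j : set_coord x j (x 0 j) = x.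
Proof. by apply/rowP => i; rewrite mxE; case: eqP => [->|]. Qed.

End line_estimates.

(** * The Poincare inequality for test functions *)

Lemma is_derive_mul {R : realType} {V : normedModType R} (f g : V -> R) (x v : V)
    (df dg : R) :
  is_derive x v f df -> is_derive x v g dg ->
  is_derive x v (f \* g) (f x * dg + g x * df).
Proof. by move=> h1 h2; exact: is_deriveM. Qed.

Section rellich.
Context {R : realType} {n : nat}.
Hypothesis n_gt0 : (0 < n)%N.
Local Notation leb := (@lebesgue_measure R).
Local Notation mu := (@lebesgue_rV R n).
Variable Omega : set 'rV[R]_n.
Hypothesis openO : open Omega.
Let mO : measurable Omega := open_measurable_mx openO.
Variable K : R.
Hypothesis K0 : 0 < K.
Hypothesis OK : Omega `<=` cube K.
Local Notation cell := (@cell R n K).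
Local Notation side := (@side R n K).

Let mcell w : measurable (cell w) := measurable_cell K w.
Let csplit := cell_split n_gt0 K0.
Let cdisj := cell_disj n_gt0 K.

Let Ocell : Omega `<=` cell [::] := subset_trans OK (@cube_cell R n K).

(** The l1 version of the total variation of a test function on D. *)
Definition gradient_mass (phi : 'rV[R]_n -> R) (D : set 'rV[R]_n) : \bar R :=
  (\sum_j \int[mu]_(x in D) `|pderive j phi x|%:E)%E.

Lemma pderive_measurable (D : set 'rV[R]_n) phi j : smooth phi ->
  measurable_fun D (fun x => `|pderive j phi x|%:E).
Proof.
move=> sp; apply/measurable_EFinP; apply: measurable_funTS.
apply: measurableT_comp => //; apply: continuous_measurable_mx.
exact: smooth_cont (smooth_pderive j sp).
Qed.

Lemma abs_measurable (D : set 'rV[R]_n) phi : smooth phi ->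
  measurable_fun D (fun x => `|phi x|%:E).
Proof.
move=> sp; apply/measurable_EFinP; apply: measurable_funTS.
by apply: measurableT_comp => //; apply: continuous_measurable_mx; exact: smooth_cont.
Qed.

Lemma cell_poincare phi w : Cc_smooth Omega phi ->
  (\int[mu]_(x in cell w) `|phi x|%:E <= `|\int[mu]_(x in cell w) phi x|%:E +
    (side (size w))%:E * gradient_mass phi (cell w))%E.
Proof.
move=> Cp; have [sp _ _] := Cp; have [C C0 pC] := Cc_bounded Cp.
have mp : measurable_fun setT phi by apply: continuous_measurable_mx; exact: smooth_cont.
pose g := phi \_ (cell w).
pose g' j := (fun x => `|pderive j phi x|%:E)%E \_ (cell w).
have mg : measurable_fun setT g.
  by apply: (measurable_restrictT _ (mcell w)).1; exact: measurable_funTS.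
have mg' j : measurable_fun setT (g' j).
  by apply: (measurable_restrictT _ (mcell w)).1; exact: pderive_measurable.
have g'0 j x : (0 <= g' j x)%E.
  by rewrite /g' /patch; case: ifP => // _; rewrite lee_fin.
have gC x : `|g x| <= C by rewrite /g /patch; case: ifP => // _; rewrite normr0.
have gout x : ~ cell w x -> g x = 0.
  by move=> nx; rewrite /g /patch; case: ifPn => // /[!inE].
have hyp x j t : cell w x -> cell w (set_coord x j t) ->
    (`|g x - g (set_coord x j t)|%:E <= \int[leb]_s g' j (set_coord x j s))%E.
  move=> xw tw.
  rewrite /g /patch !mem_set//.
  have xj : lo K w 0 j <= x 0 j < hi K w 0 j by exact: xw.
  have tj : lo K w 0 j <= t < hi K w 0 j by have := tw j; rewrite mxE eqxx.
  have cdf : continuous (fun s => pderive j phi (set_coord x j s)).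
    move=> s; apply: continuous_comp; first exact: set_coord_continuous.
    exact: smooth_cont (smooth_pderive j sp) _.
  have fD (s : R) : is_derive s 1 (fun s => phi (set_coord x j s)) (pderive j phi (set_coord x j s)).
    by apply: is_derive_set_coord; exact: smooth_derivable.
  have := line_ftc cdf fD xj tj; rewrite set_coord_id => h; apply: le_trans h _.
  rewrite integral_mkcond le_eqVlt; apply/orP; left; apply/eqP.
  apply: eq_integral => s _; rewrite /g' /patch; congr (if _ then _ else _).
  apply/idP/idP; rewrite !inE /= ?in_itv/=.
    move=> sj i; rewrite mxE; case: eqP => [->//|_]; exact: xw.
  by move=> /(_ j); rewrite mxE eqxx.
have := box_poincare (fun i => lo_lt_hi K0 w i) mg gC gout mg' g'0 hyp.
have -> : (\int[mu]_x `|g x|%:E = \int[mu]_(x in cell w) `|phi x|%:E)%E.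
  rewrite [RHS]integral_mkcond; apply: eq_integral => x _.
  by rewrite /g /patch; case: ifP => // _; rewrite normr0.
rewrite -Rintegral_mkcond => h; apply: le_trans h _; rewrite leeD2l//.
rewrite /gradient_mass ge0_sume_distrr//; last by move=> j _; exact: integral_ge0.
apply: lee_sum => j _; rewrite -integral_mkcond; apply: lee_wpmul2r.
  exact: integral_ge0.
by rewrite lee_fin; exact: width_le.
Qed.

Lemma gradient_mass_ge0 phi D : (0 <= gradient_mass phi D)%E.
Proof. by apply: sume_ge0 => j _; exact: integral_ge0. Qed.

(** The form of the Poincare inequality that yields compactness: up to an error that
    tends to 0 with the size of the cells, the L^1 norm is controlled by finitely many
    numbers, the integrals over the cells. *)
Lemma level_poincare phi l : Cc_smooth Omega phi ->
  (\int[mu]_(x in Omega) `|phi x|%:E <=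
    (\sum_(w <- level l) `|\int[mu]_(x in cell w) phi x|)%:E +
    (side l)%:E * gradient_mass phi Omega)%E.
Proof.
move=> Cp; have [sp _ _] := Cp.
have root (f : 'rV[R]_n -> R) : (forall x, ~ Omega x -> f x = 0) ->
    (\int[mu]_(x in Omega) `|f x|%:E = \int[mu]_(x in cell [::]) `|f x|%:E)%E.
  move=> f0; rewrite [LHS]integral_mkcond [RHS]integral_mkcond.
  apply: eq_integral => x _; rewrite /patch; case: ifPn => [|/negP xO].
    by rewrite inE => /Ocell xc; rewrite mem_set.
  by case: ifP => // _; rewrite f0 ?normr0// => h; apply: xO; rewrite inE.
rewrite root; last by move=> x; exact: Cc_eq0 Cp.
rewrite (tree_integral mu mcell csplit cdisj l); last exact: abs_measurable.
have tvE : gradient_mass phi Omega = (\sum_(w <- level l) gradient_mass phi (cell w))%E.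
  rewrite /gradient_mass exchange_big; apply: eq_bigr => j _ /=.
  rewrite root; last by move=> x; apply: Cc_eq0; exact: (Cc_pderive j Cp).
  by apply: (tree_integral mu mcell csplit cdisj); exact: pderive_measurable.
rewrite tvE ge0_sume_distrr; last by move=> w _; exact: gradient_mass_ge0.
rewrite -sumEFin -big_split /= big_seq [leRHS]big_seq; apply: lee_sum => w wl.
by rewrite -(level_size wl); exact: cell_poincare.
Qed.

Lemma is_derive_id_coord (x : 'rV[R]_n) (i j : 'I_n) :
  is_derive x (delta_mx 0 j) (fun y : 'rV[R]_n => y 0 i) (i == j)%:R.
Proof. by rewrite -[X in is_derive _ _ _ X]mulr1; apply: (is_derive_coord j (h := id)). Qed.

(** The integral of phi is minus that of x_i times the i-th derivative of phi, and
    |x_i| < K on Omega. *)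
Lemma mean_bound phi (i : 'I_n) : Cc_smooth Omega phi ->
  (`|\int[mu]_(x in Omega) phi x|%:E <= K%:E * gradient_mass phi Omega)%E.
Proof.
move=> Cp; have [sp _ _] := Cp.
have dphi := Cc_pderive i Cp; have [sdp _ _] := dphi.
have boundedO : bounded_set Omega.
  exists K; split; first exact: num_real.
  move=> r Kr x /OK xK; rewrite /= {1}/Num.norm /= mx_normrE; apply: bigmax_le; first exact: ltW (lt_trans K0 Kr).
  by case=> a b _; rewrite ord1 /=; apply: ltW; exact: lt_trans (xK b) Kr.
pose xi (x : 'rV[R]_n) := x 0 i.
have cxi : continuous xi by exact: coord_continuous.
have dx x := is_derive_id_coord x i i.
have d x : is_derive x (delta_mx 0 i) (xi \* phi) (phi x + xi x * pderive i phi x).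
  have h2 := derivableP (@smooth_derivable _ _ phi i x sp).
  have := is_derive_mul (dx x) h2; rewrite eqxx mulr1 addrC; exact.
have [M pM] := Cc_cube boundedO Cp.
have pE : pderive i (xi \* phi) = (fun x => phi x + xi x * pderive i phi x).
  by apply/funext => x; rewrite /pderive; have [_ ->] := d x.
have cp := smooth_cont sp; have cdp := smooth_cont sdp.
have := @integral_pderive0 R n (xi \* phi) M i (continuous_mul cxi cp).
rewrite pE => /(_ (fun x => ex_derive)) h0.
have {}h0 : (\int[mu]_x (phi x + xi x * pderive i phi x)%:E = 0)%E.
  apply: h0.
  - by apply: continuous_add => //; exact: continuous_mul.
  - by move=> x nx; rewrite /= pM// mulr0.
have ip := Cc_integrable openO boundedO Cp.
have ixp : mu.-integrable Omega (EFin \o (fun x => xi x * pderive i phi x)).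
  have ci := Cc_integrable openO boundedO dphi.
  apply: (integrableMr mO _ _ ci).
    by apply: measurable_funTS; exact: continuous_measurable_mx.
  exists K; split; first exact: num_real.
  by move=> r Kr x /OK xK; apply: ltW; exact: lt_trans (xK i) Kr.
have I0 : \int[mu]_(x in Omega) phi x = - \int[mu]_(x in Omega) (xi x * pderive i phi x).
  apply/eqP; rewrite -addr_eq0; apply/eqP.
  rewrite -(RintegralD mO ip ixp) integral_Omega_setT.
    by rewrite /Rintegral h0.
  by move=> x xO; rewrite (Cc_eq0 Cp xO) (Cc_eq0 dphi xO) mulr0 addr0.
rewrite I0 normrN (EFin_normr_Rintegral mO ixp).
have mx : measurable_fun Omega (fun x => (xi x * pderive i phi x)%:E).
  by case/integrableP: ixp.
apply: le_trans (le_abse_integral mu mO mx) _.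
apply: (@le_trans _ _ (\int[mu]_(x in Omega) (K%:E * `|pderive i phi x|%:E))%E).
  apply: ge0_le_integral.
  - exact: mO.
  - by move=> x _; exact: abse_ge0.
  - exact: measurableT_comp mx.
  - by apply: measurable_funeM; exact: pderive_measurable.
  - move=> x /OK xK; rewrite abse_EFin -EFinM lee_fin normrM ler_wpM2r//.
    exact: ltW (xK i).
rewrite ge0_integralZl_EFin//; [|exact: pderive_measurable|exact: ltW].
apply: lee_wpmul2l; first by rewrite lee_fin ltW.
rewrite /gradient_mass (bigD1 i)//= leeDl//.
by apply: sume_ge0 => j _; exact: integral_ge0.
Qed.

Lemma poincare phi : Cc_smooth Omega phi ->
  (\int[mu]_(x in Omega) `|phi x|%:E <= (3 * K)%:E * gradient_mass phi Omega)%E.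
Proof.
move=> Cp; have i : 'I_n := Ordinal n_gt0.
apply: le_trans (level_poincare 0 Cp) _.
rewrite big_seq1 /side div0n expr0 divr1.
have -> : \int[mu]_(x in cell [::]) phi x = \int[mu]_(x in Omega) phi x.
  rewrite [LHS]Rintegral_mkcond [RHS]Rintegral_mkcond; congr Rintegral.
  apply/funext => x; rewrite /patch; case: (boolP (x \in Omega)) => [|/negP xO].
    by rewrite inE => /Ocell xc; rewrite mem_set.
  by case: ifP => // _; apply: (Cc_eq0 Cp) => h; apply: xO; rewrite inE.
apply: le_trans (leeD (mean_bound i Cp) (lexx _)) _.
have h2 : (0 <= (2 * K)%:E :> \bar R)%E by rewrite lee_fin mulr_ge0// ltW.
have h1 : (0 <= K%:E :> \bar R)%E by rewrite lee_fin ltW.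
rewrite -(ge0_muleDl _ h1 h2) -EFinD.
by rewrite (_ : K + 2 * K = 3 * K)//; ring.
Qed.

End rellich.

(** * Completeness of L1 *)

Section L1_completeness.
Context d (T : measurableType d) (R : realType) (mu : {measure set T -> \bar R}).

Lemma bounded_variation_cvgn (u : nat -> R) :
  (\sum_(j <oo) `|u j.+1 - u j|%:E < +oo)%E -> cvgn u.
Proof.
move=> ufin.
have -> : u = (fun k => u 0%N + series (telescope u) k).
  by apply/funext => k; exact: eq_sum_telescope.
apply: is_cvgD; first exact: is_cvg_cst.
apply: normed_cvg; apply: nondecreasing_is_cvgn.
  by apply: nondecreasing_series => k _ _; exact: normr_ge0.
exists (fine (\sum_(j <oo) `|u j.+1 - u j|%:E)%E) => _ [k _ <-].
have h0 : (0 <= \sum_(j <oo) `|u j.+1 - u j|%:E)%E by exact: nneseries_ge0.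
rewrite -lee_fin fineK ?ge0_fin_numE// -sumEFin.
apply: nneseries_lim_ge => j _ _; by rewrite lee_fin normr_ge0.
Qed.

Lemma limn_einf_le (u : nat -> \bar R) (e : \bar R) :
  (\forall k \near \oo, (u k <= e)%E) -> (limn_einf u <= e)%E.
Proof.
move=> ue; rewrite limn_einf_lim; apply: lime_le; first exact: is_cvg_einfs.
apply: filterS ue => k; apply: le_trans; apply: ereal_inf_lbound.
by exists k => //=.
Qed.

Variable D : set T.
Hypothesis mD : measurable D.

(** A subsequence with summable increments converges almost everywhere, and the limit is
    identified by Fatou's lemma. Off the set E of convergence the subsequence is set
    to 0, so that the limit is a pointwise one of measurable functions. *)
Lemma L1_complete (f : nat -> T -> R) :
  (forall k, mu.-integrable D (EFin \o f k)) ->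
  (forall e : R, 0 < e -> exists N, forall k m, (N <= k)%N -> (N <= m)%N ->
    (\int[mu]_(x in D) `|f k x - f m x|%:E <= e%:E)%E) ->
  exists2 g, mu.-integrable D (EFin \o g) &
    (fun k => \int[mu]_(x in D) `|f k x - g x|%:E)%E @ \oo --> 0%E.
Proof.
move=> fi cauchy.
have mf k : measurable_fun D (f k) by apply/measurable_EFinP; case/integrableP: (fi k).
have md k (g : T -> R) : measurable_fun D g ->
    measurable_fun D (fun x => `|f k x - g x|%:E).
  by move=> mg; apply/measurable_EFinP; apply: measurableT_comp => //; exact: measurable_funB.
have eps j : 0 < 1 / (2 ^ j.+1)%:R :> R by rewrite divr_gt0// ltr0n expn_gt0.
have [N NP] := choice (fun j => cauchy _ (eps j)).
pose h j := (\sum_(i < j.+1) N i + j)%N.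
have hN j i : (i <= j)%N -> (N i <= h j)%N.
  move=> ij; rewrite /h (bigD1 (Ordinal (ij : (i < j.+1)%N)))//= -addnA; exact: leq_addr.
have jh j : (j <= h j)%N by exact: leq_addl.
pose dd j x := (`|f (h j.+1) x - f (h j) x|%:E : \bar R).
have dd0 j x : (0 <= dd j x)%E by rewrite lee_fin normr_ge0.
have mdd j : measurable_fun D (dd j) by exact: md.
pose S x := (\sum_(j <oo) dd j x)%E.
have mS : measurable_fun D S.
  rewrite /S (_ : (fun x => _) = (fun x => \sum_(j <oo | j \in xpredT) dd j x)%E).
    apply: (ge0_emeasurable_sum (P := xpredT)) => k; last by move=> _; exact: mdd.
    by move=> x _ _; exact: dd0.
  by apply/funext => x; exact: eq_eseriesl.
have iS : (\int[mu]_(x in D) S x <= 1)%E.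
  rewrite integral_nneseries//.
  apply: le_trans (epsilon_trick0 xpredT (ler01 : 0 <= 1 :> R)).
  apply: lee_nneseries => j _; first by move=> _; exact: integral_ge0.
  by apply: NP; apply: hN.
have S0 x : (0 <= S x)%E by exact: nneseries_ge0.
have Si : mu.-integrable D S.
  apply/integrableP; split=> //.
  under eq_integral do rewrite gee0_abs//.
  exact: le_lt_trans iS (ltry _).
have Sfin := integrable_ae mD Si.
pose E := D `&` [set x | (S x < +oo)%E].
have mE : measurable E.
  rewrite (_ : E = D `&` S @^-1` `]-oo%E, +oo%E[%classic).
    apply: mS => //; exact: emeasurable_itv.
  apply/seteqP; split => x [Dx Sx]; split=> //; move: Sx; rewrite /= in_itv/=.
    by move=> Sx; rewrite Sx andbT; apply: (@lt_le_trans _ _ 0%E) => //; exact: ltNyr.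
  by case/andP.
pose fE j := f (h j) \_ E.
pose g x := limn (fE ^~ x).
have fEg x : fE ^~ x @ \oo --> g x.
  rewrite /g /fE /patch; case: (x \in E) /idP => [|_]; last exact: is_cvg_cst.
  rewrite inE => -[Dx Sx]; exact: (@bounded_variation_cvgn (fun j => f (h j) x)).
have mg : measurable_fun D g.
  apply: (measurable_fun_cvg (h := fE)) => // j.
  apply: measurable_funTS; apply: (measurable_restrictT _ mE).1.
  apply: measurable_funS (mf (h j)) => //; exact: subIsetl.
have bound e : 0 < e -> \forall k \near \oo,
    (\int[mu]_(x in D) `|f k x - g x|%:E <= e%:E)%E.
  move=> e0; have [M MP] := cauchy e e0; exists M => // k /= Mk.
  apply: (@le_trans _ _ (\int[mu]_(x in D)
      limn_einf (fun j => `|f k x - f (h j) x|%:E))%E); last first.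
    apply: le_trans (fatou mu mD _ _) _ => //; first by move=> j; exact: md.
    apply: limn_einf_le; exists M => // j /= Mj; apply: MP => //; exact: leq_trans (jh j).
  rewrite le_eqVlt; apply/orP; left; apply/eqP; apply: ae_eq_integral.
  - exact: mD.
  - exact: md.
  - rewrite [X in measurable_fun _ X](_ : _ = (fun x => - limn_esup (fun j => - `|f k x - f (h j) x|%:E))%E)//.
    apply: measurableT_comp => //; apply: measurable_fun_limn_esup => j.
    by apply: measurableT_comp => //; exact: md.
  apply: filterS Sfin => x Sx Dx.
  have Ex : E x by split=> //=; have := Sx Dx; rewrite ge0_fin_numE.
  apply/esym; apply: (cvg_limn_einf_sup _).1.
  apply: cvg_EFin; first exact: nearW.
  have := fEg x; rewrite /fE /patch mem_set// => h1.
  by apply: cvg_norm; apply: cvgB => //; exact: cvg_cst.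
exists g; last by apply: ge0_cvge0 bound => k; exact: integral_ge0.
have [k _ /(_ k (leqnn k)) kP] := bound 1 ltr01.
have ik : mu.-integrable D (EFin \o (fun x => f k x - g x)).
  apply/integrableP; split; first by apply/measurable_EFinP; exact: measurable_funB.
  exact: le_lt_trans kP (ltry _).
have := integrableB mD (fi k) ik.
rewrite (_ : _ \- _ = EFin \o g)%E//; apply/funext => x /=.
by rewrite -EFinD opprB addrC subrK.
Qed.

End L1_completeness.

(** * Integrals against a difference of measures *)

Lemma fin_num_diff_eq (R : realType) (a b p m : \bar R) :
  a \is a fin_num -> b \is a fin_num -> p \is a fin_num -> m \is a fin_num ->
  (a - b = p - m)%E -> (p + b = a + m)%E.
Proof.
case: a b p m => [a| |] [b| |] [p| |] [m| |]// _ _ _ _.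
by rewrite -!EFinB => -[h]; rewrite -!EFinD; congr _%:E; move: h; lra.
Qed.

Section signed_measures.
Context d (T : measurableType d) (R : realType).
Variables nu1 nu2 : {finite_measure set T -> \bar R}.

Definition measure_diff : {charge set T -> \bar R} :=
  cadd (charge_of_finite_measure nu1) (cscale (-1) (charge_of_finite_measure nu2)).

Variables (D : set T) (f : T -> R) (C : R).
Hypotheses (mD : measurable D) (mf : measurable_fun D f).
Hypothesis fC : forall x, D x -> `|f x| <= C.

Lemma bounded_finite_integrable (nu : {finite_measure set T -> \bar R}) :
  nu.-integrable D (EFin \o f).
Proof.
apply: measurable_bounded_integrable => //.
  by rewrite -ge0_fin_numE ?measure_ge0// fin_num_measure.
exists C; split; first exact: num_real.
by move=> r Cr x /fC xC; exact: le_trans xC (ltW Cr).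
Qed.

(** The definition of [charge_integral] refers to some Hahn decomposition. If nu1 - nu2
    has Jordan decomposition p - m, the measures p + nu2 and nu1 + m agree, and so do
    their integrals. *)
Lemma charge_integral_diff :
  charge_integral measure_diff D f = \int[nu1]_(x in D) f x - \int[nu2]_(x in D) f x.
Proof.
rewrite /charge_integral.
set P := cid _; set N := cid _.
set jp := jordan_pos _; set jn := jordan_neg _.
have E (A : set T) : measurable A -> measure_add jp nu2 A = measure_add nu1 jn A.
  move=> mA; rewrite !measure_addE.
  apply: fin_num_diff_eq; try exact: fin_num_measure.
  by rewrite -[(- nu2 A)%E]mulN1e -[(- jn A)%E]mulN1e; exact: jordan_decomp (projT2 N) A mA.
have iE : (\int[measure_add jp nu2]_(x in D) (f x)%:E =
    \int[measure_add nu1 jn]_(x in D) (f x)%:E)%E.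
  by apply: eq_measure_integral => A mA _; exact: E.
have mfE : measurable_fun D (EFin \o f) by exact/measurable_EFinP.
have ip := bounded_finite_integrable jp.
have i_n := bounded_finite_integrable jn.
have i1 := bounded_finite_integrable nu1.
have i2 := bounded_finite_integrable nu2.
move: iE; rewrite !integral_measure_add//.
rewrite -!EFin_Rintegral// -!EFinD => -[h].
by apply/eqP; rewrite subr_eq addrAC -h addrK.
Qed.

End signed_measures.

(** * Compactness of test functions in L1 *)

Section rellich_compactness.
Context {R : realType} {n : nat}.
Hypothesis n_gt0 : (0 < n)%N.
Local Notation mu := (@lebesgue_rV R n).
Variable Omega : set 'rV[R]_n.
Hypothesis openO : open Omega.
Let mO : measurable Omega := open_measurable_mx openO.
Hypothesis boundedO : bounded_set Omega.
Variable K : R.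
Hypothesis K0 : 0 < K.
Hypothesis OK : Omega `<=` cube K.
Local Notation cell := (@cell R n K).
Local Notation side := (@side R n K).

Lemma Cc_cell_integrable (phi : 'rV[R]_n -> R) w : Cc_smooth Omega phi ->
  mu.-integrable (cell w) (EFin \o phi).
Proof.
move=> Cp; have [M pM] := Cc_cube boundedO Cp; have [sp _ _] := Cp.
apply: (integrableS _ _ (@subsetT _ _) (continuous_cube_integrable (smooth_cont sp) pM)) => //.
exact: measurable_cell.
Qed.

Lemma gradient_massB phi psi : Cc_smooth Omega phi -> Cc_smooth Omega psi ->
  (gradient_mass (phi \- psi)%R Omega <=
    gradient_mass phi Omega + gradient_mass psi Omega)%E.
Proof.
move=> [sp _ _] [ss _ _]; rewrite /gradient_mass -big_split /=.
apply: lee_sum => j _; rewrite -ge0_integralD; [|exact: mO|by []|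
  exact: pderive_measurable|by []|exact: pderive_measurable].
apply: ge0_le_integral.
- exact: mO.
- by [].
- by apply: pderive_measurable; exact: smoothB.
- by apply: emeasurable_funD; exact: pderive_measurable.
- move=> x _; rewrite -EFinD lee_fin.
  by rewrite {1}/pderive deriveB; [exact: ler_normB|exact: smooth_derivable|exact: smooth_derivable].
Qed.

Lemma rellich_arith (e B s t1 t2 V : R) : 0 < e -> 0 <= B -> 0 <= s ->
  s <= e / (4 * (B + 1)) -> t1 <= e / 4 -> t2 <= e / 4 -> V <= B + B ->
  t1 + t2 + s * V <= e.
Proof.
move=> e0 B0 s0 sl h1 h2 hV.
have B1 : 0 < 4 * (B + 1) by rewrite mulr_gt0// ltr_wpDl.
have : s * V <= s * (2 * (B + 1)) by apply: ler_wpM2l => //; lra.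
have : s * (4 * (B + 1)) <= e by rewrite -ler_pdivlMr.
lra.
Qed.

(** [level_poincare] is applied to the differences: the depth is chosen first, to
    absorb the gradients, and then the indices beyond which the finitely many cell
    integrals are close to their limits. *)
Lemma rellich_cauchy (phi : nat -> 'rV[R]_n -> R) (B : R) (a : seq bool -> R) :
  (forall k, Cc_smooth Omega (phi k)) ->
  (forall k, (gradient_mass (phi k) Omega <= B%:E)%E) ->
  (forall w, (fun k => \int[mu]_(x in cell w) phi k x) @ \oo --> a w) ->
  forall e : R, 0 < e -> exists N, forall k m, (N <= k)%N -> (N <= m)%N ->
    (\int[mu]_(x in Omega) `|phi k x - phi m x|%:E <= e%:E)%E.
Proof.
move=> Cp TV pa e e0.
have B0 : 0 <= B by rewrite -lee_fin (le_trans _ (TV 0%N))// gradient_mass_ge0.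
have B1 : 0 < e / (4 * (B + 1)) by rewrite divr_gt0// mulr_gt0// ltr_wpDl.
have [l sl] : exists l, side l <= e / (4 * (B + 1)).
  have /cvgrPdist_le/(_ _ B1)[l _ lP] := side_cvg n_gt0 K0; exists l.
  by have := lP l (leqnn l); rewrite sub0r normrN; exact: le_trans (ler_norm _).
pose t k := \sum_(w <- level l) `|\int[mu]_(x in cell w) phi k x - a w|.
have t0 : t @ \oo --> 0.
  rewrite [X in _ --> X](_ : 0 = \sum_(w <- level l) `|a w - a w|).
    apply: cvg_sum_seq => w; apply: cvg_norm; apply: cvgB; [exact: pa|exact: cvg_cst].
  by rewrite big1// => w _; rewrite subrr normr0.
have e4 : 0 < e / 4 by rewrite divr_gt0.
have /cvgrPdist_le/(_ _ e4)[N _ NP] := t0.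
have tN k : (N <= k)%N -> t k <= e / 4.
  by move=> Nk; have := NP k Nk; rewrite sub0r normrN; exact: le_trans (ler_norm _).
exists N => k m Nk Nm.
have Cd := Cc_smoothB (Cp k) (Cp m).
have tv := gradient_massB (Cp k) (Cp m).
have {}tv := le_trans tv (leeD (TV k) (TV m)).
have tvf : gradient_mass (phi k \- phi m) Omega \is a fin_num.
  by rewrite ge0_fin_numE ?gradient_mass_ge0// (le_lt_trans tv)// -EFinD ltry.
apply: le_trans (level_poincare n_gt0 K0 OK l Cd) _.
rewrite -(fineK tvf) -EFinM -EFinD lee_fin.
rewrite -(fineK tvf) -EFinD lee_fin in tv.
have s0 : 0 <= side l by apply: side_ge0.
apply: le_trans (rellich_arith e0 B0 s0 sl (tN k Nk) (tN m Nm) tv).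
rewrite lerD2r /t -big_split /=; apply: ler_sum => w _.
rewrite RintegralB; [|exact: measurable_cell|exact: Cc_cell_integrable|exact: Cc_cell_integrable].
rewrite -[leLHS]normr_id (_ : _ - _ = (\int[mu]_(x in cell w) phi k x - a w) -
   (\int[mu]_(x in cell w) phi m x - a w)); last by rewrite opprB addrA subrK.
by rewrite normr_id; exact: ler_normB.
Qed.

End rellich_compactness.

(** * Extension by zero of functions vanishing at the boundary *)

Section vanishing_functions.
Context {R : realType} {n : nat}.
Variable Omega : set 'rV[R]_n.
Hypothesis openO : open Omega.

Lemma Cc_C0 phi : Cc_smooth Omega phi -> C0 Omega phi.
Proof.
move=> [sp cp pO]; have cphi := smooth_cont sp; split.
  exact: continuous_subspaceT.
move=> e e0; apply: (subclosed_compact _ cp); last first.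
  move=> x [_ /= ex]; apply: subset_closure => /=; apply/eqP => x0.
  by move: ex; rewrite x0 normr0 leNgt e0.
rewrite (_ : _ `&` _ = (fun x => `|phi x|) @^-1` [set t | e <= t]).
  apply: closed_comp; last exact: closed_ge.
  move=> x _; apply: continuous_comp; [exact: cphi|exact: norm_continuous].
apply/seteqP; split => [x []//|x /= ex]; split=> //.
apply: pO; apply: subset_closure => /=; apply/eqP => x0.
by move: ex; rewrite x0 normr0 leNgt e0.
Qed.

Variable phi : 'rV[R]_n -> R.
Hypothesis phi0 : C0 Omega phi.
Local Notation psi := (phi \_ Omega).

Let superlevel e : 0 < e -> compact [set x | e <= `|psi x|].
Proof.
move=> e0; have [_ /(_ e e0)] := phi0.
congr compact; apply/seteqP; split => [x [Ox /=]|x /=]; first by rewrite patchT ?inE.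
by rewrite /patch; case: ifPn => [/[!inE]//|]; rewrite normr0 leNgt e0.
Qed.

(** Outside Omega, the set where the absolute value of phi is at least e is compact,
    hence closed, and its complement is a neighbourhood on which the extension is
    less than e. *)
Lemma C0_extension_continuous : continuous psi.
Proof.
move=> x; have [Ox|nOx] := pselect (Omega x).
  have [cphi _] := phi0; rewrite continuous_open_subspace// in cphi.
  rewrite /continuous_at patchT ?inE//.
  apply/(@cvgrPdist_lt _ _ _ _ (nbhs_filter x)) => e e0.
  have /cvgrPdist_lt/(_ e e0) := cphi x (mem_set Ox).
  have := open_nbhs_nbhs (conj openO Ox); apply: filterS2 => y Oy.
  by rewrite patchT ?inE.
rewrite /continuous_at [X in _ --> X]patchC ?inE//; apply/(@cvgrPdist_lt _ _ _ _ (nbhs_filter x)) => e e0.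
have cK : closed [set x | e <= `|psi x|].
  exact: compact_closed (@norm_hausdorff _ 'rV[R]_n) (superlevel e0).
have : nbhs x (~` [set x | e <= `|psi x|]).
  apply: open_nbhs_nbhs; split; first exact: closed_openC.
  by rewrite /= patchC ?normr0 ?inE// leNgt e0.
by apply: filterS => y /= /negP; rewrite -ltNge sub0r normrN.
Qed.

(** Near covering compactness of the set where the absolute value is at least e/2 gives
    a radius valid for all its points; two points outside it have values less than
    e/2. *)
Lemma C0_extension_uniform : uniformly_continuous psi.
Proof.
move=> e e0; have e2 : 0 < e / 2 by rewrite divr_gt0.
pose P (r : R) (x : 'rV[R]_n) := forall y : 'rV[R]_n,
  (forall i, `|x 0 i - y 0 i| <= r) -> `|psi x - psi y| <= e.
have /compact_near_coveringP/(_ R 0^'+ P) := superlevel e2.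
have FF : Filter (0 : R)^'+ by exact: at_right_proper_filter.
move=> /(_ FF) near_r.
have {}near_r : \forall r \near (0 : R)^'+, [set x | e / 2 <= `|psi x|] `<=` P r.
  apply: near_r => x Kx.
  have /cvgrPdist_lt/(_ _ e2)/near_mx_cube[r r0 rP] := @C0_extension_continuous x.
  have r2 : 0 < r / 2 by rewrite divr_gt0.
  exists (ball x (r / 2), [set s | s < r / 2]).
    by split; [exact: nbhsx_ballx|exact: nbhs_right_lt].
  move=> [x' s] [/= xx' sr] y x'y.
  have bx (i : 'I_1) j : `|x' i j - x i j| < r / 2.
    by have [_ /(_ i j)] := xx'; rewrite /ball /= distrC.
  have h1 : `|psi x - psi x'| < e / 2.
    by apply: rP => i j; apply: lt_trans (bx i j) _; lra.
  have h2 : `|psi x - psi y| < e / 2.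
    apply: rP => i j; rewrite ord1.
    have := x'y j; have := bx 0 j; rewrite distrC => b1 b2.
    rewrite -(subrK (x' 0 j) (y 0 j)) -addrA; apply: le_lt_trans (ler_normD _ _) _.
    by rewrite distrC; move: b1; rewrite distrC => b1; lra.
  rewrite -(subrK (psi x) (psi x')) -addrA; apply: le_trans (ler_normD _ _) _.
  by rewrite distrC; lra.
have [r [rpos rP]] := filter_ex (filterI (nbhs_right_gt (0 : R)) near_r).
exists r => // x y xy.
have [ex|xe] := leP (e / 2) `|psi x|; first exact: rP.
have [ey|ye] := leP (e / 2) `|psi y|.
  by rewrite distrC; apply: rP => // i; rewrite distrC.
apply: le_trans (ler_normB _ _) _; lra.
Qed.

Lemma C0_extension_bounded : exists C, forall x, `|psi x| <= C.
Proof.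
have cK := superlevel ltr01.
have [[x0 Kx0]|K0] := pselect ([set x | 1 <= `|psi x|] !=set0); last first.
  by exists 1 => x; rewrite leNgt; apply/negP => /ltW x1; apply: K0; exists x.
have [||c cc cmax] := @compact_EVT_max _ _ (fun x => `|psi x|) _ _ cK.
- by exists x0.
- apply: continuous_subspaceT => x; apply: continuous_comp; last exact: norm_continuous.
  exact: C0_extension_continuous.
exists `|psi c| => x; have [x1|/ltW x1] := leP 1 `|psi x|.
  by apply: cmax; rewrite inE.
by apply: le_trans x1 _; rewrite inE in cc.
Qed.

Lemma C0_extension_measurable : measurable_fun setT psi.
Proof. exact: continuous_measurable_mx C0_extension_continuous. Qed.

End vanishing_functions.

(** * Vague limits of signed densities *)

Section signed_parts.
Context d (T : measurableType d) (R : realType) (mu : {measure set T -> \bar R}).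

(** The positive part of G for s = false, the negative part for s = true. *)
Definition signed_part (s : bool) (G : T -> R) x : R := Num.max ((-1) ^+ s * G x) 0.

Lemma signed_part_ge0 s G x : 0 <= signed_part s G x.
Proof. by rewrite /signed_part le_max lexx orbT. Qed.

Lemma signed_partB G x : G x = signed_part false G x - signed_part true G x.
Proof.
rewrite /signed_part expr0 expr1 mul1r mulN1r.
by case: (leP (G x) 0) => h1; case: (leP (- G x) 0) => h2; lra.
Qed.

Lemma signed_part_le s G x : `|signed_part s G x| <= `|G x|.
Proof.
rewrite ger0_norm ?signed_part_ge0// /signed_part ge_max normr_ge0 andbT.
by apply: le_trans (ler_norm _) _; rewrite normrM normrX normrN1 expr1n mul1r.
Qed.

Lemma signed_part_integrable (D : set T) s G : measurable D ->
  mu.-integrable D (EFin \o G) -> mu.-integrable D (EFin \o signed_part s G).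
Proof.
move=> mD iG; have mG : measurable_fun D G by apply/measurable_EFinP; case/integrableP: iG.
apply: (le_integrable mD _ _ iG) => [|x _]; last by rewrite !abse_EFin lee_fin signed_part_le.
apply/measurable_EFinP; apply: measurable_maxr; last exact: measurable_cst.
by apply: measurable_funM => //; exact: measurable_cst.
Qed.

End signed_parts.

Section signed_vague_limit.
Context {R : realType} {n : nat}.
Hypothesis n_gt0 : (0 < n)%N.
Local Notation mu := (@lebesgue_rV R n).
Variable Omega : set 'rV[R]_n.
Hypothesis openO : open Omega.
Let mO : measurable Omega := open_measurable_mx openO.
Variable K : R.
Hypothesis K0 : 0 < K.
Hypothesis OK : Omega `<=` cube K.
Local Notation cell := (@cell R n K).

Let Ocell : Omega `<=` cell [::] := subset_trans OK (@cube_cell R n K).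

(** The limit measure may charge the boundary of Omega or depend on how the densities
    are extended, but functions that vanish at the boundary only see its trace on
    Omega. *)
Lemma signed_vague_limit (G : nat -> 'rV[R]_n -> R) (L : bool -> seq bool -> R) :
  (forall k, mu.-integrable Omega (EFin \o G k)) ->
  (forall s w, (fun k => \int[mu]_(x in cell w) ((signed_part s (G k)) \_ Omega) x) @ \oo
     --> L s w) ->
  exists nu : {charge set 'rV[R]_n -> \bar R}, forall phi, C0 Omega phi ->
    (fun k => \int[mu]_(x in Omega) (phi x * G k x)) @ \oo --> charge_integral nu Omega phi.
Proof.
move=> Gi GL.
have gi s k : mu.-integrable (cell [::]) (EFin \o ((signed_part s (G k)) \_ Omega)).
  have mc : measurable (cell [::]) := measurable_cell K [::].
  have := (integrable_mkcond (mu := mu) (EFin \o signed_part s (G k)) mO).1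
    (signed_part_integrable s mO (Gi k)).
  rewrite restrict_EFin; apply: integrableS => //.
have g0 s k x : cell [::] x -> 0 <= ((signed_part s (G k)) \_ Omega) x.
  by move=> _; rewrite /patch; case: ifP => // _; exact: signed_part_ge0.
have lim s := vague_limit (measurable_cell K) (cell_split n_gt0 K0)
  (cell_disj n_gt0 K) (lo_close n_gt0 K0) (cell_close n_gt0 K0) (side_cvg n_gt0 K0)
  (gi s) (g0 s) (GL s).
have {}lim s : exists nu : {finite_measure set 'rV[R]_n -> \bar R}, forall phi, C0 Omega phi ->
    (fun k => \int[mu]_(x in Omega) (phi x * signed_part s (G k) x)) @ \oo -->
    \int[nu]_(x in Omega) phi x.
  have [nu nuP] := lim s.
  exists nu => phi C0phi; have [C pC] := C0_extension_bounded openO C0phi.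
  have := nuP _ C (C0_extension_measurable openO C0phi) pC (C0_extension_uniform openO C0phi).
  rewrite -Rintegral_mkcond (_ : (fun k => _) =
    (fun k => \int[mu]_(x in Omega) (phi x * signed_part s (G k) x)))//.
  apply/funext => k; rewrite [LHS]Rintegral_mkcond [RHS]Rintegral_mkcond.
  congr Rintegral; apply/funext => x; rewrite /patch.
  case: (boolP (x \in Omega)) => [|xO].
    by rewrite inE => /Ocell xc; rewrite mem_set.
  by case: ifP => // _; rewrite mulr0.
have [nup nupP] := lim false; have [nun nunP] := lim true.
exists (measure_diff nup nun) => phi C0phi.
have [C pC] := C0_extension_bounded openO C0phi.
have mp := C0_extension_measurable openO C0phi.
have mphi : measurable_fun Omega phi by apply: (measurable_restrictT _ mO).2.
have phiC x : Omega x -> `|phi x| <= C.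
  by move=> Ox; have := pC x; rewrite patchT ?inE.
rewrite (charge_integral_diff nup nun mO mphi phiC).
rewrite (_ : (fun k => _) = (fun k => \int[mu]_(x in Omega) (phi x * signed_part false (G k) x) -
    \int[mu]_(x in Omega) (phi x * signed_part true (G k) x))).
  by apply: cvgB; [exact: nupP|exact: nunP].
apply/funext => k.
have ip s : mu.-integrable Omega (EFin \o (fun x => phi x * signed_part s (G k) x)).
  have := signed_part_integrable s mO (Gi k).
  apply: integrableMr => //.
  exists C; split; first exact: num_real.
  by move=> r Cr x Ox; apply: le_trans (phiC x Ox) (ltW Cr).
rewrite -RintegralB//; apply: eq_Rintegral => x _.
by rewrite -mulrBr -signed_partB.
Qed.

(** The measure with density G, obtained as the vague limit of a constant sequence. *)
Lemma density_charge (G : 'rV[R]_n -> R) : mu.-integrable Omega (EFin \o G) ->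
  exists nu : {charge set 'rV[R]_n -> \bar R}, forall phi, C0 Omega phi ->
    \int[mu]_(x in Omega) (phi x * G x) = charge_integral nu Omega phi.
Proof.
move=> Gi.
have [nu nuP] := @signed_vague_limit (fun=> G)
  (fun s w => \int[mu]_(x in cell w) ((signed_part s G) \_ Omega) x) (fun=> Gi)
  (fun s w => cvg_cst _).
exists nu => phi C0phi.
by apply: (cvg_unique _ (cvg_cst _) (nuP phi C0phi)) => //; exact: norm_hausdorff.
Qed.

End signed_vague_limit.

(** * Derivative measures and compactness in BV *)

Section derivative_measures.
Context {R : realType} {n N : nat}.
Hypothesis n_gt0 : (0 < n)%N.
Local Notation mu := (@lebesgue_rV R n).
Variable Omega : set 'rV[R]_n.
Hypothesis openO : open Omega.
Let mO : measurable Omega := open_measurable_mx openO.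
Hypothesis boundedO : bounded_set Omega.

Lemma weak_gradient_measure (u : 'rV[R]_n -> 'rV[R]_N) G :
  is_weak_gradient Omega u G -> Lp Omega 1 G ->
  exists2 Du, is_derivative_measure Omega u Du &
    forall i j phi, C0 Omega phi ->
      charge_integral (Du i j) Omega phi = \int[mu]_(x in Omega) (phi x * G x i j).
Proof.
move=> uG /(Lp1P _ mO) iG.
have [K K0 OK] := bounded_sub_cube boundedO.
have ex (ij : 'I_N * 'I_n) : exists nu : {charge set 'rV[R]_n -> \bar R},
    forall phi, C0 Omega phi ->
    \int[mu]_(x in Omega) (phi x * G x ij.1 ij.2) = charge_integral nu Omega phi.
  by apply: (density_charge n_gt0 openO K0 OK (G := fun x => G x ij.1 ij.2)); exact: iG.
have [D DP] := choice ex.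
exists (fun i j => D (i, j)) => [phi Cp i j|i j phi C0p]; last by rewrite -DP.
rewrite -DP; last exact: Cc_C0.
have [_ _ ->//] := uG; congr (- _); apply: eq_Rintegral => x _; exact: mulrC.
Qed.

Lemma weak_gradient_BV (u : 'rV[R]_n -> 'rV[R]_N) G :
  is_weak_gradient Omega u G -> Lp Omega 1 u -> Lp Omega 1 G -> BV Omega u.
Proof.
by move=> uG Lu LG; split=> //; have [Du ? _] := weak_gradient_measure uG LG; exists Du.
Qed.

Lemma entry_Lpnorm k l (f : 'rV[R]_n -> 'M[R]_(k, l)) i j : measurable_fun Omega f ->
  (\int[mu]_(x in Omega) `|f x i j|%:E <= Lpnorm Omega 1 f)%E.
Proof.
move=> mf; rewrite Lpnorm1E; apply: ge0_le_integral.
- exact: mO.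
- by move=> x _; rewrite lee_fin.
- apply/measurable_EFinP; apply: measurableT_comp => //; exact: measurable_fun_entry.
- by apply/measurable_EFinP; exact: measurable_fun_enorm.
- by move=> x _; rewrite lee_fin entry_le_enorm.
Qed.

Lemma extraction_countable (I : countType) (a : I -> nat -> R) :
  (forall i, exists C, forall k, `|a i k| <= C) ->
  exists (h : nat -> nat) (L : I -> R), (forall m, (m <= h m)%N) /\
    forall i, (fun k => a i (h k)) @ \oo --> L i.
Proof.
move=> ab.
pose b p k := if unpickle p is Some i then a i k else 0.
have [p|h [L [hm hL]]] := @diagonal_extraction R b.
  rewrite /b; case: (unpickle p) => [i|]; first exact: ab.
  by exists 0 => k; rewrite normr0.
exists h, (fun i => L (pickle i)); split=> // i.
have := hL (pickle i); rewrite /b pickleK; exact.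
Qed.

Lemma Rintegral_abs_le (D : set 'rV[R]_n) (f : 'rV[R]_n -> R) (B : R) :
  measurable D -> mu.-integrable D (EFin \o f) ->
  (\int[mu]_(x in D) `|f x|%:E <= B%:E)%E -> `|\int[mu]_(x in D) f x| <= B.
Proof.
move=> mD fi fB; rewrite -lee_fin EFin_normr_Rintegral//.
apply: le_trans fB; apply: le_abse_integral => //.
by case/integrableP: fi.
Qed.

Variables (u_ : nat -> 'rV[R]_n -> 'rV[R]_N) (G_ : nat -> 'rV[R]_n -> 'M[R]_(N, n)).
Variables (u0 : 'rV[R]_n -> 'rV[R]_N) (phi : nat -> 'rV[R]_n -> 'rV[R]_N) (B : R).
Hypothesis uG : forall k, is_weak_gradient Omega (u_ k) (G_ k).
Hypothesis Lu : forall k, Lp Omega 1 (u_ k).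
Hypothesis LG : forall k, Lp Omega 1 (G_ k).
Hypothesis Lu0 : Lp Omega 1 u0.
Hypothesis Cphi : forall k i, Cc_smooth Omega (fun x => phi k x 0 i).
Hypothesis uphi :
  (fun k => Lpnorm Omega 1 (fun x => u_ k x - u0 x - phi k x)) @ \oo --> 0%E.
Hypothesis phiB : forall k i, (gradient_mass (fun x => phi k x 0%R i) Omega <= B%:E)%E.
Hypothesis GB : forall k, (Lpnorm Omega 1 (G_ k) <= B%:E)%E.

Section subsequence.
Variables (K : R) (K0 : 0 < K) (OK : Omega `<=` cube K).
Local Notation cell := (@cell R n K).

Lemma integral_sub_restrict (D : set 'rV[R]_n) (f : 'rV[R]_n -> R) :
  measurable D -> measurable_fun Omega f ->
  (\int[mu]_(x in D) `|(f \_ Omega) x|%:E <= \int[mu]_(x in Omega) `|f x|%:E)%E.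
Proof.
move=> mD mf; have mg : measurable_fun setT (fun x => `|(f \_ Omega) x|%:E).
  apply/measurable_EFinP; apply: measurableT_comp => //.
  exact: (measurable_restrictT _ mO).1.
apply: (@le_trans _ _ (\int[mu]_x `|(f \_ Omega) x|%:E)%E).
  by apply: ge0_subset_integral.
rewrite [leRHS]integral_mkcond le_eqVlt; apply/orP; left; apply/eqP.
by apply: eq_integral => x _; rewrite /patch; case: ifP => // _; rewrite normr0.
Qed.

(** There are countably many cells, components and signs, and each of the sequences is
    bounded: for the components of phi, by the Poincare inequality. *)
Lemma cell_extraction : exists (h : nat -> nat) (L : seq bool -> 'I_N -> R)
    (M : bool -> seq bool -> 'I_N -> 'I_n -> R), [/\ forall m, (m <= h m)%N,
  forall w i, (fun k => \int[mu]_(x in cell w) phi (h k) x 0 i) @ \oo --> L w i &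
  forall s w i j, (fun k => \int[mu]_(x in cell w)
    ((signed_part s (fun x => G_ (h k) x i j)) \_ Omega) x) @ \oo --> M s w i j].
Proof.
pose a1 w i k := \int[mu]_(x in cell w) phi k x 0 i.
pose a2 s w i j k := \int[mu]_(x in cell w)
    ((signed_part s (fun x => G_ k x i j)) \_ Omega) x.
pose a (c : seq bool * 'I_N + bool * seq bool * 'I_N * 'I_n) := match c with
  | inl (w, i) => a1 w i | inr (s, w, i, j) => a2 s w i j end.
have mc w : measurable (cell w) by exact: measurable_cell.
have [[[w i]|[[[s w] i] j]]|h [L [hm hL]]] := @extraction_countable _ a.
- exists (3 * K * B) => k; apply: Rintegral_abs_le => //.
    exact: (Cc_cell_integrable boundedO K w (Cphi k i)).
  have [sp _ _] := Cphi k i.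
  apply: (@le_trans _ _ (\int[mu]_(x in Omega) `|phi k x 0%R i|%:E)%E).
    have mp : measurable_fun Omega (fun x => phi k x 0 i).
      by apply: measurable_funTS; apply: continuous_measurable_mx; exact: smooth_cont.
    have := integral_sub_restrict (mc w) mp.
    rewrite (_ : (fun x => phi k x 0 i) \_ Omega = (fun x => phi k x 0 i))//.
    apply/funext => x; rewrite /patch; case: ifPn => // /negP xO.
    by rewrite (Cc_eq0 (Cphi k i))// => h; apply: xO; rewrite inE.
  apply: le_trans (poincare n_gt0 openO K0 OK (Cphi k i)) _.
  rewrite [leRHS]EFinM; apply: lee_wpmul2l; last exact: phiB.
  by rewrite lee_fin mulr_ge0// ltW.
- exists B => k.
  have iG := signed_part_integrable s mO ((Lp1P _ mO).1 (LG k) i j).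
  apply: Rintegral_abs_le => //.
    have := (integrable_mkcond (mu := mu) _ mO).1 iG.
    by rewrite restrict_EFin; apply: integrableS.
  apply: le_trans (integral_sub_restrict (mc w) _) _.
    by apply/measurable_EFinP; case/integrableP: iG.
  have mG : measurable_fun Omega (fun x => G_ k x i j).
    by apply: measurable_fun_entry; exact: (LG k).1.
  apply: le_trans (GB k); apply: le_trans (entry_Lpnorm i j (LG k).1).
  apply: ge0_le_integral.
  + exact: mO.
  + by move=> x _; rewrite lee_fin.
  + by apply/measurable_EFinP; apply: measurableT_comp => //;
      apply/measurable_EFinP; case/integrableP: iG.
  + by apply/measurable_EFinP; exact: measurableT_comp.
  + by move=> x _; rewrite lee_fin; exact: signed_part_le.
exists h, (fun w i => L (inl (w, i))), (fun s w i j => L (inr (s, w, i, j))).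
by split=> [//|w i|s w i j]; [exact: (hL (inl (w, i)))|exact: (hL (inr (s, w, i, j)))].
Qed.

End subsequence.

(** Together with [entry_Lpnorm], this reduces L^1 convergence to that of the entries. *)
Lemma Lpnorm1_le_entries k l (f : 'rV[R]_n -> 'M[R]_(k, l)) : measurable_fun Omega f ->
  (Lpnorm Omega 1 f <= \sum_i \sum_j \int[mu]_(x in Omega) `|f x i j|%:E)%E.
Proof.
move=> mf.
have me i j : measurable_fun Omega (fun x => `|f x i j|%:E).
  by apply/measurable_EFinP; apply: measurableT_comp => //; exact: measurable_fun_entry.
under eq_bigr => i _.
  rewrite -ge0_integral_sum; [over|exact: mO|exact: me|by []].
have ms i : measurable_fun Omega (fun x => (\sum_j `|f x i j|%:E)%E).
  by apply: emeasurable_sum => j _; exact: me.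
rewrite -ge0_integral_sum; [|exact: mO|exact: ms|]; last first.
  by move=> i x _; apply: sume_ge0.
rewrite Lpnorm1E; apply: ge0_le_integral.
- exact: mO.
- by move=> x _; rewrite lee_fin enorm_ge0.
- by apply/measurable_EFinP; exact: measurable_fun_enorm.
- by apply: emeasurable_sum => i _; exact: ms.
move=> x _; under eq_bigr do rewrite sumEFin.
by rewrite sumEFin lee_fin; exact: enorm_le_sum.
Qed.

(** Convergence of the cell integrals along a subsequence gives strong L^1 convergence of
    phi, because its gradients are bounded, and a vague limit of each entry of the
    gradients G_. That this limit is the derivative of the limit function is seen by
    passing to the limit in the integration by parts of u_. *)
Theorem BV_compactness : exists (h : nat -> nat) (u : 'rV[R]_n -> 'rV[R]_N),
  (forall m, (m <= h m)%N) /\ BV_weak_star_cvg Omega (u_ \o h) u.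
Proof.
have [K K0 OK] := bounded_sub_cube boundedO.
have [h [L [M [hm hL hM]]]] := cell_extraction K0 OK.
have ex (i : 'I_N) : exists v : 'rV[R]_n -> R, mu.-integrable Omega (EFin \o v) /\
    (fun k => \int[mu]_(x in Omega) `|phi (h k) x 0%R i - v x|%:E)%E @ \oo --> 0%E.
  have Cauchy := rellich_cauchy n_gt0 openO boundedO K0 OK (fun k => Cphi (h k) i)
    (fun k => phiB (h k) i) (hL^~ i).
  have [|v iv vP] := L1_complete mO _ Cauchy; last by exists v.
  by move=> k; exact: (Cc_integrable openO boundedO (Cphi (h k) i)).
have [v vP] := choice ex.
pose u x := u0 x + \row_i v i x.
have Luu : Lp Omega 1 u.
  apply/(Lp1P _ mO) => i0 i; rewrite ord1.
  rewrite (_ : (fun x => _) = (fun x => (u0 x 0%R i)%:E + (v i x)%:E)%E).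
    exact: (integrableD mO ((Lp1P _ mO).1 Lu0 0 i) (vP i).1).
  by apply/funext => x; rewrite !mxE.
have hoo : h @ \oo --> \oo.
  by apply/cvgnyPge => A; exists A => // k /= /leq_trans; apply.
have cu : (fun k => Lpnorm Omega 1 (u_ (h k) \- u)) @ \oo --> 0%E.
  pose b k := (\sum_(i < N) (Lpnorm Omega 1 (fun x => u_ (h k) x - u0 x - phi (h k) x)%R +
    \int[mu]_(x in Omega) `|phi (h k) x 0%R i - v i x|%:E))%E.
  have b0 : b @ \oo --> 0%E.
    rewrite [X in _ --> X](_ : _ = (\sum_(i < N) (0 + 0))%E); last first.
      by rewrite big1// => i _; rewrite adde0.
    apply: cvg_nnesum => i _.
      by apply: nearW => k; rewrite adde_ge0 ?Lpnorm_ge0//; exact: integral_ge0.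
    apply: cvgeD; [by []|exact: (cvg_comp _ _ hoo uphi)|exact: (vP i).2].
  apply: squeeze_cvge (cvg_cst 0%E) b0; apply: nearW => k; rewrite Lpnorm_ge0/=.
  have m1 : measurable_fun Omega (fun x => u_ (h k) x - u0 x - phi (h k) x).
    apply: measurable_fun_mx => i0 i.
    rewrite (_ : (fun x => _) = (fun x => u_ (h k) x i0 i - u0 x i0 i - phi (h k) x i0 i)).
      apply: measurable_funB.
        by apply: measurable_funB; apply: measurable_fun_entry; [exact: (Lu _).1|exact: Lu0.1].
      rewrite ord1; apply: measurable_funTS; apply: continuous_measurable_mx.
      by have [sp _ _] := Cphi (h k) i; exact: smooth_cont sp.
    by apply/funext => x; rewrite !mxE.
  have m2 : measurable_fun Omega (u_ (h k) \- u).
    apply: measurable_fun_mx => i0 i.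
    rewrite (_ : (fun x => _) = (fun x => u_ (h k) x i0 i - u x i0 i)).
      by apply: measurable_funB; apply: measurable_fun_entry; [exact: (Lu _).1|exact: Luu.1].
    by apply/funext => x; rewrite !mxE.
  apply: le_trans (Lpnorm1_le_entries m2) _; rewrite exchange_big /=.
  apply: lee_sum => i _; rewrite big_ord1.
  apply: le_trans (leeD (entry_Lpnorm 0 i m1) (lexx _)).
  have mv : measurable_fun Omega (v i).
    by apply/measurable_EFinP; case/integrableP: (vP i).1.
  have mp : measurable_fun Omega (fun x => phi (h k) x 0 i).
    apply: measurable_funTS; apply: continuous_measurable_mx.
    by have [sp _ _] := Cphi (h k) i; exact: smooth_cont sp.
  have ma : measurable_fun Omega
      (fun x => `|(u_ (h k) x - u0 x - phi (h k) x)%R 0%R i|%:E).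
    by apply/measurable_EFinP; apply: measurableT_comp => //; exact: measurable_fun_entry.
  have mb : measurable_fun Omega (fun x => `|phi (h k) x 0%R i - v i x|%:E).
    by apply/measurable_EFinP; apply: measurableT_comp => //; exact: measurable_funB.
  rewrite -ge0_integralD; [|exact: mO|by []|exact: ma|by []|exact: mb].
  apply: ge0_le_integral.
  - exact: mO.
  - by [].
  - by apply/measurable_EFinP; apply: measurableT_comp => //; exact: measurable_fun_entry.
  - exact: emeasurable_funD.
  move=> x _; rewrite -EFinD lee_fin; apply: le_trans (ler_normD _ _).
  rewrite le_eqVlt; apply/orP; left; apply/eqP; congr (`|_|).
  by rewrite /u !mxE; ring.
have exD (ij : 'I_N * 'I_n) : exists nu : {charge set 'rV[R]_n -> \bar R},
    forall psi, C0 Omega psi ->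
    (fun k => \int[mu]_(x in Omega) (psi x * G_ (h k) x ij.1 ij.2)) @ \oo -->
    charge_integral nu Omega psi.
  apply: (signed_vague_limit n_gt0 openO K0 OK (G := fun k x => G_ (h k) x ij.1 ij.2)).
    by move=> k; exact: ((Lp1P _ mO).1 (LG (h k)) ij.1 ij.2).
  by move=> s w; exact: hM.
have [D DP] := choice exD.
have uD : is_derivative_measure Omega u (fun i j => D (i, j)).
  move=> psi Cp i j.
  have c1 := L1_test_cvg openO (i := i) (fun k => Lp1_L1loc openO (Lu (h k)))
    (Lp1_L1loc openO Luu) cu (Cc_pderive j Cp).
  apply: (cvg_unique _ c1); first exact: norm_hausdorff.
  rewrite (_ : (fun k => _) = (fun k => - \int[mu]_(x in Omega) (psi x * G_ (h k) x i j))).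
    by apply: cvgN; exact: (DP (i, j) psi (Cc_C0 Cp)).
  apply/funext => k; have [_ _ ->//] := uG (h k).
  by congr (- _); apply: eq_Rintegral => x _; rewrite mulrC.
have [Du_ Du_P] := choice (fun k => let: ex_intro2 E h1 h2 :=
  weak_gradient_measure (uG (h k)) (LG (h k)) in ex_intro (fun E => _ /\ _) E (conj h1 h2)).
exists h, u; split=> //; split.
- by move=> k; exact: weak_gradient_BV (uG (h k)) (Lu (h k)) (LG (h k)).
- by split=> //; exists (fun i j => D (i, j)).
- exact: cu.
exists Du_, (fun i j => D (i, j)); split=> // [k|i j psi C0psi].
  exact: (Du_P k).1.
rewrite (_ : (fun k => _) = (fun k => \int[mu]_(x in Omega) (psi x * G_ (h k) x i j))).
  exact: (DP (i, j)).
by apply/funext => k; rewrite (Du_P k).2.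
Qed.

End derivative_measures.

(** * The Dirichlet problem and its relaxation *)

Section relaxation.
Context {R : realType} {n N : nat}.
Hypothesis n_gt0 : (0 < n)%N.
Local Notation mu := (@lebesgue_rV R n).
Variables (Omega : set 'rV[R]_n) (q : R) (u0 : 'rV[R]_n -> 'rV[R]_N).
Hypothesis openO : open Omega.
Let mO : measurable Omega := open_measurable_mx openO.
Hypothesis boundedO : bounded_set Omega.
Hypothesis q1 : 1 <= q.
Hypothesis u0W : W1q Omega q u0.

Let Ofin : (mu Omega < +oo)%E := bounded_lebesgue_lty mO boundedO.
Let q0 : q != 0. Proof. by rewrite gt_eqF// (lt_le_trans _ q1). Qed.

Lemma W1q_L1 (u : 'rV[R]_n -> 'rV[R]_N) : W1q Omega q u ->
  exists2 G, is_weak_gradient Omega u G & Lp Omega 1 u /\ Lp Omega 1 G.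
Proof.
move=> [Lu [G uG LG]]; exists G => //.
by split; [exact: Lp_L1 Lu|exact: Lp_L1 LG].
Qed.

Lemma W1q_lin (a b : R) (u v : 'rV[R]_n -> 'rV[R]_N) :
  W1q Omega q u -> W1q Omega q v -> W1q Omega q (fun x => a *: u x + b *: v x).
Proof.
move=> [Lu [G uG LG]] [Lv [H vH LH]]; split; first exact: Lp_lin.
by exists (fun x => a *: G x + b *: H x); [exact: is_weak_gradient_lin|exact: Lp_lin].
Qed.

Lemma dirichlet_W1q u : dirichlet_class Omega q u0 u -> W1q Omega q u.
Proof.
move=> [W _]; have := W1q_lin 1 1 W u0W.
by congr W1q; apply/funext => x; rewrite !scale1r /= subrK.
Qed.

Lemma Lpnorm0 k l (f : 'rV[R]_n -> 'M[R]_(k, l)) : (forall x, f x = 0) ->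
  Lpnorm Omega q f = 0%E.
Proof.
move=> f0; rewrite /Lpnorm (_ : _ \_ Omega = cst 0%E).
  by rewrite Lnorm0// eqe.
by apply/funext => x; rewrite /patch; case: ifP => // _; rewrite f0 enorm0.
Qed.

Lemma dirichlet_u0 : dirichlet_class Omega q u0 u0.
Proof.
have W0 : W1q Omega q (u0 \- u0).
  have := W1q_lin 1 (-1) u0W u0W; congr W1q.
  by apply/funext => x; rewrite !scaleN1r scale1r.
split=> // e e0; exists (fun=> 0).
  by move=> i; rewrite (_ : (fun x => _) = cst 0); [exact: Cc_smooth0|apply/funext => x; rewrite mxE].
have E0 : (u0 \- u0) \- (fun=> 0) = (fun=> 0) :> ('rV[R]_n -> 'rV[R]_N).
  by apply/funext => x /=; rewrite subrr subr0.
rewrite /W1q_norm E0 Lpnorm0// add0e.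
have [_ [G uG _]] := u0W.
have := is_weak_gradient_lin openO 1 (-1) uG uG.
rewrite (_ : (fun x => _ : 'rV[R]_N) = (fun=> 0)); last first.
  by apply/funext => x; rewrite scaleN1r scale1r subrr.
move=> /(Lpnorm_weak_gradient openO q0) ->; rewrite Lpnorm0 ?lte_fin//.
by move=> x; rewrite scaleN1r scale1r subrr.
Qed.

(** Approximation in the W^{1,q} norm implies approximation of the functions and of the
    gradients in L^1, with smallness independent of the function approximated. *)
Lemma dirichlet_approx u G G0 (d : R) : 0 < d -> dirichlet_class Omega q u0 u ->
  is_weak_gradient Omega u G -> is_weak_gradient Omega u0 G0 ->
  exists phi : 'rV[R]_n -> 'rV[R]_N, [/\ forall i, Cc_smooth Omega (fun x => phi x 0 i),
    (Lpnorm Omega 1 (fun x => u x - u0 x - phi x)%R < d%:E)%E &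
    (Lpnorm Omega 1 (fun x => G x - G0 x - classical_gradient phi x)%R < d%:E)%E].
Proof.
move=> d0 [_ uapp] uG uG0.
have [e1 e10 e1P] := Lp_small (k := 1) (l := N) mO Ofin q1 d0.
have [e2 e20 e2P] := Lp_small (k := N) (l := n) mO Ofin q1 d0.
have e0 : 0 < Num.min e1 e2 by rewrite lt_min e10.
have [phi Cphi] := uapp _ e0; rewrite /W1q_norm => small.
have wphi := is_weak_gradient_Cc openO boundedO Cphi.
have w := is_weak_gradient_lin openO 1 (-1) (is_weak_gradient_lin openO 1 (-1) uG uG0) wphi.
rewrite [X in is_weak_gradient _ X](_ : _ = (fun x => u x - u0 x - phi x)) in w; last first.
  by apply/funext => x; rewrite !scaleN1r !scale1r.
rewrite [X in is_weak_gradient _ _ X](_ : _ = (fun x => G x - G0 x - classical_gradient phi x)) in w; last first.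
  by apply/funext => x; rewrite !scaleN1r !scale1r.
rewrite (Lpnorm_weak_gradient openO q0 w) in small.
have [[mu1 _] [mG1 _] _] := w.
exists phi; split=> //.
- apply: e1P => //; apply: le_lt_trans (lt_le_trans small _).
    by rewrite leeDl// Lpnorm_ge0.
  by rewrite lee_fin ge_min lexx.
- apply: e2P => //; apply: le_lt_trans (lt_le_trans small _).
    by rewrite leeDr// Lpnorm_ge0.
  by rewrite lee_fin ge_min lexx orbT.
Qed.

Variables (F : 'M[R]_(N, n) -> R) (gamma Gamma : R).
Hypothesis gamma_gt0 : 0 < gamma.
Hypothesis cF : continuous F.
Hypothesis convF : convex_function [set: 'M[R]_(N, n)] F.
Hypothesis F_growth : forall z : 'M[R]_(N, n),
    gamma * enorm z <= F z <= Gamma * (1 + enorm z `^ q).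

Let F0 z : 0 <= F z.
Proof.
have /andP[h _] := F_growth z; apply: le_trans h.
by rewrite mulr_ge0 ?enorm_ge0// ltW.
Qed.

Lemma energy_ge0 u : (0 <= energy F Omega u)%E.
Proof. by apply: integral_ge0 => x _; rewrite lee_fin. Qed.

Lemma energy_lsc u_ u : (forall k, dirichlet_class Omega q u0 (u_ k)) ->
  dirichlet_class Omega q u0 u ->
  (fun k => Lpnorm Omega 1 (u_ k \- u)) @ \oo --> 0%E ->
  (energy F Omega u <= limn_einf (fun k => energy F Omega (u_ k)))%E.
Proof.
move=> D_ D cu.
have [a [B [le sup]]] := convex_sup_affine convF cF.
have [G uG [_ LG]] := W1q_L1 (dirichlet_W1q D).
have [H uH] := choice (fun k => let: ex_intro2 H h _ :=
  W1q_L1 (dirichlet_W1q (D_ k)) in ex_intro _ H h).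
rewrite (energyE openO cF F0 uG).
rewrite (_ : (fun k => _) = (fun k => \int[mu]_(x in Omega) (F (H k x))%:E)%E).
  exact: (convex_lsc openO boundedO F0 cF le sup LG Ofin uG uH cu).
by apply/funext => k; rewrite (energyE openO cF F0 (uH k)).
Qed.

(** The constant sequence at u gives one inequality, lower semicontinuity the other. *)
Lemma relaxed_energyE u : dirichlet_class Omega q u0 u ->
  energy F Omega u = relaxed_energy F Omega q u0 u.
Proof.
move=> D; apply/eqP; rewrite eq_le; apply/andP; split.
  apply/ereal_infP => _ [u_ [D_ [_ _ cu _] ->]]; exact: energy_lsc.
apply: ereal_inf_lbound; exists (fun=> u); split=> //; last first.
  by rewrite (cvg_limn_einf_sup (cvg_cst _)).1.
have [G uG [Lu LG]] := W1q_L1 (dirichlet_W1q D).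
have bv := weak_gradient_BV n_gt0 openO boundedO uG Lu LG.
have [Du uD _] := weak_gradient_measure n_gt0 openO boundedO uG LG.
split=> //; last by exists (fun=> Du), Du; split=> // i j phi _; exact: cvg_cst.
rewrite (_ : (fun=> _) = cst 0%E); first exact: cvg_cst.
apply/funext => k; rewrite Lpnorm1E integral0_eq// => x Ox.
by rewrite /= subrr enorm0.
Qed.

Local Notation m := (ereal_inf [set energy F Omega v | v in dirichlet_class Omega q u0]).

Lemma infimum_ge0 : (0 <= m)%E.
Proof. by apply/ereal_infP => _ [u _ <-]; exact: energy_ge0. Qed.

Lemma infimum_lty : (m < +oo)%E.
Proof.
have [_ [G uG [mG LG]]] := u0W.
have q_gt0 : 0 < q by rewrite (lt_le_trans _ q1).
have mGq := measurable_enorm_powR q mG.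
apply: (@le_lt_trans _ _ (energy F Omega u0)).
  by apply: ereal_inf_lbound; exists u0 => //; exact: dirichlet_u0.
rewrite (energyE openO cF F0 uG).
have Gamma0 : 0 <= Gamma.
  have /andP[h1 h2] := F_growth 0.
  have := le_trans h1 h2; rewrite enorm0 mulr0 powR0// addr0 mulr1; exact.
apply: (@le_lt_trans _ _ (\int[mu]_(x in Omega) (Gamma%:E * (1 + (enorm (G x) `^ q)%:E)))%E).
  apply: ge0_le_integral.
  - exact: mO.
  - by move=> x _; rewrite lee_fin.
  - apply/measurable_EFinP; exact: (measurableT_comp (continuous_measurable_mx cF) mG).
  - by apply: measurable_funeM; exact: emeasurable_funD.
  by move=> x _; rewrite -EFinD -EFinM lee_fin; have /andP[] := F_growth (G x).
have p0 x : Omega x -> (0 <= (enorm (G x) `^ q)%:E)%E.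
  by move=> _; rewrite lee_fin powR_ge0.
rewrite ge0_integralZl_EFin; [|exact: mO| |exact: emeasurable_funD|exact: Gamma0]; last first.
  by move=> x Ox; apply: adde_ge0 => //; exact: p0.
have GqE := (Lpnorm_ltyP Omega G q_gt0).1 LG.
rewrite ge0_integralD; [|exact: mO|by []|by []|exact: p0|exact: mGq].
rewrite integral_cst// mul1e.
apply: lte_mul_pinfty; [by rewrite lee_fin|by []|exact: lte_add_pinfty].
Qed.

Lemma relaxed_ge u : (m <= relaxed_energy F Omega q u0 u)%E.
Proof.
apply/ereal_infP => _ [u_ [D_ _ ->]].
apply: (@limn_einf_ge_cvg _ _ (cst m)); last exact: cvg_cst.
by move=> k; apply: ereal_inf_lbound; exists (u_ k).
Qed.

Lemma coercive_bound u G (b : R) : is_weak_gradient Omega u G ->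
  (energy F Omega u <= b%:E)%E -> (Lpnorm Omega 1 G <= (b / gamma)%:E)%E.
Proof.
move=> uG; rewrite (energyE openO cF F0 uG) => Eb.
have [_ [mG _] _] := uG.
have me : measurable_fun Omega (fun x => (enorm (G x))%:E).
  by apply/measurable_EFinP; exact: measurable_fun_enorm.
rewrite mulrC EFinM lee_pdivlMl// Lpnorm1E; apply: le_trans Eb.
rewrite -ge0_integralZl_EFin; [|exact: mO| |exact: me|exact: ltW]; last first.
  by move=> x _; rewrite lee_fin enorm_ge0.
apply: ge0_le_integral.
- exact: mO.
- by move=> x _; rewrite -EFinM lee_fin mulr_ge0 ?enorm_ge0// ltW.
- exact: measurable_funeM.
- by apply/measurable_EFinP; exact: (measurableT_comp (continuous_measurable_mx cF) mG).
- by move=> x _; rewrite -EFinM lee_fin; have /andP[] := F_growth (G x).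
Qed.

Lemma gradient_mass_bound (G G0 : 'rV[R]_n -> 'M[R]_(N, n)) (phi : 'rV[R]_n -> 'rV[R]_N)
    (i : 'I_N) (a b c : R) :
  measurable_fun Omega G -> measurable_fun Omega G0 ->
  (forall i, Cc_smooth Omega (fun x => phi x 0 i)) ->
  (Lpnorm Omega 1 G <= a%:E)%E -> (Lpnorm Omega 1 G0 <= b%:E)%E ->
  (Lpnorm Omega 1 (fun x => G x - G0 x - classical_gradient phi x)%R <= c%:E)%E ->
  (gradient_mass (fun x => phi x 0%R i) Omega <= (n%:R * (a + b + c))%:E)%E.
Proof.
move=> mG mG0 Cphi Ga G0b Dc.
have mphi : measurable_fun Omega (classical_gradient phi).
  apply: measurable_fun_mx => i0 j; rewrite /classical_gradient.
  under eq_fun do rewrite mxE.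
  apply: measurable_funTS; apply: continuous_measurable_mx.
  by have [sp _ _] := Cphi i0; exact: smooth_cont (smooth_pderive j sp).
pose D := fun x => G x - G0 x - classical_gradient phi x.
have mD : measurable_fun Omega D.
  apply: measurable_fun_mx => i0 j.
  rewrite (_ : (fun x => _) = (fun x => G x i0 j - G0 x i0 j - classical_gradient phi x i0 j)).
    apply: measurable_funB; last exact: measurable_fun_entry.
    by apply: measurable_funB; exact: measurable_fun_entry.
  by apply/funext => x; rewrite /D !mxE.
have me (H : 'rV[R]_n -> 'M[R]_(N, n)) j : measurable_fun Omega H ->
    measurable_fun Omega (fun x => `|H x i j|%:E).
  by move=> mH; apply/measurable_EFinP; apply: measurableT_comp => //; exact: measurable_fun_entry.
rewrite /gradient_mass.
apply: (@le_trans _ _ (\sum_(j < n) (a + b + c)%:E)%E); last first.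
  by rewrite sumEFin sumr_const card_ord mulr_natl.
apply: lee_sum => j _; rewrite !EFinD.
apply: le_trans (leeD (leeD (le_trans (entry_Lpnorm openO i j mG) Ga)
  (le_trans (entry_Lpnorm openO i j mG0) G0b)) (le_trans (entry_Lpnorm openO i j mD) Dc)).
have mGG0 := emeasurable_funD (me _ j mG) (me _ j mG0).
rewrite -ge0_integralD; [|exact: mO|by []|exact: me|by []|exact: me].
rewrite -ge0_integralD; [|exact: mO| |exact: mGG0|by []|exact: me]; last first.
  by move=> x _; rewrite -EFinD lee_fin addr_ge0.
apply: ge0_le_integral.
- exact: mO.
- by [].
- by apply: pderive_measurable; case: (Cphi i).
- by apply: emeasurable_funD; [exact: mGG0|exact: me].
move=> x _; rewrite -!EFinD lee_fin.
have -> : pderive j (fun x => phi x 0 i) x = G x i j - G0 x i j - D x i j.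
  by rewrite /D /classical_gradient !mxE; ring.
apply: le_trans (ler_normB _ _) _; rewrite lerD2r; exact: ler_normB.
Qed.

(** The limit of a minimizing sequence. Coercivity bounds the gradients in L^1, and
    with them those of the test functions that approximate u_k - u0; the errors made
    in this approximation are at most 1/(k+1) and disappear in the limit. *)
Lemma relaxed_minimizer : exists2 u, BV Omega u & relaxed_energy F Omega q u0 u = m.
Proof.
have mfin : m \is a fin_num by rewrite ge0_fin_numE ?infimum_ge0// infimum_lty.
pose d k : R := k.+1%:R^-1.
have d0 k : 0 < d k by rewrite invr_gt0 ltr0n.
have d1 k : d k <= 1 by rewrite invf_le1 ?ltr0n// ler1n.
have ex1 k : exists u, dirichlet_class Omega q u0 u /\ (energy F Omega u < m + (d k)%:E)%E.
  by have [_ [u Du <-] Eu] := lb_ereal_inf_adherent (d0 k) mfin; exists u.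
have [u_ u_P] := choice ex1.
have ex2 k : exists G, [/\ is_weak_gradient Omega (u_ k) G, Lp Omega 1 (u_ k) & Lp Omega 1 G].
  by have [G uG [Lu LG]] := W1q_L1 (dirichlet_W1q (u_P k).1); exists G.
have [G_ G_P] := choice ex2.
have [G0 uG0 [Lu0 LG0]] := W1q_L1 u0W.
have uG k : is_weak_gradient Omega (u_ k) (G_ k) by case: (G_P k).
have [phi phiP] := choice (fun k => dirichlet_approx (d0 k) (u_P k).1 (uG k) uG0).
pose M := fine m.
have mE : m = M%:E by rewrite fineK.
pose a := (M + 1) / gamma.
have Ga k : (Lpnorm Omega 1 (G_ k) <= a%:E)%E.
  apply: coercive_bound (uG k) _; apply: ltW; apply: lt_le_trans (u_P k).2 _.
  by rewrite mE -EFinD lee_fin lerD2l.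
pose b := fine (Lpnorm Omega 1 G0).
have G0b : (Lpnorm Omega 1 G0 <= b%:E)%E.
  by rewrite fineK// ge0_fin_numE ?Lpnorm_ge0//; exact: LG0.2.
have a0 : 0 <= a by rewrite -lee_fin (le_trans _ (Ga 0%N))// Lpnorm_ge0.
have b0 : 0 <= b by rewrite -lee_fin (le_trans _ G0b)// Lpnorm_ge0.
have n1 : 1 <= n%:R :> R by rewrite ler1n.
have massB k i : (gradient_mass (fun x => phi k x 0%R i) Omega <= (n%:R * (a + b + 1))%:E)%E.
  have [Cphi _ /ltW small] := phiP k; have [_ _ [mG _]] := G_P k.
  apply: gradient_mass_bound mG LG0.1 Cphi (Ga k) G0b (le_trans small _).
  by rewrite lee_fin.
have GB k : (Lpnorm Omega 1 (G_ k) <= (n%:R * (a + b + 1))%:E)%E.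
  by apply: le_trans (Ga k) _; rewrite lee_fin; nra.
have near_d e : 0 < e -> \forall k \near \oo, d k <= e.
  move=> e0; have := near_infty_natSinv_lt (PosNum e0); apply: filterS => k.
  exact: ltW.
have uphi : (fun k => Lpnorm Omega 1 (fun x => u_ k x - u0 x - phi k x)) @ \oo --> 0%E.
  apply: ge0_cvge0 => [k|e e0]; first exact: Lpnorm_ge0.
  apply: filterS (near_d e e0) => k dk; have [_ /ltW small _] := phiP k.
  by apply: le_trans small _; rewrite lee_fin.
have [h [u [hm cu]]] := BV_compactness n_gt0 openO boundedO uG
  (fun k => let: And3 _ x _ := G_P k in x) (fun k => let: And3 _ _ x := G_P k in x) Lu0
  (fun k => let: And3 x _ _ := phiP k in x) uphi massB GB.
exists u; first by case: cu.
apply/eqP; rewrite eq_le relaxed_ge andbT.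
apply: (@le_trans _ _ (limn_einf (fun k => energy F Omega (u_ (h k))))).
  by apply: ereal_inf_lbound; exists (u_ \o h); split=> // k; exact: (u_P (h k)).1.
apply/lee_addgt0Pr => e e0; apply: limn_einf_le.
apply: filterS (near_d e e0) => k dk; apply: ltW; apply: lt_le_trans (u_P (h k)).2 _.
rewrite leeD2l// lee_fin; apply: le_trans dk.
by rewrite /d lef_pV2 ?posrE ?ltr0n// ler_nat ltnS.
Qed.

End relaxation.
Theorem theorem4p4 (R : realType) (n N : nat) (n_gt0 : (0 < n)%N)
  (N_gt0 : (0 < N)%N) (Omega : set 'rV[R]_n) (q gamma Gamma : R)
  (u0 : 'rV[R]_n -> 'rV[R]_N) (F : 'M[R]_(N, n) -> R)
  (Omega_open : open Omega) (Omega_bounded : bounded_set Omega)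
  (Omega_lipschitz : lipschitz_boundary Omega)
  (q_ge1 : 1 <= q) (gamma_gt0 : 0 < gamma) (gamma_le : gamma <= Gamma)
  (u0_W1q : W1q Omega q u0)
  (F_continuous : continuous F)
  (F_convex : convex_function [set: 'M[R]_(N, n)] F)
  (F_growth : forall z : 'M[R]_(N, n),
    gamma * enorm z <= F z <= Gamma * (1 + enorm z `^ q)) :
  (forall u, dirichlet_class Omega q u0 u ->
     energy F Omega u = relaxed_energy F Omega q u0 u) /\
  (let m := ereal_inf [set energy F Omega v | v in dirichlet_class Omega q u0] in
   is_minimum (BV Omega) (relaxed_energy F Omega q u0) m /\
   (-oo < m < +oo)%E).
Proof.
split=> [u|m].
  exact: (relaxed_energyE n_gt0 Omega_open Omega_bounded q_ge1 u0_W1q gamma_gt0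
    F_continuous F_convex F_growth).
have [u BVu uE] := relaxed_minimizer n_gt0 Omega_open Omega_bounded q_ge1 u0_W1q
  gamma_gt0 F_continuous F_growth.
split; first by split; [exists u|move=> v _; exact: relaxed_ge].
apply/andP; split; last exact: (infimum_lty Omega_open Omega_bounded q_ge1 u0_W1q
  gamma_gt0 F_continuous F_growth).
by apply: lt_le_trans (infimum_ge0 Omega u0 gamma_gt0 F_growth); exact: ltNyr.
Qed.
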